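(* Let $\mathcal A:L^2([0,1]^N,\mathbb C^M)\to L^2([0,1]^N,\mathbb C^M)$ be an operator of the form $$\mathcal A\mathbf u=\mathbf A_0\mathbf u+\mathbf A_1\langle \mathbf u\rangle_1+\dots+\mathbf A_N\langle\mathbf u\rangle_{1,N},$$ where each $\mathbf A_j=\mathbf A_j(\mathbf k_j)$, $0\le j\le N$, is a continuous $M\times M$ matrix-valued function depending only on $\mathbf k_j=(k_{j+1},\dots,k_N)\in[0,1]^{N-j}$. Let $\mathcal I$ be the identity operator and let $\lambda\notin\sigma(\mathcal A)$. Then the following explicit formula for the inverse operator (resolvent) holds true: $$\mathcal R(\lambda)\equiv(\mathcal A-\lambda\mathcal I)^{-1}=\mathbf D_0\,\cdot-\mathbf H_1\mathbf A_1\langle\mathbf D_1\,\cdot\rangle_1-\dots-\mathbf H_N\mathbf A_N\langle\mathbf D_N\,\cdot\rangle_{1,N},$$ where the dot denotes the place of the operator argument $\mathbf u\in L^2([0,1]^N,\mathbb C^M)$, and the matrix-valued functions $\mathbf H$, $\mathbf D$ are defined by $$\mathbf H_{j+1}=(\overline{\mathbf G}_j\cdots\overline{\mathbf G}_0)^{-1},\qquad \mathbf D_j=(\mathbf G_0\cdots\mathbf G_j)^{-1},$$ with $\mathbf G_j$, $\overline{\mathbf G}_j$ as defined in the context. If all $\mathbf A_j^*=\mathbf A_j$ are self-adjoint and $\lambda\in\mathbb R\setminus\sigma(\mathcal A)$, then $\mathcal A$ and its resolvent are self-adjoint, and $$\mathcal R(\lambda)=\mathbf H_1\,\cdot-\sum_{r=1}^N\mathbf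 H_r\mathbf A_r\langle\mathbf H_{r+1}^*\,\cdot\rangle_{1,r}=\mathbf D_0\,\cdot-\sum_{r=1}^N\mathbf D_{r-1}^*\mathbf A_r\langle\mathbf D_r\,\cdot\rangle_{1,r}.$$
   Context: Notation: $N,M\ge1$ are integers; $\mathbf k=(k_1,\dots,k_N)\in[0,1]^N$, $\mathbf k_j=(k_{j+1},\dots,k_N)$, $\mathbf k_0=\mathbf k$; functions of $\mathbf k_N$ are constants. $\langle\cdot\rangle_{i,j}=\int_{[0,1]^{j-i+1}}\cdot\,dk_i\cdots dk_j$ for $j>i$, and $\langle\cdot\rangle_i=\langle\cdot\rangle_{i,i}=\int_0^1\cdot\,dk_i$ (entrywise integration). $\mathbf I$ is the $M\times M$ identity matrix, $^*$ is the Hermitian adjoint, and $\sigma(\mathcal A)$ is the spectrum of $\mathcal A$. The overline in $\overline{\mathbf G}_j$ is only part of the name and does not mean complex conjugation. Definitions: the matrix-valued continued fractions $\mathbf F_j=\mathbf F_j(\lambda,\mathbf k_j)$ are given by $\mathbf F_0=\mathbf A_0-\lambda\mathbf I$ and $\mathbf F_j=\mathbf A_j+\langle\mathbf F_{j-1}^{-1}\rangle_j^{-1}$ for $1\le j\le N$, where the inverses are matrix inverses. Further, $\mathbf G_0=\overline{\mathbf G}_0=\mathbf F_0$ and, for $j\ge1$, $$\mathbf G_j=\langle\mathbf F_{j-1}^{-1}\rangle_j\mathbf F_j=\mathbf I+\langle\mathbf F_{j-1}^{-1}\rangle_j\mathbf A_j,\qquad \overline{\mathbf G}_j=\mathbf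 F_j\langle\mathbf F_{j-1}^{-1}\rangle_j=\mathbf I+\mathbf A_j\langle\mathbf F_{j-1}^{-1}\rangle_j.$$ The matrix-valued functions $\mathbf G_j$ (and likewise $\overline{\mathbf G}_j$) determine the spectrum of $\mathcal A$: $\sigma(\mathcal A)=\bigcup_{j=0}^N\sigma_j$ with $\sigma_j=\{\lambda:\det\mathbf G_j(\lambda,\mathbf k_j)=0\text{ for some }\mathbf k_j\in[0,1]^{N-j}\}$, where the $\sigma_j$ are determined successively and $\mathbf G_j$ is considered for $\lambda\in\mathbb C\setminus(\sigma_0\cup\dots\cup\sigma_{j-1})$. *)

(* Defs.v *)
(* MathComp-Analysis, with mathcomp-real-closed for the complex numbers R[i]
   over R : realType. *)
From HB Require Import structures.
From mathcomp Require Export all_boot all_order all_algebra.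
From mathcomp Require Export spectral complex.
From mathcomp Require Export all_classical all_reals all_analysis.
Export numFieldNormedType.Exports.

Set Implicit Arguments.
Unset Strict Implicit.
Unset Printing Implicit Defensive.

Import Order.TTheory GRing.Theory Num.Theory.

Local Open Scope classical_set_scope.
Local Open Scope ring_scope.
Local Open Scope sesquilinear_scope.

(* The coordinates are typed in [measurableTypeR R], the copy of R on which
   [lebesgue_measure] is defined. *)
Notation point R n := (n.-tuple (measurableTypeR R)).

Section LebesgueMeasure.
Variable R : realType.

Definition cons_point n (p : measurableTypeR R * point R n) : point R n.+1 :=
  [tuple of p.1 :: p.2].

Definition uncons_point n (k : point R n.+1) : measurableTypeR R * point R n :=
  (thead k, [tuple of behead k]).

Lemma cons_pointK n : cancel (@cons_point n) (@uncons_point n).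
Proof. by move=> [x t]; congr (_, _) => //; apply/val_inj. Qed.

Lemma uncons_pointK n : cancel (@uncons_point n) (@cons_point n).
Proof. by move=> k; rewrite [RHS]tuple_eta. Qed.

Lemma measurable_cons_point n : measurable_fun setT (@cons_point n).
Proof. exact: measurable_cons. Qed.

Lemma measurable_uncons_point n : measurable_fun setT (@uncons_point n).
Proof.
apply/measurable_fun_pairP; split.
- exact: measurable_tnth.
- exact: measurable_behead.
Qed.

Section Step.
Variables (n : nat) (mu : {sigma_finite_measure set (point R n) -> \bar R}).

Definition lebesgue_step : set (point R n.+1) -> \bar R :=
  pushforward (lebesgue_measure \x mu)%E (@cons_point n).

Let preimage_cons A : measurable A -> measurable (@cons_point n @^-1` A).
Proof. by move=> mA; rewrite -[X in measurable X]setTI; exact: measurable_cons_point. Qed.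

Let lebesgue_step0 : lebesgue_step set0 = 0%E.
Proof. by rewrite /lebesgue_step /pushforward preimage_set0 measure0. Qed.

Let lebesgue_step_ge0 A : (0 <= lebesgue_step A)%E.
Proof. by rewrite /lebesgue_step /pushforward. Qed.

Let lebesgue_step_sigma_additive : semi_sigma_additive lebesgue_step.
Proof.
move=> F mF tF mUF; rewrite /lebesgue_step /pushforward preimage_bigcup.
apply: measure_semi_sigma_additive.
- by move=> i; exact: preimage_cons.
- apply/trivIsetP => /= i j _ _ ij; rewrite -preimage_setI.
  by move/trivIsetP : tF => /(_ _ _ _ _ ij) ->//; rewrite preimage_set0.
- by rewrite -preimage_bigcup; exact: preimage_cons.
Qed.

HB.instance Definition _ := isMeasure.Build _ _ _ lebesgue_step
  lebesgue_step0 lebesgue_step_ge0 lebesgue_step_sigma_additive.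

Let sigma_finite_lebesgue_step : sigma_finite setT lebesgue_step.
Proof.
have /sigma_finiteP[F [TF ndF Foo]] :=
  sigma_finiteT (lebesgue_measure : {sigma_finite_measure set _ -> \bar R}).
have /sigma_finiteP[G [TG ndG Goo]] := sigma_finiteT mu.
exists (fun i => @uncons_point n @^-1` (F i `*` G i)).
  rewrite -preimage_bigcup -[LHS](preimage_setT (@uncons_point n)).
  congr (_ @^-1` _); rewrite -setXTT TF TG predeqE => -[x y]; split.
    move=> [/= [i _ Fix] [j _ Gjy]]; exists (maxn i j) => //; split.
    - by move: x Fix; exact/subsetPset/ndF/leq_maxl.
    - by move: y Gjy; exact/subsetPset/ndG/leq_maxr.
  by move=> [i _ []/= ? ?]; split; exists i.
move=> i; have [mF Fi] := Foo i; have [mG Gi] := Goo i.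
have mFG : measurable (F i `*` G i) by exact: measurableX.
split.
  by rewrite -[X in measurable X]setTI; exact: measurable_uncons_point.
rewrite /lebesgue_step /pushforward -comp_preimage.
rewrite (_ : _ \o _ = id); last by apply/funext => p /=; rewrite cons_pointK.
by rewrite preimage_id product_measure1E// lte_mul_pinfty// ge0_fin_numE.
Qed.

HB.instance Definition _ :=
  Measure_isSigmaFinite.Build _ _ _ lebesgue_step sigma_finite_lebesgue_step.

End Step.

(* n-dimensional Lebesgue measure, as an iterated product. *)
Fixpoint lebesgue n : {sigma_finite_measure set (point R n) -> \bar R} :=
  if n is n'.+1 then lebesgue_step (lebesgue n')
  else \d_([tuple] : point R 0).

End LebesgueMeasure.

Definition cube (R : realType) n : set (point R n) :=
  [set k | forall i, 0 <= (tnth k i : R) <= 1].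
Arguments cube {R} n _.

(* Points carry the product sigma-algebra but no topology; [row_point]
   transports continuity from the normed space 'rV[R]_n. *)
Definition row_point (R : realType) n (x : 'rV[R]_n) : point R n :=
  [tuple (x ord0 i : measurableTypeR R) | i < n].

Definition continuous_on_cube (R : realType) n p q
    (B : point R n -> 'M[R[i]]_(p, q)) : Prop :=
  forall a b,
    {within @row_point R n @^-1` cube n,
      continuous (fun x : 'rV[R]_n => complex.Re (B (row_point x) a b))} /\
    {within @row_point R n @^-1` cube n,
      continuous (fun x : 'rV[R]_n => complex.Im (B (row_point x) a b))}.

Definition cube_integral (R : realType) n (f : point R n -> R[i]) : R[i] :=
  Complex (\int[lebesgue R n]_(t in cube n) complex.Re (f t))
          (\int[lebesgue R n]_(t in cube n) complex.Im (f t)).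

Section Mean.
Variables (R : realType) (N : nat).

(* The point k with its coordinates number i, ..., j (counted from 1) replaced
   by those of t. *)
Definition splice i j (k : point R N) (t : point R (j - i).+1) : point R N :=
  [tuple (if (i <= l.+1 <= j)%N then nth (0 : R) t (l.+1 - i)
          else tnth k l : measurableTypeR R) | l < N].

(* <f>_{i,j} for i <= j, still viewed as a function of all of k_1, ..., k_N;
   <f>_i is [mean i i f]. *)
Definition mean p q i j (f : point R N -> 'M[R[i]]_(p, q))
    (k : point R N) : 'M[R[i]]_(p, q) :=
  \matrix_(a, b) cube_integral (fun t => f (@splice i j k t) a b).

End Mean.

Section L2.
Variables (R : realType) (N M : nat).

(* Elements of L^2([0,1]^N, C^M) are represented by functions, and equality in
   L^2 by [eqL2]. Values outside the cube are irrelevant. *)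
Definition vecfun : Type := point R N -> 'cV[R[i]]_M.

Definition sqnorm (v : 'cV[R[i]]_M) : R :=
  \sum_a (complex.Re (v a ord0) ^+ 2 + complex.Im (v a ord0) ^+ 2).

Definition L2 : set vecfun := [set u : vecfun |
  (forall a, measurable_fun (cube N) (fun k => complex.Re (u k a ord0)) /\
             measurable_fun (cube N) (fun k => complex.Im (u k a ord0))) /\
  (\int[lebesgue R N]_(k in cube N) (sqnorm (u k))%:E < +oo)%E].

Definition eqL2 (u v : vecfun) : Prop := ae_eq (lebesgue R N) (cube N) u v.

Definition normL2 (u : vecfun) : R :=
  Num.sqrt (\int[lebesgue R N]_(k in cube N) sqnorm (u k)).

Definition innerL2 (u v : vecfun) : R[i] :=
  cube_integral (fun k => \sum_a u k a ord0 * (v k a ord0)^*).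

Definition bounded_operator (T : vecfun -> vecfun) : Prop :=
  [/\ forall u, L2 u -> L2 (T u),
      forall u v, L2 u -> L2 v -> eqL2 u v -> eqL2 (T u) (T v),
      forall (c : R[i]) u v, L2 u -> L2 v ->
        eqL2 (T (fun k => c *: u k + v k)) (fun k => c *: T u k + T v k) &
      exists K : R, forall u, L2 u -> normL2 (T u) <= K * normL2 u].

Definition bounded_inverse (T S : vecfun -> vecfun) : Prop :=
  bounded_operator S /\
  forall u, L2 u -> eqL2 (T (S u)) u /\ eqL2 (S (T u)) u.

Definition sub_scalar (T : vecfun -> vecfun) (lam : R[i]) : vecfun -> vecfun :=
  fun u k => T u k - lam *: u k.

Definition is_resolvent (T : vecfun -> vecfun) (lam : R[i])
    (S : vecfun -> vecfun) : Prop :=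
  bounded_inverse (sub_scalar T lam) S.

Definition spectrum (T : vecfun -> vecfun) : set R[i] :=
  [set lam | ~ exists S, is_resolvent T lam S].

Definition self_adjoint (T : vecfun -> vecfun) : Prop :=
  bounded_operator T /\
  forall u v, L2 u -> L2 v -> innerL2 (T u) v = innerL2 u (T v).

End L2.

Section Resolvent.
Variables (R : realType) (N M : nat).
Variable A : forall j, point R (N - j) -> 'M[R[i]]_M.

(* A_j(k_j), where k_j = (k_{j+1}, ..., k_N), as a function of the full k. *)
Definition coef j (k : point R N) : 'M[R[i]]_M := A [tuple of drop j k].

Definition operA : vecfun R N M -> vecfun R N M := fun u k =>
  coef 0 k *m u k + \sum_(1 <= j < N.+1) coef j k *m mean 1 j u k.

Variable lam : R[i].

(* F_j in terms of P = <F_{j-1}^{-1}>_j and B = A_j. *)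
Definition F_step (P B : 'M[R[i]]_M) : 'M[R[i]]_M := B + invmx P.

(* F_j^{-1} in terms of the same data. At points where P is singular, F_j has
   no finite value; F_j^{-1} is then given its continuous extension
   (I + P B)^{-1} P, see [Finv_stepE]. *)
Definition Finv_step (P B : 'M[R[i]]_M) : 'M[R[i]]_M :=
  if P \in unitmx then invmx (F_step P B) else invmx (1%:M + P *m B) *m P.

Fixpoint Finv j : point R N -> 'M[R[i]]_M :=
  if j is j'.+1 then
    fun k => Finv_step (mean j'.+1 j'.+1 (Finv j') k) (coef j'.+1 k)
  else fun k => invmx (coef 0 k - lam%:M).

Definition F j (k : point R N) : 'M[R[i]]_M :=
  if j is j'.+1 then F_step (mean j'.+1 j'.+1 (Finv j') k) (coef j'.+1 k)
  else coef 0 k - lam%:M.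

Definition G j (k : point R N) : 'M[R[i]]_M :=
  if j is j'.+1 then 1%:M + mean j'.+1 j'.+1 (Finv j') k *m coef j'.+1 k
  else F 0 k.

Definition Gbar j (k : point R N) : 'M[R[i]]_M :=
  if j is j'.+1 then 1%:M + coef j'.+1 k *m mean j'.+1 j'.+1 (Finv j') k
  else F 0 k.

Lemma Finv_stepE P B : 1%:M + P *m B \in unitmx ->
  Finv_step P B = invmx (1%:M + P *m B) *m P.
Proof.
rewrite /Finv_step /F_step; case: ifP => // uP uG.
have E : 1%:M + P *m B = P *m (B + invmx P).
  by rewrite mulmxDr mulmxV // addrC.
have uF : B + invmx P \in unitmx by move: uG; rewrite E unitmx_mul uP.
have : (1%:M + P *m B) *m invmx (B + invmx P) = P by rewrite E mulmxK.
by move=> {3}<-; rewrite mulKmx.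
Qed.

Lemma FinvE j k : mean j.+1 j.+1 (Finv j) k \in unitmx ->
  Finv j.+1 k = invmx (F j.+1 k).
Proof. by move=> uP; rewrite /= /Finv_step uP. Qed.

Lemma GE j k : mean j.+1 j.+1 (Finv j) k \in unitmx ->
  G j.+1 k = mean j.+1 j.+1 (Finv j) k *m F j.+1 k.
Proof. by move=> uP; rewrite /G /F /F_step mulmxDr mulmxV // addrC. Qed.

Lemma GbarE j k : mean j.+1 j.+1 (Finv j) k \in unitmx ->
  Gbar j.+1 k = F j.+1 k *m mean j.+1 j.+1 (Finv j) k.
Proof. by move=> uP; rewrite /Gbar /F /F_step mulmxDl mulVmx // addrC. Qed.

(* [H r] is H_r for r >= 1, i.e. (Gbar_{r-1} ... Gbar_0)^{-1}, and [D j] is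
   (G_0 ... G_j)^{-1}. *)
Definition H r (k : point R N) : 'M[R[i]]_M :=
  invmx (\big[mulmx/1%:M]_(0 <= i < r) Gbar (r.-1 - i) k).

Definition D j (k : point R N) : 'M[R[i]]_M :=
  invmx (\big[mulmx/1%:M]_(0 <= i < j.+1) G i k).

Definition resolvent_formula : vecfun R N M -> vecfun R N M := fun u k =>
  D 0 k *m u k - \sum_(1 <= r < N.+1)
    H r k *m coef r k *m mean 1 r (fun k' => D r k' *m u k') k.

Definition resolvent_formula_H : vecfun R N M -> vecfun R N M := fun u k =>
  H 1 k *m u k - \sum_(1 <= r < N.+1)
    H r k *m coef r k *m mean 1 r (fun k' => (H r.+1 k')^t* *m u k') k.

Definition resolvent_formula_D : vecfun R N M -> vecfun R N M := fun u k =>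
  D 0 k *m u k - \sum_(1 <= r < N.+1)
    (D r.-1 k)^t* *m coef r k *m mean 1 r (fun k' => D r k' *m u k') k.

End Resolvent.

(* Main.v *)
(** Let A^(j) be the operator A without the terms A_s <u>_{1,s}, s > j. If c does
not depend on k_1, ..., k_j, then (A^(j) - lam)(H_j c) = Gbar_j c, because the
tower property of the means gives <H_j>_{1,j} = <F_{j-1}^-1>_j.

Suppose that Gbar_j(k0) v = 0 with v <> 0. Let B be the set of the points whose
coordinates k_{j+1}, ..., k_N are within d of those of k0, and u = H_j (1_B v).
Then (A^(j) - lam) u = 1_B Gbar_j v is small by continuity, and each mean
<u>_{1,s} with s > j gains a factor d. So ||(A - lam) u|| <= o(1) ||u|| as
d -> 0, which is impossible when A - lam has a bounded inverse. Hence all the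
Gbar_j are invertible, and so are the G_j, because 1 + P B and 1 + B P are
invertible together.

The partial sums R_j of the formula then satisfy (A^(j) - lam) R_j f = f and
<R_j f>_{1,j} = <D_j f>_{1,j}, by induction on j and A_j G_j = Gbar_j A_j. If the
A_j are Hermitian and lam is real, then Gbar_j = G_j^* and H_{j+1} = D_j^*. *)

Require Import Defs.
From mathcomp Require Import ring lra measurable_realfun.

Set Implicit Arguments.
Unset Strict Implicit.
Unset Printing Implicit Defensive.

Import Order.TTheory GRing.Theory Num.Theory.
Local Open Scope classical_set_scope.
Local Open Scope ring_scope.
Local Open Scope sesquilinear_scope.

Local Notation Re := complex.Re.
Local Notation Im := complex.Im.

(** * Uniform continuity on the cube *)

Section UniformContinuity.
Variable R : realType.
Implicit Types n : nat.

(** Invertibility of the [Gbar j] cannot be shown for all [j] at once: F_{j-1}^-1, and with it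
    [Gbar j] and [H j], is known to be continuous only once the lower levels are invertible. Hence
    the levels already settled are carried along as a hypothesis. Moreover F_j has no finite value
    where P = <F_{j-1}^-1>_j is singular; with B = A_j, the proof works with [1 + P B], [1 + B P]
    and [(1 + P B)^-1 P] instead.

    Why H_j (1_B v): on functions H_j c the nonlocal operator A^(j) - lam acts as multiplication by
    Gbar_j, so a kernel vector at k0 can be localised there. For s > j the mean <.>_{1,s} runs over
    a localised coordinate, hence the factor d. For j = N no coordinate is left and H_N v is a true
    eigenvector.

    The formula is only computed to be a right inverse; the resolvent that exists by assumption then
    agrees with it.

    Points carry no topology, so continuity is used as uniform continuity on the cube, a form that
    averages visibly inherit. All means are reduced to means over the first coordinates: <.>_j is
    one of these on functions independent of k_1, ..., k_{j-1}. *)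

Definition ucont n (f : point R n -> R) := forall e : R, 0 < e ->
  exists2 d : R, 0 < d & forall k k' : point R n, cube n k -> cube n k' ->
    (forall i, `|(tnth k i : R) - (tnth k' i : R)| <= d) -> `|f k - f k'| <= e.

Lemma tnth_row_point n (x : 'rV[R]_n) i : tnth (row_point x) i = x ord0 i.
Proof. by rewrite tnth_mktuple. Qed.

Definition point_row n (k : point R n) : 'rV[R]_n := \row_i (tnth k i : R).

Lemma point_rowK n : cancel (@point_row n) (@row_point R n).
Proof. by move=> k; apply: eq_from_tnth => i; rewrite tnth_row_point mxE. Qed.

Lemma compact_row_cube n : compact (@row_point R n @^-1` cube n).
Proof.
have := @rV_compact R n (fun=> `[0, 1]%classic) (fun=> @segment_compact R 0 1).
congr compact; apply/seteqP; split=> x /= h i.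
  by have := h i; rewrite tnth_row_point in_itv /=.
by have := h i; rewrite tnth_row_point in_itv /=.
Qed.

Lemma ball_rV n (x y : 'rV[R]_n) (e : R) : 0 < e ->
  ball x e y <-> forall i, `|x ord0 i - y ord0 i| < e.
Proof.
move=> e0; split; first by move=> [_ h] i; have := h ord0 i.
by move=> h; split => // i j; rewrite (ord1 i); exact: h.
Qed.

(** Heine-Cantor in near-covering form: around each [x] every small [d > 0] is a modulus for all
    nearby [x'], and compactness of the cube makes one [d] serve all points. *)
Lemma within_ucont n (f : point R n -> R) :
  {within @row_point R n @^-1` cube n, continuous (f \o @row_point R n)} ->
  ucont f.
Proof.
set K := _ @^-1` _ => fc e e0.
have e20 : 0 < e / 2 by rewrite divr_gt0.
have /compact_near_coveringP near_cover := @compact_row_cube n.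
have H : forall x : 'rV_n, K x -> \forall x' \near x & d \near 0^'+,
  K x' -> forall y, K y -> (forall i, `|x' ord0 i - y ord0 i| <= d) ->
  `|f (row_point x') - f (row_point y)| <= e.
  move=> x Kx.
  have /subspace_continuousP/(_ x Kx)/cvgrPdist_le/(_ _ e20) := fc.
  rewrite near_withinE => /nbhs_ballP [r /= r0 hr].
  have r20 : 0 < r / 2 by rewrite divr_gt0.
  exists (ball x (r / 2), [set d | 0 < d < r / 2]).
    split => /=; first exact: nbhsx_ballx.
    near=> d; apply/andP; split; near: d; first exact: nbhs_right_gt.
    exact: nbhs_right_lt.
  move=> [x' d] /= [xx' /andP[d0 dr]] Kx' y Ky yd.
  (* The radius [r / 2] for [x'] and the bound [d < r / 2] put both [x'] and [y] in the ball where
     [f] stays within [e / 2] of its value at [x]. *)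
  have h1 : ball x r x' by apply: le_ball xx'; lra.
  have h2 : ball x r y.
    apply/(ball_rV _ _ r0) => i; move/(ball_rV _ _ r20) : xx' => /(_ i) xi.
    have := ler_distD (x' ord0 i) (x ord0 i) (y ord0 i).
    by move: (yd i) => ?; lra.
  have ab : `|f (row_point x) - f (row_point x')| <= e / 2 := hr _ h1 Kx'.
  have ac : `|f (row_point x) - f (row_point y)| <= e / 2 := hr _ h2 Ky.
  apply: le_trans (ler_distD (f (row_point x)) _ _) _.
  by rewrite (distrC (f (row_point x'))) [leRHS](splitr e) lerD.
have hd := near_cover R (0^'+) (fun d x => K x -> forall y, K y ->
  (forall i, `|x ord0 i - y ord0 i| <= d) ->
  `|f (row_point x) - f (row_point y)| <= e) _ H.
have {hd} : \forall d \near 0^'+, 0 < d /\ (K `<=` (fun x => K x -> forall y, K y ->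
  (forall i, `|x ord0 i - y ord0 i| <= d) ->
  `|f (row_point x) - f (row_point y)| <= e)).
  near=> d; split; near: d; [exact: nbhs_right_gt|exact: hd].
move=> /filter_ex [d [d0 hd]]; exists d => // k k' ck ck' kk'.
have := hd (point_row k); rewrite /K /= !point_rowK => /(_ ck ck (point_row k')).
rewrite /= !point_rowK; apply => // i.
by rewrite !mxE.
Unshelve. all: by end_near.
Qed.

Lemma ucont_within n (f : point R n -> R) : ucont f ->
  {within @row_point R n @^-1` cube n, continuous (f \o @row_point R n)}.
Proof.
move=> fc; apply/subspace_continuousP => x Kx; apply/cvgrPdist_le => e e0.
have [d d0 h] := fc e e0; rewrite near_withinE; apply/nbhs_ballP.
exists d => //= y /(ball_rV _ _ d0) xy Ky; apply: h => // i.
by rewrite !tnth_row_point ltW.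
Qed.

Lemma cube0 n : cube n (nseq_tuple n 0 : point R n).
Proof. by move=> i; rewrite /= tnth_nseq lexx ler01. Qed.

Lemma ucont_max n (f : point R n -> R) : ucont f ->
  exists2 c, cube n c & forall k, cube n k -> f k <= f c.
Proof.
move=> /ucont_within fc.
have [|c Kc hc] := compact_EVT_max _ (@compact_row_cube n) fc.
  by exists (point_row (nseq_tuple n 0)); rewrite /= point_rowK; exact: cube0.
exists (row_point c); first by move: Kc; rewrite inE.
by move=> k ck; have := hc (point_row k); rewrite /= point_rowK inE /= point_rowK; apply.
Qed.

Lemma ucont_eq n (f g : point R n -> R) :
  (forall k, cube n k -> f k = g k) -> ucont f -> ucont g.
Proof.
move=> fg fc e /fc [d d0 h]; exists d => // k k' ck ck' /(h _ _ ck ck').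
by rewrite !fg.
Qed.

Lemma ucont_cst n (a : R) : ucont (fun _ : point R n => a).
Proof. by move=> e e0; exists 1 => // k k' *; rewrite subrr normr0 ltW. Qed.

Lemma ucontN n (f : point R n -> R) : ucont f -> ucont (fun k => - f k).
Proof.
move=> fc e /fc [d d0 h]; exists d => // k k' ck ck' /(h _ _ ck ck').
by rewrite -opprD normrN.
Qed.

Lemma ucont_norm n (f : point R n -> R) : ucont f -> ucont (fun k => `|f k|).
Proof.
move=> fc e /fc [d d0 h]; exists d => // k k' ck ck' /(h _ _ ck ck').
by apply: le_trans; exact: ler_dist_dist.
Qed.

Lemma ucont_bounded n (f : point R n -> R) : ucont f ->
  exists2 K, 0 < K & forall k, cube n k -> `|f k| <= K.
Proof.
move=> /ucont_norm /ucont_max[c _ h]; exists (`|f c| + 1).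
  by rewrite ltr_wpDl.
by move=> k /h /le_trans; apply; rewrite lerDl.
Qed.

Lemma ucontD n (f g : point R n -> R) :
  ucont f -> ucont g -> ucont (fun k => f k + g k).
Proof.
move=> fc gc e e0; have e20 : 0 < e / 2 by rewrite divr_gt0.
have [d d0 h] := fc _ e20; have [d' d'0 h'] := gc _ e20.
exists (Num.min d d'); first by rewrite lt_min d0.
move=> k k' ck ck' kk'.
have {}h : `|f k - f k'| <= e / 2.
  by apply: h => // i; apply: le_trans (kk' i) _; rewrite ge_min lexx.
have {}h' : `|g k - g k'| <= e / 2.
  by apply: h' => // i; apply: le_trans (kk' i) _; rewrite ge_min lexx orbT.
rewrite opprD addrACA; apply: le_trans (ler_normD _ _) _; lra.
Qed.

Lemma ucontM n (f g : point R n -> R) :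
  ucont f -> ucont g -> ucont (fun k => f k * g k).
Proof.
move=> fc gc e e0.
have [K K0 hK] := ucont_bounded fc; have [L L0 hL] := ucont_bounded gc.
have [|d d0 h] := fc (e / 2 / L); first by rewrite !divr_gt0.
have [|d' d'0 h'] := gc (e / 2 / K); first by rewrite !divr_gt0.
exists (Num.min d d'); first by rewrite lt_min d0.
move=> k k' ck ck' kk'.
have {}h : `|f k - f k'| <= e / 2 / L.
  by apply: h => // i; apply: le_trans (kk' i) _; rewrite ge_min lexx.
have {}h' : `|g k - g k'| <= e / 2 / K.
  by apply: h' => // i; apply: le_trans (kk' i) _; rewrite ge_min lexx orbT.
rewrite (_ : _ - _ = (f k - f k') * g k + f k' * (g k - g k')); last ring.
apply: le_trans (ler_normD _ _) _; rewrite !normrM.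
have h1 : `|f k - f k'| * `|g k| <= e / 2.
  rewrite -[leRHS](@mulfVK _ L) ?gt_eqF//.
  by apply: ler_pM => //; exact: hL.
have h2 : `|f k'| * `|g k - g k'| <= e / 2.
  rewrite -[leRHS](@mulfVK _ K) ?gt_eqF// mulrC.
  by apply: ler_pM => //; exact: hK.
lra.
Qed.

Lemma ucontV n (f : point R n -> R) : ucont f ->
  (forall k, cube n k -> f k != 0) -> ucont (fun k => (f k)^-1).
Proof.
move=> fc f0 e e0.
(* A maximum of [-|f|] is a minimum of [|f|], so [|f c| > 0] bounds [|f|] from below on the whole
   cube. *)
have [c cc hc] := ucont_max (ucontN (ucont_norm fc)).
have c0 : 0 < `|f c| by rewrite normr_gt0 f0.
have [|d d0 h] := fc (e * (`|f c| * `|f c|)); first by rewrite !mulr_gt0.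
exists d => // k k' ck ck' /(h _ _ ck ck') kk'.
have fk : f k != 0 by exact: f0.
have fk' : f k' != 0 by exact: f0.
rewrite (_ : _ - _ = (f k' - f k) * ((f k)^-1 * (f k')^-1)); last by field; rewrite fk fk'.
rewrite normrM distrC normrM !normfV -invfM ler_pdivrMr ?mulr_gt0 ?normr_gt0//.
apply: le_trans kk' _; rewrite ler_pM2l//.
by apply: ler_pM => //; rewrite -lerN2 hc.
Qed.

Lemma ucont_sum n (I : Type) (s : seq I) (P : pred I) (f : I -> point R n -> R) :
  (forall i, P i -> ucont (f i)) -> ucont (fun k => \sum_(i <- s | P i) f i k).
Proof.
move=> fc; elim: s => [|i s IH].
  by apply: ucont_eq (@ucont_cst n 0) => k _; rewrite big_nil.
have [Pi|nPi] := boolP (P i).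
  by apply: ucont_eq (ucontD (fc i Pi) IH) => k _; rewrite big_cons Pi.
by apply: ucont_eq IH => k _; rewrite big_cons (negPf nPi).
Qed.

Lemma measurable_coord_set n (i : 'I_n) (B : set R) : measurable B ->
  measurable [set k : point R n | B (tnth k i)].
Proof. by move=> mB; rewrite -[X in measurable X]setTI; exact: measurable_tnth. Qed.

Lemma measurable_box n (B : 'I_n -> set R) : (forall i, measurable (B i)) ->
  measurable [set k : point R n | forall i, B i (tnth k i)].
Proof.
move=> mB; rewrite (_ : [set _ | _] =
    \bigcap_(i in [set: 'I_n]) [set k : point R n | B i (tnth k i)]).
  by apply: fin_bigcap_measurable => [|i _]; [exact: finite_finset|exact: measurable_coord_set].
by apply/seteqP; split => [k h i _|k h i]; [exact: h|exact: (h i I)].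
Qed.

Lemma measurable_cube n : measurable (@cube R n).
Proof.
rewrite (_ : cube n = [set k : point R n | forall i, `[0, 1]%classic (tnth k i)]).
  exact: (@measurable_box n (fun=> `[0, 1]%classic)).
by apply/seteqP; split=> k h i; have := h i; rewrite /= in_itv.
Qed.

Lemma exists_rat_near (x : R) (m : nat) :
  exists q : rat, ratr q - m.+1%:R^-1 <= x <= ratr q + m.+1%:R^-1.
Proof.
have : 0 < m.+1%:R^-1 :> R by rewrite invr_gt0.
move: (m.+1%:R^-1) => e e0.
have [|q] := @rat_in_itvoo R x (x + e); first by rewrite ltrDl.
by rewrite in_itv /= => /andP[h1 h2]; exists q; apply/andP; split; lra.
Qed.

Lemma dist_le_trans_mid (x y q e d : R) : q - e <= x <= q + e -> e < d / 2 ->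
  q - e <= y <= q + e -> `|x - y| <= d.
Proof. by rewrite ler_norml => /andP[? ?] ? /andP[? ?]; apply/andP; split; lra. Qed.

(** The sigma-algebra on points is not defined through open sets. The set where [f > a] is therefore
    exhibited as a countable union of boxes with rational centre and radius [1 / (m + 1)], namely
    those on which [f > a]. *)
Lemma ucont_measurable n (f : point R n -> R) : ucont f ->
  measurable_fun (cube n) f.
Proof.
move=> fc mC; apply: (measurability _ (measurable_realfun.RGenOInfty.measurableE R)) => // _ [_ [a ->] <-].
pose box (q : n.-tuple rat) (m : nat) : set (point R n) :=
  [set k : point R n | forall i, (tnth k i : R) \in `[ratr (tnth q i) - m.+1%:R^-1,
                                            ratr (tnth q i) + m.+1%:R^-1]].
have mbox q m : measurable (box q m).
  apply: (@measurable_box n (fun i => `[ratr (tnth q i) - m.+1%:R^-1,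
    ratr (tnth q i) + m.+1%:R^-1]%classic)) => i; exact: measurable_itv.
rewrite [X in measurable X](_ : _ = cube n `&`
   \bigcup_(qm in [set qm : n.-tuple rat * nat |
      forall k, cube n k -> box qm.1 qm.2 k -> a < f k]) box qm.1 qm.2).
  apply: measurableI => //; rewrite bigcup_mkcond.
  apply: countable_bigcupT_measurable => // qm.
  by case: ifP => _; [exact: mbox|exact: measurable0].
apply/seteqP; split => k /= [ck].
  rewrite in_itv /= andbT => afk; split => //.
  have [|d d0 h] := fc ((f k - a) / 2); first by rewrite divr_gt0 // subr_gt0.
  have [m md] : exists m : nat, m.+1%:R^-1 < d / 2.
    have := @near_infty_natSinv_lt R (PosNum (divr_gt0 d0 (ltr0n R 2))).
    by case=> m _ /(_ m (leqnn m)) h0; exists m.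
  have qP i := exists_rat_near (tnth k i) m.
  (* Two points of a box differ by at most [2 / (m + 1) < d] in each coordinate, and a margin of
     half of [f k - a] keeps [f] above [a]. *)
  exists ([tuple xchoose (qP i) | i < n], m) => /=.
    move=> k' ck' bk'; have : `|f k - f k'| <= (f k - a) / 2.
      apply: h => // i; have := bk' i; rewrite tnth_mktuple in_itv /=.
      move: (xchooseP (qP i)) md; exact: dist_le_trans_mid.
    by rewrite ler_norml => /andP[? ?]; lra.
  move=> i; rewrite tnth_mktuple in_itv /=.
  exact: (xchooseP (qP i)).
by move=> [qm /= hq bk]; split => //; rewrite in_itv /= andbT; exact: hq.
Qed.

End UniformContinuity.

Arguments measurable_cube {R} n.
Arguments measurable_coord_set {R n} i B.
Arguments measurable_box {R n} B.
#[global] Hint Extern 0 (measurable (cube _)) =>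
  solve [exact: measurable_cube] : core.

(** * Tonelli and Fubini for means over the first coordinates *)

Section CubeIntegral.
Variable R : realType.
Implicit Types (n r s : nat).

(** With this encoding a mean over the first [r] coordinates is an integral over the [r]-dimensional
    cube with [k] as a parameter; [point R n] need not be split as a product. *)
Definition glue r n (t : point R r) (k : point R n) : point R n :=
  [tuple (if (l < r)%N then nth (0 : R) t l else tnth k l : measurableTypeR R) | l < n].

Lemma cube_glue r n (t : point R r) (k : point R n) :
  cube r t -> cube n k -> cube n (glue t k).
Proof.
move=> ct ck l; rewrite tnth_mktuple; case: ifP => lr; last exact: ck.
by have := ct (Ordinal lr); rewrite (tnth_nth 0).
Qed.

Lemma nth_point n (t : point R n) l (h : (l < n)%N) :
  nth (0 : R) t l = tnth t (Ordinal h).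
Proof. by rewrite (tnth_nth (0 : R)). Qed.

Lemma glue_glue s r n (t : point R s) (p : point R r) (k : point R n) :
  (s <= r)%N -> glue t (glue p k) = glue (glue t p) k.
Proof.
move=> sr; apply: eq_from_tnth => l; rewrite !tnth_mktuple.
case: (ltnP l r) => lr; last by rewrite ltnNge (leq_trans sr lr).
by rewrite !(nth_point _ lr) tnth_mktuple.
Qed.

Lemma glue0 n (t : point R 0) (k : point R n) : glue t k = k.
Proof. by apply: eq_from_tnth => l; rewrite tnth_mktuple. Qed.

Lemma glue_full n (t k : point R n) : glue t k = t.
Proof. by apply: eq_from_tnth => l; rewrite tnth_mktuple ltn_ord -tnth_nth. Qed.

Lemma glue_cons r n (y x : measurableTypeR R) (t : point R r) (k : point R n) :
  glue (cons_point (y, t)) (cons_point (x, k)) = cons_point (y, glue t k).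
Proof.
apply: eq_from_tnth => l; rewrite tnth_mktuple.
case: (unliftP ord0 l) => [l' ->|->] //.
by rewrite !tnthS tnth_mktuple /= ltnS.
Qed.

Lemma measurable_glue r n : measurable_fun setT
  (fun tk : point R r * point R n => glue tk.1 tk.2).
Proof.
apply/measurable_fun_tnthP => l.
case: (ltnP l r) => lr.
  rewrite (_ : _ \o _ = (fun tk : point R r * point R n => tnth tk.1 (Ordinal lr))).
    apply: (@measurableT_comp _ _ _ _ _ _ (fun t : point R r => tnth t (Ordinal lr))) => //.
    exact: measurable_tnth.
  by apply/funext => tk /=; rewrite tnth_mktuple lr (tnth_nth 0).
rewrite (_ : _ \o _ = (fun tk : point R r * point R n => tnth tk.2 l)).
  apply: (@measurableT_comp _ _ _ _ _ _ (fun t : point R n => tnth t l)) => //.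
  exact: measurable_tnth.
by apply/funext => tk /=; rewrite tnth_mktuple ltnNge lr.
Qed.

Lemma measurable_gluel r n (k : point R n) :
  measurable_fun setT (fun t : point R r => glue t k).
Proof.
apply: (@measurableT_comp _ _ _ _ _ _ (fun tk : point R r * point R n => glue tk.1 tk.2)
   _ (fun t => (t, k))); first exact: measurable_glue.
exact: pair2_measurable.
Qed.

Local Open Scope ereal_scope.

Lemma cube_cons n x (t : point R n) :
  cube n.+1 (cons_point (x, t)) <-> (0 <= (x : R) <= 1)%R /\ cube n t.
Proof.
split=> [h|[hx ht] i].
  by split; [exact: (h ord0)|move=> i; have := h (lift ord0 i); rewrite tnthS].
by case: (unliftP ord0 i) => [i' ->|->] //; rewrite tnthS; exact: ht.
Qed.

Lemma restrict_cube_cons n (f : point R n.+1 -> \bar R) (x : measurableTypeR R) (t : point R n) :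
  (f \_ (cube n.+1)) (cons_point (x, t)) =
  ((fun x => ((fun t => f (cons_point (x, t))) \_ (cube n)) t) \_ `[0%R, 1%R]) x.
Proof.
rewrite /patch; case: (boolP (_ \in cube n.+1)); rewrite ?inE => h.
  have [hx ht] := (cube_cons x t).1 h.
  by rewrite !mem_set //= in_itv /= .
case: ifPn; rewrite ?inE //= in_itv /= => hx; case: ifPn; rewrite ?inE // => ht.
by case: (negP h); rewrite inE; apply/cube_cons.
Qed.

Lemma measurable_restrict_cube n (f : point R n -> \bar R) :
  measurable_fun [set: point R n] f -> measurable_fun [set: point R n] (f \_ (cube n)).
Proof.
move=> mf; apply/(measurable_restrictT _ (measurable_cube n)).
exact: measurable_funTS.
Qed.

Lemma measurable_cons_pointl n (x : measurableTypeR R) :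
  measurable_fun setT (fun t : point R n => cons_point (x, t)).
Proof.
apply: (@measurableT_comp _ _ _ _ _ _ (@cons_point R n) _ (fun t => (x, t))).
  exact: measurable_cons_point.
exact: pair1_measurable.
Qed.

Lemma cube_integral_cons n (f : point R n.+1 -> \bar R) :
  measurable_fun setT f -> (forall k, 0 <= f k) ->
  \int[lebesgue R n.+1]_(p in cube n.+1) f p =
  \int[lebesgue_measure]_(x in `[0%R, 1%R]) \int[lebesgue R n]_(t in cube n) f (cons_point (x, t)).
Proof.
move=> mf f0; rewrite integral_mkcond /= /lebesgue_step.
have f'0 k : 0 <= (f \_ (cube n.+1)) k by apply: erestrict_ge0.
rewrite ge0_integral_pushforward //=; last 2 first.
  exact: measurable_cons_point.
  exact: measurable_restrict_cube.
rewrite preimage_setT.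
have mg : measurable_fun setT ((f \_ (cube n.+1)) \o @cons_point R n).
  apply: measurableT_comp; [exact: measurable_restrict_cube|exact: measurable_cons_point].
have g0 p : 0 <= ((f \_ (cube n.+1)) \o @cons_point R n) p by exact: f'0.
have FT := fubini_tonelli1 (m1 := lebesgue_measure) (m2 := lebesgue R n) _ mg g0.
apply: etrans FT _.
rewrite [RHS]integral_mkcond. apply: eq_integral => x _; rewrite /fubini_F.
under eq_integral do rewrite /= restrict_cube_cons.
rewrite /= /patch; case: ifPn => hx; last by rewrite integral0.
by rewrite [RHS]integral_mkcond.
Qed.

Lemma measurable_cube_integral d (T : measurableType d) n (f : T * point R n -> \bar R) :
  measurable_fun setT f -> (forall p, 0 <= f p) ->
  measurable_fun setT (fun x => \int[lebesgue R n]_(t in cube n) f (x, t)).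
Proof.
move=> mf f0; pose g := f \_ (setT `*` @cube R n).
rewrite (_ : (fun x => _) = (fun x => \int[lebesgue R n]_t g (x, t))).
  apply: measurable_fun_fubini_tonelli_F.
    have mD : measurable ([set: T] `*` @cube R n) by apply: measurableX.
    exact: (measurable_restrictT f mD).1 (measurable_funTS mf).
  by move=> x; apply: erestrict_ge0.
apply/funext => x; rewrite integral_mkcond; apply: eq_integral => t _.
rewrite /g /patch; congr (if _ then _ else _).
by apply/idP/idP; rewrite !inE => // -[].
Qed.

Lemma lebesgue_itv01 : lebesgue_measure (`[0%R, 1%R]%classic : set R) = 1.
Proof. by rewrite lebesgue_measure_itv /= lte01 oppr0 adde0. Qed.

Lemma cube_integral_swap n (f : measurableTypeR R * point R n -> \bar R) :
  measurable_fun setT f -> (forall p, 0 <= f p) ->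
  \int[lebesgue_measure]_(x in `[0%R, 1%R]) \int[lebesgue R n]_(t in cube n) f (x, t) =
  \int[lebesgue R n]_(t in cube n) \int[lebesgue_measure]_(x in `[0%R, 1%R]) f (x, t).
Proof.
move=> mf f0; pose g := f \_ (`[0%R, 1%R] `*` cube n).
have mg : measurable_fun setT g.
  have mD : measurable (`[0%R, 1%R]%classic `*` cube n : set (measurableTypeR R * point R n)).
    by apply: measurableX.
  exact: (measurable_restrictT f mD).1 (measurable_funTS mf).
have g0 p : 0 <= g p by apply: erestrict_ge0.
transitivity (\int[lebesgue_measure]_x \int[lebesgue R n]_t g (x, t)).
  rewrite integral_mkcond; apply: eq_integral => x _; rewrite {1}/patch.
  case: ifPn => hx; last first.
    rewrite integral0_eq // => t _; rewrite /g /patch ifN //.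
    by apply: contra hx; rewrite !inE => -[].
  rewrite integral_mkcond; apply: eq_integral => t _; rewrite /g /patch.
  congr (if _ then _ else _); apply/idP/idP; rewrite !inE; last by case.
  by split => //; rewrite inE in hx.
apply: etrans (fubini_tonelli (m1 := lebesgue_measure) (m2 := lebesgue R n) g mg g0) _.
rewrite [RHS]integral_mkcond; apply: eq_integral => t _; rewrite [in RHS]/patch.
case: ifPn => hx; last first.
  rewrite integral0_eq // => x _; rewrite /g /patch ifN //.
  by apply: contra hx; rewrite !inE => -[].
rewrite [RHS]integral_mkcond; apply: eq_integral => x _; rewrite /g /patch.
congr (if _ then _ else _); apply/idP/idP; rewrite !inE; first by case.
by split => //; rewrite inE in hx.
Qed.

(** The cube has mass one, so averaging preserves the integral. After splitting off the first
    coordinate, the old value [x] has been overwritten by the new one [y] and integrates to 1;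
    exchanging [y] with the other coordinates leaves the statement for [r] on each slice. *)
Lemma tonelli_glue r n (f : point R n -> \bar R) : (r <= n)%N ->
  measurable_fun setT f -> (forall k, 0 <= f k) ->
  \int[lebesgue R n]_(k in cube n) \int[lebesgue R r]_(t in cube r) f (glue t k) =
  \int[lebesgue R n]_(k in cube n) f k.
Proof.
elim: r n f => [|r IH] n f rn mf f0.
  apply: eq_integral => k _.
  under eq_integral do rewrite glue0.
  rewrite integral_cst /=; last exact: measurable_cube.
  by rewrite diracE mem_set ?mule1 // => -[].
case: n f rn mf f0 => // n f; rewrite ltnS => rn mf f0.
have mfg : measurable_fun setT (fun a : point R n.+1 * point R r.+1 => f (glue a.2 a.1)).
  apply: measurableT_comp => //.
  apply: (@measurableT_comp _ _ _ _ _ _ (fun tk : point R r.+1 * point R n.+1 => glue tk.1 tk.2)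
    _ (fun a : point R n.+1 * point R r.+1 => (a.2, a.1))); first exact: measurable_glue.
  exact: measurable_swap.
rewrite [RHS](cube_integral_cons mf f0).
apply: etrans (cube_integral_cons (measurable_cube_integral mfg _) _) _.
- by [].
- by move=> k; exact: integral_ge0.
have mfc y k : measurable_fun setT (fun t : point R r => f (cons_point (y, glue t k))).
  apply: measurableT_comp => //.
  apply: (@measurableT_comp _ _ _ _ _ _ (fun t => cons_point (y, t)) _ (fun t : point R r => glue t k)).
    exact: measurable_cons_pointl.
  exact: measurable_gluel.
have mF : measurable_fun setT (fun yk : measurableTypeR R * point R n =>
    \int[lebesgue R r]_(t in cube r) f (cons_point (yk.1, glue t yk.2))).
  apply: (@measurable_cube_integral _ _ r (fun a : (measurableTypeR R * point R n) * point R r =>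
    f (cons_point (a.1.1, glue a.2 a.1.2)))) => //.
  apply: measurableT_comp => //.
  apply: (@measurableT_comp _ _ _ _ _ _ (@cons_point R n)).
    exact: measurable_cons_point.
  apply: measurable_fun_pair => /=.
    exact: measurableT_comp.
  apply: (@measurableT_comp _ _ _ _ _ _ (fun tk : point R r * point R n => glue tk.1 tk.2)
    _ (fun a : (measurableTypeR R * point R n) * point R r => (a.2, a.1.2))); first exact: measurable_glue.
  by apply: measurable_fun_pair => //; exact: measurableT_comp.
have F0 yk : 0 <= \int[lebesgue R r]_(t in cube r) f (cons_point (yk.1, glue t yk.2)).
  exact: integral_ge0.
transitivity (\int[lebesgue_measure]_(x in `[0%R, 1%R])
   \int[lebesgue R n]_(k in cube n) f (cons_point (x, k))); last by [].
transitivity (\int[lebesgue_measure]_(x in `[0%R, 1%R]) \int[lebesgue R n]_(k in cube n)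
    \int[lebesgue_measure]_(y in `[0%R, 1%R]) \int[lebesgue R r]_(t in cube r)
      f (cons_point (y, glue t k))).
  apply: eq_integral => x _; apply: eq_integral => k _.
  have mg : measurable_fun setT (fun t : point R r.+1 => f (glue t (cons_point (x, k)))).
    by apply: measurableT_comp => //; exact: measurable_gluel.
  apply: etrans (@cube_integral_cons r (fun t => f (glue t (cons_point (x, k)))) mg _) _ => //.
  by apply: eq_integral => y _; apply: eq_integral => t _; rewrite glue_cons.
(* The integrand no longer contains [x], and [0,1] has length 1. *)
rewrite integral_cst // [X in _ * X](_ : _ = 1) ?mule1; last exact: lebesgue_itv01.
apply: etrans (esym (cube_integral_swap mF F0)) _; apply: eq_integral => y _ /=.
apply: (IH n (fun k => f (cons_point (y, k)))) => //.
by apply: measurableT_comp => //; exact: measurable_cons_pointl.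
Qed.

Lemma lebesgue_cube n : lebesgue R n (cube n) = 1.
Proof.
elim: n => [|n IH]; first by rewrite /= diracE mem_set // => -[].
have cst1 m : \int[lebesgue R m]_(k in cube m) cst 1 k = lebesgue R m (cube m).
  by apply: etrans (integral_cst _ (measurable_cube m) 1) _; rewrite mul1e.
have := cube_integral_cons (@measurable_cst _ _ (point R n.+1) _ setT 1) (fun=> lee01).
rewrite cst1 => ->; under eq_integral do rewrite cst1 IH.
rewrite integral_cst; last exact: measurable_itv.
by rewrite mul1e; exact: lebesgue_itv01.
Qed.

Lemma integral_coord n (l : 'I_n) (f : measurableTypeR R -> \bar R) :
  measurable_fun setT f -> (forall x, 0 <= f x) ->
  \int[lebesgue R n]_(k in cube n) f (tnth k l) =
  \int[lebesgue_measure]_(x in `[0%R, 1%R]) f x.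
Proof.
move=> mf f0; elim: n l => [[]//|n IH] l.
have mft m (i : 'I_m) : measurable_fun setT (fun k : point R m => f (tnth k i)).
  by apply: measurableT_comp => //; exact: measurable_tnth.
rewrite (cube_integral_cons (mft n.+1 l)) //.
case: (unliftP ord0 l) => [l' ->|->].
  under eq_integral do under eq_integral do rewrite tnthS.
  under eq_integral do rewrite IH.
  by rewrite integral_cst // [X in _ * X](_ : _ = 1) ?mule1; last exact: lebesgue_itv01.
apply: eq_integral => x _.
apply: etrans (integral_cst (lebesgue R n) (measurable_cube n) (f x)) _.
by apply: etrans (congr1 _ (lebesgue_cube n)) _; rewrite mule1.
Qed.

Lemma max_min_itvE (x x0 d : R) : (Num.max 0 (x0 - d) <= x <= Num.min 1 (x0 + d))%R =
  (0 <= x <= 1)%R && (`|x - x0| <= d)%R.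
Proof.
rewrite ge_max le_min ler_norml.
by apply/idP/idP => /andP[/andP[? ?] /andP[? ?]];
  apply/andP; split; apply/andP; split; lra.
Qed.

Lemma lebesgue_box_gt0 n (c : point R n) (d : R) : cube n c -> (0 < d)%R ->
  0 < lebesgue R n [set k | cube n k /\ forall i, (`|(tnth k i : R) - (tnth c i : R)| <= d)%R].
Proof.
move=> cc d0; elim: n c cc => [|n IH] c cc.
  rewrite /= diracE mem_set ?lte01 //=; split; first by case.
  by case.
pose x0 : R := tnth c ord0; pose c' : point R n := [tuple of behead c].
have cE : c = cons_point (x0, c') by rewrite [LHS]tuple_eta.
have [hx0 cc'] : (0 <= x0 <= 1)%R /\ cube n c' by apply/cube_cons; rewrite -cE.
set B := [set _ | _]; rewrite /= /lebesgue_step /pushforward.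
pose I : set (measurableTypeR R) := [set` `[Num.max 0 (x0 - d), Num.min 1 (x0 + d)]%R].
pose B' := [set k | cube n k /\ forall i, (`|(tnth k i : R) - (tnth c' i : R)| <= d)%R].
have -> : @cons_point R n @^-1` B = I `*` B'.
  apply/seteqP; split=> -[x t] /=.
    rewrite /B /I /B' /= in_itv /= => -[/cube_cons[x01 ct] h].
    have := h ord0; rewrite cE /= !tnth0 => x0d.
    split; first by rewrite max_min_itvE x01 x0d.
    by split => // i; have := h (lift ord0 i); rewrite cE !tnthS.
  rewrite /B /I /B' /= in_itv /= max_min_itvE => -[/andP[x01 x0d] [ct h]].
  split; first exact/cube_cons.
  by move=> i; case: (unliftP ord0 i) => [i' ->|->]; rewrite cE ?tnthS // !tnth0.
have mB' : measurable B'.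
  rewrite (_ : B' = cube n `&` [set k | forall i, [set` `[(tnth c' i : R) - d, (tnth c' i : R) + d]%R] (tnth k i)]).
    apply: measurableI => //.
    by apply: (measurable_box (fun i => [set` `[(tnth c' i : R) - d, (tnth c' i : R) + d]%R])).
  by apply/seteqP; split => k [ck h]; split => // i; have := h i; rewrite /= in_itv /= ler_distl.
have mI : measurable I by exact: measurable_itv.
rewrite [X in _ < X](_ : _ = lebesgue_measure I * lebesgue R n B'); last first.
  exact: product_measure1E mI mB'.
apply: mule_gt0; last exact: IH.
(* The centre may lie on the boundary of the cube; the part of the interval inside [0,1] still has
   positive length. *)
have lt : (Num.max 0 (x0 - d) < Num.min 1 (x0 + d))%R.
  move: hx0 => /andP[? ?]; rewrite gt_max !lt_min ltr01 /=.
  by apply/andP; split; [|apply/andP; split]; lra.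
by rewrite /I lebesgue_measure_itv /= lte_fin lt -EFinB lte_fin subr_gt0.
Qed.

End CubeIntegral.

Section Averages.
Variable R : realType.
Implicit Types (n r s : nat).

(** Tonelli lives in the extended reals, because slice integrals may be infinite on a null set;
    [avg] is the [fine] part of this average. *)
Definition eavg r n (f : point R n -> \bar R) (k : point R n) : \bar R :=
  (\int[lebesgue R r]_(t in cube r) f (glue t k))%E.

Definition avg r n (f : point R n -> R) (k : point R n) : R :=
  \int[lebesgue R r]_(t in cube r) f (glue t k).

Definition slice_integrable r n (f : point R n -> R) (k : point R n) :=
  (lebesgue R r).-integrable (cube r) (EFin \o (fun t => f (glue t k))).

Lemma avgE r n (f : point R n -> R) k : avg r f k = fine (eavg r (EFin \o f) k).
Proof. by []. Qed.

Lemma measurable_slice d (U : measurableType d) r n (f : point R n -> U) k :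
  measurable_fun (cube n) f -> cube n k ->
  measurable_fun (cube r) (fun t : point R r => f (glue t k)).
Proof.
move=> mf ck; apply: (measurable_comp (measurable_cube n) _ mf).
  by move=> _ [t ct <-]; exact: cube_glue.
by apply: measurable_funTS; exact: measurable_gluel.
Qed.

Lemma eq_eavg r n (f g : point R n -> \bar R) k : cube n k ->
  (forall k', cube n k' -> f k' = g k') -> eavg r f k = eavg r g k.
Proof.
move=> ck fg; apply: eq_integral => t; rewrite inE => ct.
by apply: fg; exact: cube_glue.
Qed.

Lemma restrict_cubeE n (f : point R n -> \bar R) k : cube n k ->
  (f \_ (cube n)) k = f k.
Proof. by move=> ck; rewrite /patch mem_set. Qed.

Local Open Scope ereal_scope.

Lemma eavg_ge0 r n (f : point R n -> \bar R) k : (forall k, 0 <= f k) ->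
  0 <= eavg r f k.
Proof. by move=> f0; exact: integral_ge0. Qed.

Lemma measurable_patch_cube n (f : point R n -> \bar R) :
  measurable_fun (cube n) f -> measurable_fun setT (f \_ (cube n)).
Proof. by move=> mf; exact: (measurable_restrictT f (measurable_cube n)).1. Qed.

Lemma measurable_eavg r n (f : point R n -> \bar R) :
  measurable_fun (cube n) f -> (forall k, 0 <= f k) ->
  measurable_fun (cube n) (eavg r f).
Proof.
move=> mf f0; pose g := f \_ (cube n).
have mg : measurable_fun setT g by exact: measurable_patch_cube.
have g0 k : 0 <= g k by exact: erestrict_ge0.
apply: (@eq_measurable_fun _ _ _ _ _ (eavg r g)).
  move=> k; rewrite inE => ck; apply: eq_eavg => // k' ck'.
  exact: restrict_cubeE.
apply: measurable_funTS.
apply: (@measurable_cube_integral _ _ _ r (fun a : point R n * point R r => g (glue a.2 a.1))) => //.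
apply: measurableT_comp => //.
apply: (@measurableT_comp _ _ _ _ _ _ (fun tk : point R r * point R n => glue tk.1 tk.2)
    _ (fun a : point R n * point R r => (a.2, a.1))); first exact: measurable_glue.
exact: measurable_swap.
Qed.

Lemma tonelli r n (f : point R n -> \bar R) : (r <= n)%N ->
  measurable_fun (cube n) f -> (forall k, 0 <= f k) ->
  \int[lebesgue R n]_(k in cube n) eavg r f k = \int[lebesgue R n]_(k in cube n) f k.
Proof.
move=> rn mf f0; pose g := f \_ (cube n).
have mg : measurable_fun setT g by exact: measurable_patch_cube.
have g0 k : 0 <= g k by exact: erestrict_ge0.
have := tonelli_glue rn mg g0.
have <- : \int[lebesgue R n]_(k in cube n) f k = \int[lebesgue R n]_(k in cube n) g k.
  by apply: eq_integral => k; rewrite inE => ck; rewrite /g restrict_cubeE.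
move=> <-; apply: eq_integral => k; rewrite inE => ck.
by apply: eq_eavg => // k' ck'; rewrite /g restrict_cubeE.
Qed.

Lemma eavg_funeposneg r n (f : point R n -> R) k :
  eavg r (EFin \o f) k =
  eavg r (EFin \o f)^\+ k - eavg r (EFin \o f)^\- k.
Proof.
by apply: etrans (integralE _ _ _) _; congr (_ - _); apply: eq_integral => t _;
  rewrite ?funeposE ?funenegE.
Qed.

(** The integral of a signed function is the difference of those of its positive and negative parts,
    so the nonnegative case applies to both; [fine] preserves measurability where the difference is
    infinite. *)
Lemma measurable_avg r n (f : point R n -> R) :
  measurable_fun (cube n) f -> measurable_fun (cube n) (avg r f).
Proof.
move=> mf; rewrite (_ : avg r f = fine \o eavg r (EFin \o f)) //.
apply: measurableT_comp => //.
rewrite (_ : eavg r (EFin \o f) = (fun k =>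
  eavg r (EFin \o f)^\+ k - eavg r (EFin \o f)^\- k)); last first.
  by apply/funext => k; exact: eavg_funeposneg.
have mEf : measurable_fun (cube n) (EFin \o f) by exact/measurable_EFinP.
apply: emeasurable_funB; apply: measurable_eavg => //.
  exact: measurable_funepos.
exact: measurable_funeneg.
Qed.

(** By Tonelli the slice integrals of [|f|] form an integrable function, which is finite almost
    everywhere. *)
Lemma ae_slice_integrable r n (f : point R n -> R) : (r <= n)%N ->
  (lebesgue R n).-integrable (cube n) (EFin \o f) ->
  {ae lebesgue R n, forall k, cube n k -> slice_integrable r f k}.
Proof.
move=> rn /integrableP[mf fi].
have mAf : measurable_fun (cube n) (fun k => `|(f k)%:E|) by exact: measurableT_comp.
have iA : (lebesgue R n).-integrable (cube n) (eavg r (fun k => `|(f k)%:E|)).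
  apply/integrableP; split; first exact: measurable_eavg.
  under eq_integral do rewrite gee0_abs ?eavg_ge0//.
  by rewrite tonelli.
have := integrable_ae (measurable_cube n) iA.
apply: filterS => k h ck; apply/integrableP; split.
  by apply/measurable_EFinP; apply: measurable_slice => //; exact/measurable_EFinP.
by have := h ck; rewrite ge0_fin_numE ?eavg_ge0.
Qed.

Lemma fubini r n (f : point R n -> R) : (r <= n)%N ->
  (lebesgue R n).-integrable (cube n) (EFin \o f) ->
  (lebesgue R n).-integrable (cube n) (EFin \o avg r f) /\
  (\int[lebesgue R n]_(k in cube n) avg r f k = \int[lebesgue R n]_(k in cube n) f k)%R.
Proof.
move=> rn fi; have /integrableP[mf _] := fi.
have mfp := measurable_funepos mf; have mfn := measurable_funeneg mf.
have ifp : (lebesgue R n).-integrable (cube n) (EFin \o f)^\+.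
  by apply: integrable_funepos.
have ifn : (lebesgue R n).-integrable (cube n) (EFin \o f)^\-.
  by apply: integrable_funeneg.
have iavg (g : point R n -> \bar R) : (forall k, 0 <= g k) ->
    (lebesgue R n).-integrable (cube n) g ->
    (lebesgue R n).-integrable (cube n) (eavg r g).
  move=> g0 /integrableP[mg gi]; apply/integrableP; split; first exact: measurable_eavg.
  under eq_integral do rewrite gee0_abs ?eavg_ge0//.
  rewrite tonelli //; apply: le_lt_trans gi.
  by apply: ge0_le_integral => //; [exact: measurableT_comp|move=> k _; exact: lee_abs].
have iE : (lebesgue R n).-integrable (cube n) (eavg r (EFin \o f)).
  rewrite (_ : eavg r _ = (fun k =>
    eavg r (EFin \o f)^\+ k - eavg r (EFin \o f)^\- k)); last first.
    by apply/funext => k; exact: eavg_funeposneg.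
  by apply: integrableB => //; apply: iavg.
(* [avg] and [eavg] can differ only where the slice integral is infinite, that is on a null set. *)
have aeE : ae_eq (lebesgue R n) (cube n) (eavg r (EFin \o f)) (EFin \o avg r f).
  have := integrable_ae (measurable_cube n) iE.
  by apply: filterS => k h ck; rewrite /= avgE fineK // h.
have mavg : measurable_fun (cube n) (EFin \o avg r f).
  by apply/measurable_EFinP; apply: measurable_avg; exact/measurable_EFinP.
split.
  apply/integrableP; split => //.
  have /integrableP[mE iE'] := iE; apply: le_lt_trans iE'.
  rewrite le_eqVlt; apply/orP; left; apply/eqP.
  apply: ge0_ae_eq_integral => //; [exact: measurableT_comp|exact: measurableT_comp|].
  by apply: ae_eq_comp; exact: ae_eq_sym.
rewrite /Rintegral; congr fine.
have /integrableP[mE iE'] := iE.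
apply: etrans (esym (ae_eq_integral _ _ _ _ _ aeE)) _ => //.
transitivity (\int[lebesgue R n]_(k in cube n)
  (eavg r (EFin \o f)^\+ k - eavg r (EFin \o f)^\- k)).
  by apply: eq_integral => k _; exact: eavg_funeposneg.
rewrite integralB //; try exact: iavg.
by rewrite !tonelli // [RHS]integralE.
Qed.

(** Tower property. On the slice through [k] it is Fubini in dimension [r], because gluings
    compose. *)
Lemma avg_avg s r n (f : point R n -> R) k : (s <= r)%N ->
  slice_integrable r f k -> avg r (avg s f) k = avg r f k.
Proof.
move=> sr si; have [_ E] := fubini sr si; apply: etrans E.
by apply: eq_Rintegral => t _; apply: eq_Rintegral => u _; rewrite glue_glue.
Qed.

End Averages.

(** * Means over initial coordinates and over a single coordinate *)

Section Means.
Variable R : realType.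
Implicit Types (n r s : nat).

(** Independence of the first [r] coordinates, tested inside the cube only: outside it nothing is
    assumed about the coefficients. *)
Definition invariant r n (U : Type) (f : point R n -> U) :=
  forall (t : point R r) k, cube r t -> cube n k -> f (glue t k) = f k.

(* [mavg r f] is <f>_{1,r}, with <f>_{1,0} = f. *)
Definition mavg r n p q (f : point R n -> 'M[R[i]]_(p, q)) k : 'M[R[i]]_(p, q) :=
  \matrix_(a, b) Complex (avg r (fun k => complex.Re (f k a b)) k)
                         (avg r (fun k => complex.Im (f k a b)) k).

Lemma Rintegral_coord n (l : 'I_n) (f : measurableTypeR R -> R) :
  measurable_fun (`[0, 1]%classic : set (measurableTypeR R)) f ->
  \int[lebesgue R n]_(k in cube n) f (tnth k l) =
  \int[lebesgue_measure]_(x in (`[0, 1]%classic : set (measurableTypeR R))) f x.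
Proof.
move=> mf; congr fine; set I := `[0, 1]%classic.
have mI : measurable (I : set (measurableTypeR R)) by exact: measurable_itv.
have coord (g : measurableTypeR R -> \bar R) : measurable_fun I g -> (forall x, 0 <= g x)%E ->
    (\int[lebesgue R n]_(k in cube n) g (tnth k l) = \int[lebesgue_measure]_(x in I) g x)%E.
  move=> mg g0.
  have mg' : measurable_fun setT (g \_ I) by exact: (measurable_restrictT g mI).1.
  have := integral_coord l mg' (fun x => erestrict_ge0 (fun x _ => g0 x) x).
  have -> : (\int[lebesgue_measure]_(x in I) (g \_ I) x = \int[lebesgue_measure]_(x in I) g x)%E.
    by apply: eq_integral => x xI; rewrite /patch xI.
  move=> <-; apply: eq_integral => k; rewrite inE => ck.
  by rewrite /patch mem_set // /I /= in_itv /=; exact: ck.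
have mEf : measurable_fun I (EFin \o f) by exact/measurable_EFinP.
apply: etrans (integralE _ _ _) _; apply: esym; apply: etrans (integralE _ _ _) _.
congr (_ - _)%E.
  by apply: etrans (esym (coord _ (measurable_funepos mEf) _)) _ => //;
    apply: eq_integral => k _; rewrite !funeposE.
by apply: etrans (esym (coord _ (measurable_funeneg mEf) _)) _ => //;
  apply: eq_integral => k _; rewrite !funenegE.
Qed.

Lemma mean1E r n p q (f : point R n -> 'M[R[i]]_(p, q)) k :
  mean 1 r.+1 f k = mavg r.+1 f k.
Proof.
apply/matrixP => a b; rewrite !mxE /cube_integral /avg.
(* The dimension [(r.+1 - 1).+1] of the integration variable equals [r.+1] only up to rewriting; a
   general dimension [m] makes that rewriting possible. *)
pose glue' m (t : point R m) : point R n := [tuple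
  (if (1 <= l.+1 <= r.+1)%N then nth (0 : R) t (l.+1 - 1)
          else tnth k l : measurableTypeR R) | l < n].
have E (h : point R n -> R) m : m = r.+1 ->
    \int[lebesgue R m]_(t in cube m) h (glue' m t) =
    \int[lebesgue R r.+1]_(t in cube r.+1) h (glue t k).
  move=> ->; apply: eq_Rintegral => t _; congr h.
  by apply: eq_from_tnth => l; rewrite !tnth_mktuple subn1.
have e : (r.+1 - 1).+1 = r.+1 by rewrite subn1.
by congr Complex;
  [exact: (E (fun k => complex.Re (f k a b)) _ e)
  |exact: (E (fun k => complex.Im (f k a b)) _ e)].
Qed.

Definition upd n (j : 'I_n) (k : point R n) (x : measurableTypeR R) : point R n :=
  [tuple (if l == j then x else tnth k l) | l < n].

Lemma measurable_upd n (j : 'I_n) k : measurable_fun setT (upd j k).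
Proof.
apply/measurable_fun_tnthP => l; case: (eqVneq l j) => [lj|lj].
  rewrite (_ : _ \o _ = id); first exact: (@measurable_id _ (measurableTypeR R) setT).
  by apply/funext => x; rewrite /= tnth_mktuple lj eqxx.
rewrite (_ : _ \o _ = cst (tnth k l)); first exact: measurable_cst.
by apply/funext => x; rewrite /= tnth_mktuple (negPf lj).
Qed.

Lemma cube_upd n (j : 'I_n) (k : point R n) (x : measurableTypeR R) :
  cube n k -> 0 <= (x : R) <= 1 -> cube n (upd j k x).
Proof. by move=> ck hx l; rewrite tnth_mktuple; case: ifP => // _; exact: ck. Qed.

(** By invariance the integrand depends on [t] only through its last coordinate, whose distribution
    is Lebesgue measure on [0,1]. *)
Lemma avg_invariant n (j : 'I_n) (f : point R n -> R) k : invariant j f ->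
  measurable_fun (cube n) f -> cube n k ->
  avg j.+1 f k =
  \int[lebesgue_measure]_(x in (`[0, 1]%classic : set (measurableTypeR R))) f (upd j k x).
Proof.
move=> jf mf ck.
have mfu : measurable_fun (`[0, 1]%classic : set (measurableTypeR R)) (fun x => f (upd j k x)).
  apply: (measurable_comp (measurable_cube n) _ mf).
    by move=> _ [x + <-]; rewrite /= in_itv => x01; exact: cube_upd.
  by apply: measurable_funTS; exact: measurable_upd.
rewrite -(Rintegral_coord (@ord_max j) mfu); apply: eq_Rintegral => t; rewrite inE => ct.
have ctj : 0 <= (tnth t ord_max : R) <= 1 by exact: ct.
pose t' : point R j := [tuple (tnth t (widen_ord (leqnSn j) l)) | l < j].
rewrite -(jf t' (upd j k (tnth t ord_max))); last 2 first.
- by move=> l; rewrite tnth_mktuple; exact: ct.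
- exact: cube_upd.
congr f; apply: eq_from_tnth => l; rewrite !tnth_mktuple ltnS.
case: (ltngtP l j) => lj.
- by rewrite (nth_point _ lj) tnth_mktuple (tnth_nth (0 : R)).
- by case: eqP lj => // ->; rewrite ltnn.
- have -> : l = j by exact: val_inj.
  by rewrite eqxx (tnth_nth (0 : R)).
Qed.

(** This turns the single-coordinate means in the recursion for [Finv] into means over initial
    coordinates, to which Fubini and the tower property apply. *)
Lemma mean_coordE n (j : 'I_n) p q (f : point R n -> 'M[R[i]]_(p, q)) k :
  invariant j f ->
  (forall a b, measurable_fun (cube n) (fun k => complex.Re (f k a b)) /\
               measurable_fun (cube n) (fun k => complex.Im (f k a b))) ->
  cube n k -> mean j.+1 j.+1 f k = mavg j.+1 f k.
Proof.
move=> jf mf ck; apply/matrixP => a b; rewrite !mxE /cube_integral.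
pose splice' m (t : point R m) : point R n := [tuple
  (if (j.+1 <= l.+1 <= j.+1)%N then nth (0 : R) t (l.+1 - j.+1)
          else tnth k l : measurableTypeR R) | l < n].
have E (h : point R n -> R) m : m = 1%N -> invariant j h ->
    measurable_fun (cube n) h ->
    \int[lebesgue R m]_(t in cube m) h (splice' m t) = avg j.+1 h k.
  move=> -> jh mh; rewrite avg_invariant //.
  have mhu : measurable_fun (`[0, 1]%classic : set (measurableTypeR R)) (fun x => h (upd j k x)).
    apply: (measurable_comp (measurable_cube n) _ mh).
      by move=> _ [x + <-]; rewrite /= in_itv => x01; exact: cube_upd.
    by apply: measurable_funTS; exact: measurable_upd.
  rewrite -(Rintegral_coord (ord0 : 'I_1) mhu); apply: eq_Rintegral => t _; congr h.
  apply: eq_from_tnth => l; rewrite !tnth_mktuple !ltnS -eqn_leq.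
  rewrite [in LHS]eq_sym -(inj_eq val_inj) /=; case: eqP => // ->.
  by rewrite subnn (tnth_nth (0 : R)).
have e : (j.+1 - j.+1).+1 = 1%N by rewrite subnn.
congr Complex.
  apply: (E (fun k => complex.Re (f k a b)) _ e); last by have [] := mf a b.
  by move=> t k' ct ck'; rewrite jf.
apply: (E (fun k => complex.Im (f k a b)) _ e); last by have [] := mf a b.
by move=> t k' ct ck'; rewrite jf.
Qed.

End Means.

(** * Continuous matrix-valued functions *)

Section ComplexParts.
Variable R : realType.
Implicit Types x y z : R[i].

Lemma cReD x y : Re (x + y) = Re x + Re y. Proof. by case: x y => [a b] [c d]. Qed.
Lemma cImD x y : Im (x + y) = Im x + Im y. Proof. by case: x y => [a b] [c d]. Qed.
Lemma cReM x y : Re (x * y) = Re x * Re y - Im x * Im y.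
Proof. by case: x y => [a b] [c d]. Qed.
Lemma cImM x y : Im (x * y) = Re x * Im y + Im x * Re y.
Proof. by case: x y => [a b] [c d]. Qed.
Lemma cReV x : Re x^-1 = Re x * (Re x * Re x + Im x * Im x)^-1.
Proof. by case: x. Qed.
Lemma cImV x : Im x^-1 = - (Im x * (Re x * Re x + Im x * Im x)^-1).
Proof. by case: x. Qed.
Lemma cReJ x : Re x^* = Re x. Proof. by case: x. Qed.
Lemma cImJ x : Im x^* = - Im x. Proof. by case: x. Qed.

Lemma complexP x y : Re x = Re y -> Im x = Im y -> x = y.
Proof. by case: x y => [a b] [c d] /= -> ->. Qed.

Lemma complex_eq0 x : (x == 0) = (Re x * Re x + Im x * Im x == 0).
Proof. by rewrite -!expr2 paddr_eq0 ?sqr_ge0 // !sqrf_eq0 eq_complex. Qed.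

Lemma cRe_sum (I : Type) (s : seq I) (P : pred I) (F : I -> R[i]) :
  Re (\sum_(i <- s | P i) F i) = \sum_(i <- s | P i) Re (F i).
Proof. exact: (big_morph _ cReD). Qed.

Lemma cIm_sum (I : Type) (s : seq I) (P : pred I) (F : I -> R[i]) :
  Im (\sum_(i <- s | P i) F i) = \sum_(i <- s | P i) Im (F i).
Proof. exact: (big_morph _ cImD). Qed.

End ComplexParts.

Section Continuity.
Variable R : realType.
Implicit Types (n p q r : nat).

Definition ccont n (f : point R n -> R[i]) :=
  ucont (fun k => Re (f k)) /\ ucont (fun k => Im (f k)).

Lemma ccont_eq n (f g : point R n -> R[i]) :
  (forall k, cube n k -> f k = g k) -> ccont f -> ccont g.
Proof.
by move=> fg [h1 h2]; split; [apply: ucont_eq h1|apply: ucont_eq h2] => k ck;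
  rewrite fg.
Qed.

Lemma ccont_cst n (c : R[i]) : ccont (fun _ : point R n => c).
Proof. by split; exact: ucont_cst. Qed.

Lemma ccontD n (f g : point R n -> R[i]) :
  ccont f -> ccont g -> ccont (fun k => f k + g k).
Proof.
move=> [f1 f2] [g1 g2]; split.
  by apply: ucont_eq (ucontD f1 g1) => k _; rewrite cReD.
by apply: ucont_eq (ucontD f2 g2) => k _; rewrite cImD.
Qed.

Lemma ccontM n (f g : point R n -> R[i]) :
  ccont f -> ccont g -> ccont (fun k => f k * g k).
Proof.
move=> [f1 f2] [g1 g2]; split.
  by apply: ucont_eq (ucontD (ucontM f1 g1) (ucontN (ucontM f2 g2))) => k _; rewrite cReM.
by apply: ucont_eq (ucontD (ucontM f1 g2) (ucontM f2 g1)) => k _; rewrite cImM.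
Qed.

Lemma ccontV n (f : point R n -> R[i]) : ccont f ->
  (forall k, cube n k -> f k != 0) -> ccont (fun k => (f k)^-1).
Proof.
move=> [f1 f2] f0.
have h : ucont (fun k => (Re (f k) * Re (f k) + Im (f k) * Im (f k))^-1).
  apply: ucontV; first by apply: ucontD; exact: ucontM.
  by move=> k ck; rewrite -complex_eq0 f0.
split; first by apply: ucont_eq (ucontM f1 h) => k _; rewrite cReV.
by apply: ucont_eq (ucontN (ucontM f2 h)) => k _; rewrite cImV.
Qed.

Lemma ccont_sum n (I : Type) (s : seq I) (P : pred I) (f : I -> point R n -> R[i]) :
  (forall i, P i -> ccont (f i)) -> ccont (fun k => \sum_(i <- s | P i) f i k).
Proof.
move=> fc; elim: s => [|i s IH].
  by apply: ccont_eq (@ccont_cst n 0) => k _; rewrite big_nil.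
have [Pi|nPi] := boolP (P i).
  by apply: ccont_eq (ccontD (fc i Pi) IH) => k _; rewrite big_cons Pi.
by apply: ccont_eq IH => k _; rewrite big_cons (negPf nPi).
Qed.

Lemma ccont_prod n (I : Type) (s : seq I) (P : pred I) (f : I -> point R n -> R[i]) :
  (forall i, P i -> ccont (f i)) -> ccont (fun k => \prod_(i <- s | P i) f i k).
Proof.
move=> fc; elim: s => [|i s IH].
  by apply: ccont_eq (@ccont_cst n 1) => k _; rewrite big_nil.
have [Pi|nPi] := boolP (P i).
  by apply: ccont_eq (ccontM (fc i Pi) IH) => k _; rewrite big_cons Pi.
by apply: ccont_eq IH => k _; rewrite big_cons (negPf nPi).
Qed.

Definition mcont n p q (B : point R n -> 'M[R[i]]_(p, q)) :=
  forall a b, ccont (fun k => B k a b).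

Lemma mcont_eq n p q (B C : point R n -> 'M[R[i]]_(p, q)) :
  (forall k, cube n k -> B k = C k) -> mcont B -> mcont C.
Proof. by move=> BC cB a b; apply: ccont_eq (cB a b) => k ck; rewrite BC. Qed.

Lemma mcont_cst n p q (B : 'M[R[i]]_(p, q)) : mcont (fun _ : point R n => B).
Proof. by move=> a b; exact: ccont_cst. Qed.

Lemma mcontD n p q (B C : point R n -> 'M[R[i]]_(p, q)) :
  mcont B -> mcont C -> mcont (fun k => B k + C k).
Proof.
by move=> cB cC a b; apply: ccont_eq (ccontD (cB a b) (cC a b)) => k _; rewrite mxE.
Qed.

Lemma mcontM n p q r (B : point R n -> 'M[R[i]]_(p, q))
    (C : point R n -> 'M[R[i]]_(q, r)) :
  mcont B -> mcont C -> mcont (fun k => B k *m C k).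
Proof.
move=> cB cC a b; apply: (@ccont_eq _ (fun k => \sum_c B k a c * C k c b)).
  by move=> k _; rewrite mxE.
by apply: ccont_sum => c _; exact: ccontM.
Qed.

Lemma mcontN n p q (B : point R n -> 'M[R[i]]_(p, q)) :
  mcont B -> mcont (fun k => - B k).
Proof.
move=> cB a b; apply: ccont_eq (ccontM (@ccont_cst n (-1)) (cB a b)) => k _.
by rewrite mxE mulN1r.
Qed.

Lemma ccont_det n p (B : point R n -> 'M[R[i]]_p) :
  mcont B -> ccont (fun k => \det (B k)).
Proof.
move=> cB; apply: ccont_sum => s _; apply: ccontM; first exact: ccont_cst.
by apply: ccont_prod => i _; exact: cB.
Qed.

Lemma mcontV n p (B : point R n -> 'M[R[i]]_p) : mcont B ->
  (forall k, cube n k -> B k \in unitmx) -> mcont (fun k => invmx (B k)).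
Proof.
move=> cB uB a b.
apply: (@ccont_eq _ (fun k => (\det (B k))^-1 * cofactor (B k) b a)).
  by move=> k ck; rewrite /invmx uB // !mxE.
apply: ccontM.
  apply: ccontV; first exact: ccont_det.
  by move=> k ck; have := uB k ck; rewrite unitmxE unitfE.
apply: ccontM; first exact: ccont_cst.
by apply: ccont_det => c d; apply: ccont_eq (cB (lift b c) (lift a d)) => k _; rewrite !mxE.
Qed.

(** Copying the first [r] coordinates of [k0] into [k] does not change [f k], so only the remaining
    coordinates have to be close. *)
Lemma ucont_invariant_at r n (f : point R n -> R) k0 (e : R) : (r <= n)%N ->
  ucont f -> invariant r f -> cube n k0 -> 0 < e ->
  exists2 d, 0 < d & forall k, cube n k ->
    (forall i : 'I_n, (r <= i)%N -> `|(tnth k i : R) - (tnth k0 i : R)| <= d) ->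
    `|f k - f k0| <= e.
Proof.
move=> rn fc fi ck0 e0; have [d d0 h] := fc e e0; exists d => // k ck kk0.
pose t : point R r := [tuple (tnth k0 (widen_ord rn l)) | l < r].
have ct : cube r t by move=> l; rewrite tnth_mktuple; exact: ck0.
rewrite -(fi t k ct ck); apply: h => //; first exact: cube_glue.
move=> i; rewrite tnth_mktuple; case: (ltnP i r) => ir; last exact: kk0.
rewrite (nth_point _ ir) tnth_mktuple (_ : widen_ord _ _ = i); last exact: val_inj.
by rewrite subrr normr0 ltW.
Qed.

End Continuity.

(** * Squared norms of vectors and of matrix products *)

Section SquareNorms.
Variable R : realType.
Implicit Types (x y z : R[i]).

(** The squared modulus. Most estimates are made for squared norms, at the price of crude constants,
    to keep them polynomial in the real and imaginary parts. *)
Definition sqc x : R := Re x ^+ 2 + Im x ^+ 2.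

Lemma sqc_ge0 x : 0 <= sqc x. Proof. by rewrite addr_ge0 ?sqr_ge0. Qed.

Lemma sqcM x y : sqc (x * y) = sqc x * sqc y.
Proof. by rewrite /sqc cReM cImM; ring. Qed.

Lemma sqcD x y : sqc (x + y) <= 2 * sqc x + 2 * sqc y.
Proof.
rewrite /sqc cReD cImD -subr_ge0.
rewrite (_ : _ - _ = (Re x - Re y) ^+ 2 + (Im x - Im y) ^+ 2); last ring.
by rewrite addr_ge0 ?sqr_ge0.
Qed.

(** The crude factor comes from iterating [sqcD]; what matters is that it depends only on the number
    of terms. *)
Lemma sqc_sum (I : Type) (s : seq I) (F : I -> R[i]) :
  sqc (\sum_(i <- s) F i) <= 2 ^+ size s * \sum_(i <- s) sqc (F i).
Proof.
elim: s => [|i s IH]; first by rewrite !big_nil mulr0 /sqc /= expr0n addr0.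
rewrite !big_cons /=; apply: le_trans (sqcD _ _) _.
rewrite exprS -mulrA (mulrDr (2 ^+ size s) (sqc (F i))) (mulrDr 2 (_ * sqc (F i))).
have h : sqc (F i) <= 2 ^+ size s * sqc (F i).
  by rewrite ler_peMl ?sqc_ge0 // exprn_ege1 // ler1n.
by apply: lerD; rewrite ler_pM2l.
Qed.

Lemma sqnormE p (v : 'cV[R[i]]_p) : sqnorm v = \sum_a sqc (v a ord0).
Proof. by []. Qed.

Lemma sqnorm_ge0 p (v : 'cV[R[i]]_p) : 0 <= sqnorm v.
Proof. by rewrite sqnormE sumr_ge0 // => a _; exact: sqc_ge0. Qed.

Lemma sqc_le_sqnorm p (v : 'cV[R[i]]_p) a : sqc (v a ord0) <= sqnorm v.
Proof. by rewrite sqnormE (bigD1 a) //= lerDl sumr_ge0 // => *; exact: sqc_ge0. Qed.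

Lemma sqnorm0 p : sqnorm (0 : 'cV[R[i]]_p) = 0.
Proof. by rewrite sqnormE big1 // => a _; rewrite mxE /sqc /= expr0n addr0. Qed.

Lemma sqnorm_gt0 p (v : 'cV[R[i]]_p) : v != 0 -> 0 < sqnorm v.
Proof.
move=> v0; rewrite lt_def sqnorm_ge0 andbT; apply: contra v0 => /eqP s0.
apply/eqP/matrixP => a b; rewrite (ord1 b) mxE; apply/eqP.
rewrite complex_eq0 -!expr2 -[_ + _]/(sqc _) eq_le sqc_ge0 andbT -s0.
exact: sqc_le_sqnorm.
Qed.

Lemma sqnormD p (u v : 'cV[R[i]]_p) : sqnorm (u + v) <= 2 * sqnorm u + 2 * sqnorm v.
Proof.
rewrite !sqnormE !mulr_sumr -big_split; apply: ler_sum => a _.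
by rewrite mxE sqcD.
Qed.

Lemma sqnormZ p (c : R[i]) (v : 'cV[R[i]]_p) : sqnorm (c *: v) = sqc c * sqnorm v.
Proof. by rewrite !sqnormE mulr_sumr; apply: eq_bigr => a _; rewrite mxE sqcM. Qed.

Lemma ccont_sqc_bounded n (f : point R n -> R[i]) : ccont f ->
  exists2 K, 0 <= K & forall k, cube n k -> sqc (f k) <= K.
Proof.
move=> [f1 f2].
have [K K0 h] := ucont_bounded (ucontD (ucontM f1 f1) (ucontM f2 f2)).
by exists K; [exact: ltW|move=> k /h; apply: le_trans; rewrite /sqc !expr2 ler_norm].
Qed.

Lemma mcont_bounded n p q (B : point R n -> 'M[R[i]]_(p, q)) : mcont B ->
  exists2 K, 0 <= K & forall k a b, cube n k -> sqc (B k a b) <= K.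
Proof.
move=> cB.
have /choice[K hK] : forall ab : 'I_p * 'I_q, exists K, 0 <= K /\
    forall k, cube n k -> sqc (B k ab.1 ab.2) <= K.
  by move=> [a b]; have [K ? ?] := ccont_sqc_bounded (cB a b); exists K.
exists (\sum_ab K ab); first by apply: sumr_ge0 => ab _; have [] := hK ab.
move=> k a b ck; rewrite (bigD1 (a, b)) //=.
have [_ /(_ k ck) h] := hK (a, b); apply: le_trans h _.
by rewrite lerDl; apply: sumr_ge0 => ab _; have [] := hK ab.
Qed.

Lemma mcont_sqnorm_mulmx n p q (B : point R n -> 'M[R[i]]_(p, q)) : mcont B ->
  exists2 K, 0 <= K & forall k (v : 'cV_q), cube n k -> sqnorm (B k *m v) <= K * sqnorm v.
Proof.
move=> /mcont_bounded[K K0 hK].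
(* Each of the [p] entries is a sum of [q] products, which costs [2 ^+ q] by [sqc_sum]. *)
exists (p%:R * (2 ^+ q * K)); first by rewrite !mulr_ge0 // exprn_ge0.
move=> k v ck; rewrite [leLHS]sqnormE.
apply: (@le_trans _ _ (\sum_(a < p) 2 ^+ q * K * sqnorm v)); last first.
  by rewrite sumr_const card_ord -[_ *+ p]mulr_natl !mulrA.
apply: ler_sum => a _; rewrite mxE; apply: le_trans (sqc_sum _ _) _.
rewrite -[index_enum _]enumT size_enum_ord -mulrA ler_wpM2l ?exprn_ge0 //.
rewrite sqnormE mulr_sumr big_enum /=; apply: ler_sum => b _.
by rewrite sqcM ler_wpM2r ?sqc_ge0 // hK.
Qed.

End SquareNorms.

(** * Linearity, continuity and tower property of complex and matrix-valued means *)

Section ComplexAverages.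
Variable R : realType.
Implicit Types (n p q r s : nat).

Lemma glue_absorb r s n (t' : point R s) (t : point R r) (k : point R n) :
  (r <= s)%N -> glue t' (glue t k) = glue t' k.
Proof.
move=> rs; apply: eq_from_tnth => l; rewrite !tnth_mktuple.
by case: (ltnP l s) => // sl; rewrite ltnNge (leq_trans rs sl).
Qed.

Lemma eq_avg r n (f g : point R n -> R) k : cube n k ->
  (forall k', cube n k' -> f k' = g k') -> avg r f k = avg r g k.
Proof.
move=> ck fg; apply: eq_Rintegral => t; rewrite inE => ct.
by apply: fg; exact: cube_glue.
Qed.

Lemma eq_slice_integrable r n (f g : point R n -> R) k : cube n k ->
  (forall k', cube n k' -> f k' = g k') ->
  slice_integrable r f k -> slice_integrable r g k.
Proof.
move=> ck fg; apply: eq_integrable => // t; rewrite inE => ct /=.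
by congr EFin; apply: fg; exact: cube_glue.
Qed.

Lemma avg_cst r n (c : R) (k : point R n) : avg r (fun=> c) k = c.
Proof.
rewrite /avg Rintegral_cst //= (_ : fine _ = 1) ?mulr1 //.
by rewrite -[RHS]/(fine 1%E); congr fine; exact: lebesgue_cube.
Qed.

Lemma invariant_avg r s n (f : point R n -> R) : (r <= s)%N -> invariant r (avg s f).
Proof. by move=> rs t k _ _; apply: eq_Rintegral => u _; rewrite glue_absorb. Qed.

Lemma avgD r n (f g : point R n -> R) k :
  slice_integrable r f k -> slice_integrable r g k ->
  avg r (fun k => f k + g k) k = avg r f k + avg r g k.
Proof. by move=> fi gi; rewrite /avg RintegralD. Qed.

Lemma slice_integrableD r n (f g : point R n -> R) k :
  slice_integrable r f k -> slice_integrable r g k ->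
  slice_integrable r (fun k => f k + g k) k.
Proof.
move=> fi gi; have := integrableD (measurable_cube r) fi gi.
by apply: eq_integrable.
Qed.

Lemma avgZ r n (c : R) (f : point R n -> R) k :
  slice_integrable r f k -> avg r (fun k => c * f k) k = c * avg r f k.
Proof. by move=> fi; rewrite /avg RintegralZl. Qed.

Lemma slice_integrableZ r n (c : R) (f : point R n -> R) k :
  slice_integrable r f k -> slice_integrable r (fun k => c * f k) k.
Proof.
move=> fi; have := integrableZl (measurable_cube r) c fi.
by apply: eq_integrable.
Qed.

Lemma ucont_slice_integrable r n (f : point R n -> R) k :
  ucont f -> cube n k -> slice_integrable r f k.
Proof.
move=> fc ck; apply: measurable_bounded_integrable => //.
- by apply: (@le_lt_trans _ _ 1%E); [rewrite -(lebesgue_cube R r)|exact: ltry].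
- by apply: measurable_slice => //; exact: ucont_measurable.
have [K K0 hK] := ucont_bounded fc.
exists K; split; first exact: num_real.
move=> L KL t ct; apply: le_trans (ltW KL); apply: hK; exact: cube_glue.
Qed.

(** The modulus of [f] also serves its average: gluing the same [t] into [k] and [k'] does not
    increase any coordinate difference, and the cube has mass one. *)
Lemma ucont_avg r n (f : point R n -> R) : ucont f -> ucont (avg r f).
Proof.
move=> fc e e0; have [d d0 h] := fc e e0; exists d => // k k' ck ck' kk'.
have fi := ucont_slice_integrable r fc ck.
have fi' := ucont_slice_integrable r fc ck'.
pose g (p : point R r) := f (glue p k) - f (glue p k').
have gi : (lebesgue R r).-integrable (cube r) (EFin \o g).
  have := integrableB (measurable_cube r) fi fi'.
  by apply: eq_integrable.
rewrite /avg -RintegralB //.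
apply: le_trans (le_normr_Rintegral _ gi) _ => //.
rewrite -[leRHS](avg_cst r e k); apply: le_Rintegral => //.
- exact: integrable_norm.
- exact: (@ucont_slice_integrable r n (fun=> e) k (@ucont_cst _ _ _)).
move=> t ct; apply: h; [exact: cube_glue|exact: cube_glue|].
move=> i; rewrite !tnth_mktuple; case: ifP => // _.
by rewrite subrr normr0 ltW.
Qed.

Definition cavg r n (f : point R n -> R[i]) k : R[i] :=
  Complex (avg r (fun k => Re (f k)) k) (avg r (fun k => Im (f k)) k).

Definition cslice r n (f : point R n -> R[i]) k :=
  slice_integrable r (fun k => Re (f k)) k /\
  slice_integrable r (fun k => Im (f k)) k.

Lemma eq_cavg r n (f g : point R n -> R[i]) k : cube n k ->
  (forall k', cube n k' -> f k' = g k') -> cavg r f k = cavg r g k.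
Proof. by move=> ck fg; congr Complex; apply: eq_avg => // k' ck'; rewrite fg. Qed.

Lemma eq_cslice r n (f g : point R n -> R[i]) k : cube n k ->
  (forall k', cube n k' -> f k' = g k') -> cslice r f k -> cslice r g k.
Proof.
by move=> ck fg [h1 h2]; split; [apply: eq_slice_integrable h1|
  apply: eq_slice_integrable h2] => // k' ck'; rewrite fg.
Qed.

Lemma cavg_cst r n (c : R[i]) (k : point R n) : cavg r (fun=> c) k = c.
Proof. by rewrite /cavg !avg_cst; case: c. Qed.

Lemma ccont_cslice r n (f : point R n -> R[i]) k :
  ccont f -> cube n k -> cslice r f k.
Proof. by move=> [f1 f2] ck; split; exact: ucont_slice_integrable. Qed.

Lemma cslice_cst r n (c : R[i]) (k : point R n) : cube n k -> cslice r (fun=> c) k.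
Proof. exact: ccont_cslice (ccont_cst _ _). Qed.

Lemma ccont_cavg r n (f : point R n -> R[i]) : ccont f -> ccont (cavg r f).
Proof. by move=> [f1 f2]; split; exact: ucont_avg. Qed.

Lemma csliceD r n (f g : point R n -> R[i]) k : cube n k ->
  cslice r f k -> cslice r g k -> cslice r (fun k => f k + g k) k.
Proof.
move=> ck [f1 f2] [g1 g2]; split.
  by apply: eq_slice_integrable (slice_integrableD f1 g1) => // k' _; rewrite cReD.
by apply: eq_slice_integrable (slice_integrableD f2 g2) => // k' _; rewrite cImD.
Qed.

Lemma cavgD r n (f g : point R n -> R[i]) k : cube n k ->
  cslice r f k -> cslice r g k ->
  cavg r (fun k => f k + g k) k = cavg r f k + cavg r g k.
Proof.
move=> ck [f1 f2] [g1 g2]; apply: complexP.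
  rewrite cReD /= -avgD //; apply: eq_avg => // k' _; exact: cReD.
rewrite cImD /= -avgD //; apply: eq_avg => // k' _; exact: cImD.
Qed.

Lemma csliceZ r n (c : R[i]) (f : point R n -> R[i]) k : cube n k ->
  cslice r f k -> cslice r (fun k => c * f k) k.
Proof.
move=> ck [f1 f2]; split.
  apply: eq_slice_integrable (slice_integrableD (slice_integrableZ (Re c) f1)
    (slice_integrableZ (- Im c) f2)) => // k' _.
  by rewrite cReM mulNr.
apply: eq_slice_integrable (slice_integrableD (slice_integrableZ (Re c) f2)
  (slice_integrableZ (Im c) f1)) => // k' _.
by rewrite cImM.
Qed.

Lemma cavgZ r n (c : R[i]) (f : point R n -> R[i]) k : cube n k ->
  cslice r f k -> cavg r (fun k => c * f k) k = c * cavg r f k.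
Proof.
move=> ck [f1 f2]; apply: complexP.
  rewrite cReM /= -mulNr -!avgZ // -avgD; try exact: slice_integrableZ.
  by apply: eq_avg => // k' _; rewrite cReM mulNr.
rewrite cImM /= -!avgZ // -avgD; try exact: slice_integrableZ.
by apply: eq_avg => // k' _; rewrite cImM.
Qed.

Lemma cslice_sum r n (I : Type) (l : seq I) (P : pred I) (f : I -> point R n -> R[i]) k :
  cube n k -> (forall i, P i -> cslice r (f i) k) ->
  cslice r (fun k => \sum_(i <- l | P i) f i k) k.
Proof.
move=> ck fc; elim: l => [|i l IH].
  by apply: eq_cslice (cslice_cst r 0 ck) => // k' _; rewrite big_nil.
have [Pi|nPi] := boolP (P i).
  by apply: eq_cslice (csliceD ck (fc i Pi) IH) => // k' _; rewrite big_cons Pi.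
by apply: eq_cslice IH => // k' _; rewrite big_cons (negPf nPi).
Qed.

Lemma cavg_sum r n (I : Type) (l : seq I) (P : pred I) (f : I -> point R n -> R[i]) k :
  cube n k -> (forall i, P i -> cslice r (f i) k) ->
  cavg r (fun k => \sum_(i <- l | P i) f i k) k = \sum_(i <- l | P i) cavg r (f i) k.
Proof.
move=> ck fc; elim: l => [|i l IH].
  rewrite big_nil -[RHS](cavg_cst r 0 k); apply: eq_cavg => // k' _.
  by rewrite big_nil.
rewrite big_cons; have [Pi|nPi] := boolP (P i).
  rewrite -IH -cavgD //; [|exact: fc|exact: cslice_sum].
  by apply: eq_cavg => // k' _; rewrite big_cons Pi.
by rewrite -IH; apply: eq_cavg => // k' _; rewrite big_cons (negPf nPi).
Qed.

Lemma cavg_cavg s r n (f : point R n -> R[i]) k : (s <= r)%N ->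
  cslice r f k -> cavg r (cavg s f) k = cavg r f k.
Proof. by move=> sr [f1 f2]; congr Complex; [exact: (avg_avg sr f1)|exact: (avg_avg sr f2)]. Qed.

Definition mslice r n p q (f : point R n -> 'M[R[i]]_(p, q)) k :=
  forall a b, cslice r (fun k => f k a b) k.

Lemma mavgE r n p q (f : point R n -> 'M[R[i]]_(p, q)) k a b :
  mavg r f k a b = cavg r (fun k => f k a b) k.
Proof. by rewrite mxE. Qed.

Lemma eq_mavg r n p q (f g : point R n -> 'M[R[i]]_(p, q)) k : cube n k ->
  (forall k', cube n k' -> f k' = g k') -> mavg r f k = mavg r g k.
Proof.
move=> ck fg; apply/matrixP => a b; rewrite !mavgE.
by apply: eq_cavg => // k' ck'; rewrite fg.
Qed.

Lemma mcont_mslice r n p q (f : point R n -> 'M[R[i]]_(p, q)) k :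
  mcont f -> cube n k -> mslice r f k.
Proof. by move=> fc ck a b; exact: ccont_cslice. Qed.

Lemma mcont_mavg r n p q (f : point R n -> 'M[R[i]]_(p, q)) :
  mcont f -> mcont (mavg r f).
Proof. by move=> fc a b; apply: ccont_eq (ccont_cavg r (fc a b)) => k _; rewrite mavgE. Qed.

Lemma invariant_mavg r s n p q (f : point R n -> 'M[R[i]]_(p, q)) :
  (r <= s)%N -> invariant r (mavg s f).
Proof.
move=> rs t k ct ck; apply/matrixP => a b; rewrite !mavgE.
by congr Complex; [exact: (@invariant_avg r s n (fun k => Re (f k a b)) rs t k ct ck)
  |exact: (@invariant_avg r s n (fun k => Im (f k a b)) rs t k ct ck)].
Qed.

Lemma invariant_mono r s n (U : Type) (f : point R n -> U) :
  (r <= s)%N -> invariant s f -> invariant r f.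
Proof.
move=> rs sf t k ct ck.
(* If [s] exceeds [n], the missing coordinates take the default 0, which lies in [0,1]. *)
pose t' : point R s := [tuple nth (0 : R) k l | l < s].
have ct' : cube s t'.
  move=> l; rewrite tnth_mktuple; case: (ltnP l n) => ln.
    by rewrite (nth_point _ ln); exact: ck.
  by rewrite nth_default ?size_tuple // lexx ler01.
rewrite -(sf t' (glue t k)) //; last exact: cube_glue.
by rewrite glue_absorb // sf.
Qed.

Lemma mavg_invariant r n p q (f : point R n -> 'M[R[i]]_(p, q)) k :
  invariant r f -> cube n k -> mavg r f k = f k.
Proof.
move=> fi ck; apply/matrixP => a b; rewrite mavgE -[RHS](cavg_cst r _ k).
by congr Complex; apply: eq_Rintegral => t; rewrite inE => ct; rewrite fi.
Qed.

Lemma mavg_mavg s r n p q (f : point R n -> 'M[R[i]]_(p, q)) k : (s <= r)%N ->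
  mslice r f k -> cube n k -> mavg r (mavg s f) k = mavg r f k.
Proof.
move=> sr fi ck; apply/matrixP => a b; rewrite !mavgE -[RHS](cavg_cavg sr) //.
by apply: eq_cavg => // k' _; exact: mavgE.
Qed.

Lemma mavgD r n p q (f g : point R n -> 'M[R[i]]_(p, q)) k : cube n k ->
  mslice r f k -> mslice r g k ->
  mavg r (fun k => f k + g k) k = mavg r f k + mavg r g k.
Proof.
move=> ck fi gi; apply/matrixP => a b; rewrite [RHS]mxE !mavgE -cavgD //.
by apply: eq_cavg => // k' _; rewrite mxE.
Qed.

Lemma mavgZ r n p q c (f : point R n -> 'M[R[i]]_(p, q)) k : cube n k ->
  mslice r f k -> mavg r (fun k => c *: f k) k = c *: mavg r f k.
Proof.
move=> ck fi; apply/matrixP => a b; rewrite [RHS]mxE !mavgE -cavgZ //.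
by apply: eq_cavg => // k' _; rewrite mxE.
Qed.

Lemma msliceZ r n p q c (f : point R n -> 'M[R[i]]_(p, q)) k : cube n k ->
  mslice r f k -> mslice r (fun k => c *: f k) k.
Proof.
move=> ck fi a b; apply: eq_cslice (csliceZ c ck (fi a b)) => // k' _.
by rewrite mxE.
Qed.

(** The mean at [k] sees only the slice through [k]; an invariant factor can thus be frozen at its
    value in [k], after which linearity pulls it out. *)
Lemma invariant_slice r n p q (f g : point R n -> 'M[R[i]]_(p, q)) k :
  cube n k -> (forall t, cube r t -> f (glue t k) = g (glue t k)) ->
  mavg r f k = mavg r g k.
Proof.
move=> ck fg; apply/matrixP => a b; rewrite !mxE.
by congr Complex; apply: eq_Rintegral => t; rewrite inE => ct; rewrite fg.
Qed.

Lemma mavg_mulmxl r n p q l (B : point R n -> 'M[R[i]]_(p, q))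
    (u : point R n -> 'M[R[i]]_(q, l)) k : cube n k ->
  invariant r B -> mslice r u k ->
  mavg r (fun k => B k *m u k) k = B k *m mavg r u k.
Proof.
move=> ck Bi ui.
rewrite (@invariant_slice _ _ _ _ _ (fun k' => B k *m u k')) //; last first.
  by move=> t ct; rewrite Bi.
apply/matrixP => a b; rewrite [RHS]mxE mavgE.
under eq_bigr do rewrite mavgE -cavgZ //.
rewrite -cavg_sum //; last by move=> c _; exact: csliceZ.
by apply: eq_cavg => // k' _; rewrite mxE.
Qed.

Lemma mavg_mulmxr r n p q l (B : point R n -> 'M[R[i]]_(p, q))
    (c : point R n -> 'M[R[i]]_(q, l)) k : cube n k ->
  invariant r c -> mslice r B k ->
  mavg r (fun k => B k *m c k) k = mavg r B k *m c k.
Proof.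
move=> ck ci Bi.
rewrite (@invariant_slice _ _ _ _ _ (fun k' => B k' *m c k)) //; last first.
  by move=> t ct; rewrite ci.
apply/matrixP => a b; rewrite [RHS]mxE mavgE.
under eq_bigr do rewrite mulrC mavgE -cavgZ //.
rewrite -cavg_sum //; last by move=> d _; exact: csliceZ.
by apply: eq_cavg => // k' _; rewrite mxE; apply: eq_bigr => d _; rewrite mulrC.
Qed.

End ComplexAverages.

(** * Bounded operators on L^2 *)

Section SquareIntegrable.
Variables (R : realType) (N M : nat).
Local Notation vecfun := (vecfun R N M).
Local Notation mu := (lebesgue R N).
Implicit Types (u v w : vecfun) (r s : nat) (T S : vecfun -> vecfun).

Definition vmeas u := forall a,
  measurable_fun (cube N) (fun k => Re (u k a ord0)) /\
  measurable_fun (cube N) (fun k => Im (u k a ord0)).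

Definition nsq u : R := \int[mu]_(k in cube N) sqnorm (u k).

Lemma vmeas_sqnorm u : vmeas u -> measurable_fun (cube N) (fun k => sqnorm (u k)).
Proof.
move=> mu'; apply: measurable_sum => a.
have [h1 h2] := mu' a.
by apply: measurable_funD; apply: measurable_funX.
Qed.

Lemma L2_integrable u : L2 u -> mu.-integrable (cube N) (EFin \o (fun k => sqnorm (u k))).
Proof.
move=> [mu' fu]; apply/integrableP; split.
  by apply/measurable_EFinP; exact: vmeas_sqnorm.
apply: le_lt_trans fu; apply: ge0_le_integral => //.
- by do 2!apply: measurableT_comp => //; exact: vmeas_sqnorm.
- by apply/measurable_EFinP; exact: vmeas_sqnorm.
- by move=> k _; rewrite /= ger0_norm // sqnorm_ge0.
Qed.

(** The pointwise bound is asked almost everywhere, because for means of L^2 functions Jensen's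
    inequality is available only on the integrable slices. *)
Lemma L2_dominated v (g : point R N -> R) : vmeas v -> (forall k, 0 <= g k) ->
  mu.-integrable (cube N) (EFin \o g) ->
  {ae mu, forall k, cube N k -> sqnorm (v k) <= g k} ->
  L2 v /\ nsq v <= \int[mu]_(k in cube N) g k.
Proof.
move=> mv g0 gi vg; have /integrableP[mg gi'] := gi.
have le : (\int[mu]_(k in cube N) (sqnorm (v k))%:E <= \int[mu]_(k in cube N) (g k)%:E)%E.
  apply: ae_ge0_le_integral => //.
  - by move=> k _; rewrite lee_fin sqnorm_ge0.
  - by apply/measurable_EFinP; exact: vmeas_sqnorm.
  - by move=> k _; rewrite lee_fin.
have gf : (\int[mu]_(k in cube N) (g k)%:E < +oo)%E.
  apply: le_lt_trans gi'; apply: ge0_le_integral => //.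
  - by move=> k _; rewrite lee_fin.
  - by apply: measurableT_comp.
  - by move=> k _; rewrite lee_abs.
split; first by split => //; exact: le_lt_trans le gf.
rewrite fine_le // ge0_fin_numE ?(le_lt_trans le gf) //.
- by apply: integral_ge0 => k _; rewrite lee_fin sqnorm_ge0.
- by apply: integral_ge0 => k _; rewrite lee_fin.
Qed.

Lemma nsq_ge0 u : 0 <= nsq u.
Proof. by apply: Rintegral_ge0 => k _; exact: sqnorm_ge0. Qed.

Lemma L2_bounded u v C : vmeas v -> L2 u -> 0 <= C ->
  (forall k, cube N k -> sqnorm (v k) <= C * sqnorm (u k)) ->
  L2 v /\ nsq v <= C * nsq u.
Proof.
move=> mv L2u C0 vu; have ui := L2_integrable L2u.
have Cui : mu.-integrable (cube N) (EFin \o (fun k => C * sqnorm (u k))).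
  by have := integrableZl (measurable_cube N) C ui; apply: eq_integrable.
rewrite -RintegralZl //; apply: (L2_dominated mv _ Cui).
  by move=> k; rewrite mulr_ge0 // sqnorm_ge0.
exact: aeW.
Qed.

Lemma vmeasD u v : vmeas u -> vmeas v -> vmeas (fun k => u k + v k).
Proof.
move=> mu' mv a; have [u1 u2] := mu' a; have [v1 v2] := mv a; split.
  apply: (@eq_measurable_fun _ _ _ _ (cube N) (fun k => Re (u k a ord0) + Re (v k a ord0))).
    by move=> k _; rewrite mxE cReD.
  exact: measurable_funD.
apply: (@eq_measurable_fun _ _ _ _ (cube N) (fun k => Im (u k a ord0) + Im (v k a ord0))).
  by move=> k _; rewrite mxE cImD.
exact: measurable_funD.
Qed.

Lemma L2D u v : L2 u -> L2 v -> L2 (fun k => u k + v k) /\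
  nsq (fun k => u k + v k) <= 2 * nsq u + 2 * nsq v.
Proof.
move=> L2u L2v; have ui := L2_integrable L2u; have vi := L2_integrable L2v.
have u2i : mu.-integrable (cube N) (EFin \o (fun k => 2 * sqnorm (u k))).
  by have := integrableZl (measurable_cube N) 2 ui; apply: eq_integrable.
have v2i : mu.-integrable (cube N) (EFin \o (fun k => 2 * sqnorm (v k))).
  by have := integrableZl (measurable_cube N) 2 vi; apply: eq_integrable.
rewrite -!RintegralZl // -RintegralD //.
apply: L2_dominated => //.
- by apply: vmeasD; [case: L2u|case: L2v].
- by move=> k; rewrite addr_ge0 // mulr_ge0 // sqnorm_ge0.
- by have := integrableD (measurable_cube N) u2i v2i; apply: eq_integrable.
- by apply: aeW => k _; exact: sqnormD.
Qed.

Lemma vmeas_mulmx (B : point R N -> 'M[R[i]]_M) u : mcont B -> vmeas u ->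
  vmeas (fun k => B k *m u k).
Proof.
move=> cB mu' a.
have mB b := (ucont_measurable (cB a b).1, ucont_measurable (cB a b).2).
split.
  apply: (@eq_measurable_fun _ _ _ _ _ (fun k => \sum_b
    (Re (B k a b) * Re (u k b ord0) - Im (B k a b) * Im (u k b ord0)))).
    by move=> k _; rewrite mxE cRe_sum; apply: eq_bigr => b _; rewrite cReM.
  apply: measurable_sum => b; have [u1 u2] := mu' b; have [B1 B2] := mB b.
  by apply: measurable_funB; apply: measurable_funM.
apply: (@eq_measurable_fun _ _ _ _ _ (fun k => \sum_b
    (Re (B k a b) * Im (u k b ord0) + Im (B k a b) * Re (u k b ord0)))).
  by move=> k _; rewrite mxE cIm_sum; apply: eq_bigr => b _; rewrite cImM.
apply: measurable_sum => b; have [u1 u2] := mu' b; have [B1 B2] := mB b.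
by apply: measurable_funD; apply: measurable_funM.
Qed.

Lemma L2_mulmx (B : point R N -> 'M[R[i]]_M) : mcont B ->
  exists2 C, 0 <= C & forall u, L2 u ->
    L2 (fun k => B k *m u k) /\ nsq (fun k => B k *m u k) <= C * nsq u.
Proof.
move=> cB; have [C C0 h] := mcont_sqnorm_mulmx cB; exists C => // u L2u.
apply: L2_bounded => //; first by apply: vmeas_mulmx => //; case: L2u.
by move=> k ck; exact: h.
Qed.

Lemma L2_lin (c : R[i]) u v : L2 u -> L2 v -> L2 (fun k => c *: u k + v k).
Proof.
move=> L2u L2v.
have [C C0 h] := L2_mulmx (@mcont_cst R N M M c%:M).
have := (L2D (h u L2u).1 L2v).1; congr L2; apply/funext => k.
by rewrite mul_scalar_mx.
Qed.

Lemma sqr_Re_le_sqnorm p (v : 'cV[R[i]]_p) a : Re (v a ord0) ^+ 2 <= sqnorm v.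
Proof. by apply: le_trans (sqc_le_sqnorm v a); rewrite lerDl sqr_ge0. Qed.

Lemma sqr_Im_le_sqnorm p (v : 'cV[R[i]]_p) a : Im (v a ord0) ^+ 2 <= sqnorm v.
Proof. by apply: le_trans (sqc_le_sqnorm v a); rewrite lerDr sqr_ge0. Qed.

Lemma sqr_dominated_integrable r (f g : point R r -> R) :
  measurable_fun (cube r) f ->
  (lebesgue R r).-integrable (cube r) (EFin \o g) ->
  (forall t, f t ^+ 2 <= g t) ->
  (lebesgue R r).-integrable (cube r) (EFin \o (fun t => f t ^+ 2)) /\
  (lebesgue R r).-integrable (cube r) (EFin \o f).
Proof.
move=> mf gi fg; split.
  apply: (le_integrable (measurable_cube r) _ _ gi).
    by apply/measurable_EFinP; exact: measurable_funX.
  move=> t ct; rewrite /= lee_fin ger0_norm ?sqr_ge0 //.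
  exact: le_trans (fg t) (ler_norm _).
(* From [0 <= (|f| - 1)^2] one gets [|f| <= 1 + f^2 <= 1 + g], and constants are integrable on the
   cube. *)
have i1 : (lebesgue R r).-integrable (cube r) (EFin \o (fun=> 1%R)).
  have := @ucont_slice_integrable R r r (fun=> 1) (nseq_tuple r 0) (@ucont_cst _ _ _) (@cube0 R r).
  by apply: eq_integrable.
have g1i := integrableD (measurable_cube r) i1 gi.
apply: (le_integrable (measurable_cube r) _ _ g1i).
  exact/measurable_EFinP.
move=> t ct; rewrite /= lee_fin; apply: le_trans (ler_norm _).
have := fg t; have := sqr_ge0 (`|f t| - 1); rewrite sqrrB expr1n mulr1 real_normK ?num_real //.
have := sqr_ge0 (f t); move: (`|f t|) => x; lra.
Qed.

(** Jensen's inequality on a space of mass one: integrate [2 c f - c^2 <= f^2], where [c] is the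
    mean of [f]. *)
Lemma sqr_Rintegral_le r (f : point R r -> R) :
  (lebesgue R r).-integrable (cube r) (EFin \o (fun t => f t ^+ 2)) ->
  (lebesgue R r).-integrable (cube r) (EFin \o f) ->
  (\int[lebesgue R r]_(t in cube r) f t) ^+ 2 <=
  \int[lebesgue R r]_(t in cube r) (f t ^+ 2).
Proof.
move=> f2i fi; set c := (X in X ^+ 2).
have ci : (lebesgue R r).-integrable (cube r) (EFin \o (fun=> (- c ^+ 2)%R)).
  have := @ucont_slice_integrable R r r (fun=> - c ^+ 2) (nseq_tuple r 0) (@ucont_cst _ _ _) (@cube0 R r).
  by apply: eq_integrable.
have fci : (lebesgue R r).-integrable (cube r) (EFin \o (fun t => 2 * c * f t)).
  by have := integrableZl (measurable_cube r) (2 * c) fi; apply: eq_integrable.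
have : \int[lebesgue R r]_(t in cube r) (2 * c * f t + - c ^+ 2) <=
  \int[lebesgue R r]_(t in cube r) (f t ^+ 2).
  apply: le_Rintegral => //.
    by have := integrableD (measurable_cube r) fci ci; apply: eq_integrable.
  move=> t ct; rewrite -subr_ge0 (_ : _ - _ = (f t - c) ^+ 2) ?sqr_ge0 //; ring.
rewrite RintegralD // RintegralZl // -/c.
rewrite -[X in _ + X]/(avg r (fun=> - c ^+ 2) (nseq_tuple r 0 : point R r)) avg_cst.
by apply: le_trans; rewrite expr2; lra.
Qed.

Lemma L2slice_parts r u k a : vmeas u -> cube N k ->
  slice_integrable r (fun k => sqnorm (u k)) k ->
  [/\ slice_integrable r (fun k => Re (u k a ord0) ^+ 2) k,
      slice_integrable r (fun k => Re (u k a ord0)) k,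
      slice_integrable r (fun k => Im (u k a ord0) ^+ 2) k &
      slice_integrable r (fun k => Im (u k a ord0)) k].
Proof.
move=> mu' ck si; have [m1 m2] := mu' a.
have [] := sqr_dominated_integrable (measurable_slice m1 ck) si
  (fun t => sqr_Re_le_sqnorm (u (glue t k)) a).
have [] := sqr_dominated_integrable (measurable_slice m2 ck) si
  (fun t => sqr_Im_le_sqnorm (u (glue t k)) a).
by split.
Qed.

Lemma L2slice_mslice r u k : vmeas u -> cube N k ->
  slice_integrable r (fun k => sqnorm (u k)) k -> mslice r u k.
Proof.
by move=> mu' ck si a b; rewrite (ord1 b); have [] := L2slice_parts a mu' ck si.
Qed.

Lemma slice_integrable_sum r (I : finType) (F : I -> point R N -> R) k : cube N k ->
  (forall i, slice_integrable r (F i) k) ->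
  slice_integrable r (fun k => \sum_i F i k) k /\
  avg r (fun k => \sum_i F i k) k = \sum_i avg r (F i) k.
Proof.
move=> ck Fi; elim: (index_enum I) => [|i l [IH1 IH2]].
  rewrite big_nil -[X in _ = X](avg_cst r 0 k); split.
    apply: eq_slice_integrable (ucont_slice_integrable r (@ucont_cst R N 0) ck) => //.
    by move=> k' _; rewrite big_nil.
  by apply: eq_avg => // k' _; rewrite big_nil.
split.
  by apply: eq_slice_integrable (slice_integrableD (Fi i) IH1) => // k' _; rewrite big_cons.
rewrite big_cons -IH2 -avgD //.
by apply: eq_avg => // k' _; rewrite big_cons.
Qed.

Lemma sqnorm_mavg_le r u k : vmeas u -> cube N k ->
  slice_integrable r (fun k => sqnorm (u k)) k ->
  sqnorm (mavg r u k) <= avg r (fun k => sqnorm (u k)) k.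
Proof.
move=> mu' ck si.
pose F a k := Re (u k a ord0) ^+ 2 + Im (u k a ord0) ^+ 2.
have Fi a : slice_integrable r (F a) k.
  by have [h1 h2 h3 h4] := L2slice_parts a mu' ck si; exact: slice_integrableD.
have [_ ->] := slice_integrable_sum ck Fi.
rewrite sqnormE; apply: ler_sum => a _.
have [h1 h2 h3 h4] := L2slice_parts a mu' ck si.
rewrite mavgE avgD // /sqc /=.
by apply: lerD; exact: sqr_Rintegral_le.
Qed.

Lemma vmeas_mavg r u : vmeas u -> vmeas (mavg r u).
Proof.
move=> mu' a; have [m1 m2] := mu' a; split.
  apply: (@eq_measurable_fun _ _ _ _ (cube N) (avg r (fun k => Re (u k a ord0)))).
    by move=> k _; rewrite mavgE.
  exact: measurable_avg.
apply: (@eq_measurable_fun _ _ _ _ (cube N) (avg r (fun k => Im (u k a ord0)))).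
  by move=> k _; rewrite mavgE.
exact: measurable_avg.
Qed.

Lemma ae_L2slice r u : (r <= N)%N -> L2 u ->
  {ae mu, forall k, cube N k -> slice_integrable r (fun k => sqnorm (u k)) k}.
Proof. by move=> rN /L2_integrable; exact: ae_slice_integrable. Qed.

Lemma ae_mslice r u : (r <= N)%N -> L2 u ->
  {ae mu, forall k, cube N k -> mslice r u k}.
Proof.
move=> rN L2u; have := ae_L2slice rN L2u; apply: filterS => k h ck.
by apply: L2slice_mslice => //; [case: L2u|exact: h].
Qed.

(** Jensen's inequality on almost every slice, followed by Fubini for [sqnorm]. *)
Lemma L2_mavg r u : (r <= N)%N -> L2 u -> L2 (mavg r u) /\ nsq (mavg r u) <= nsq u.
Proof.
move=> rN L2u; have ui := L2_integrable L2u.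
have [gi E] := fubini rN ui.
rewrite /nsq -[leRHS]E; apply: L2_dominated => //.
- by apply: vmeas_mavg; case: L2u.
- by move=> k; apply: Rintegral_ge0 => t _; exact: sqnorm_ge0.
- have := ae_L2slice rN L2u; apply: filterS => k h ck.
  by apply: sqnorm_mavg_le => //; [case: L2u|exact: h].
Qed.

End SquareIntegrable.

Section BoundedOperators.
Variables (R : realType) (N M : nat).
Local Notation vecfun := (vecfun R N M).
Local Notation mu := (lebesgue R N).
Implicit Types (u v w : vecfun) (r s : nat) (T S : vecfun -> vecfun).

Lemma eqL2_refl u : eqL2 u u. Proof. exact: ae_eq_refl. Qed.

Lemma eqL2_sym u v : eqL2 u v -> eqL2 v u. Proof. exact: ae_eq_sym. Qed.

Lemma eqL2_trans v u w : eqL2 u v -> eqL2 v w -> eqL2 u w.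
Proof. exact: ae_eq_trans. Qed.

Lemma eqL2_cube u v : (forall k, cube N k -> u k = v k) -> eqL2 u v.
Proof. by move=> uv; exact: aeW. Qed.

Lemma eqL2D u u' v v' : eqL2 u u' -> eqL2 v v' ->
  eqL2 (fun k => u k + v k) (fun k => u' k + v' k).
Proof. by apply: filterS2 => k h1 h2 ck; rewrite h1 // h2. Qed.

Lemma eqL2_lin c u u' v v' : eqL2 u u' -> eqL2 v v' ->
  eqL2 (fun k => c *: u k + v k) (fun k => c *: u' k + v' k).
Proof. by apply: filterS2 => k h1 h2 ck; rewrite h1 // h2. Qed.

Lemma eqL2_nsq u v : vmeas u -> vmeas v -> eqL2 u v -> nsq u = nsq v.
Proof.
move=> mu' mv uv; congr fine; apply: ae_eq_integral => //.
- by apply/measurable_EFinP; exact: vmeas_sqnorm.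
- by apply/measurable_EFinP; exact: vmeas_sqnorm.
- by apply: filterS uv => k h ck; rewrite h.
Qed.

Lemma vmeas_ext u v : (forall k, cube N k -> u k = v k) -> vmeas u -> vmeas v.
Proof.
move=> uv mu' a; have [m1 m2] := mu' a; split.
  by apply: eq_measurable_fun m1 => k; rewrite inE => ck; rewrite uv.
by apply: eq_measurable_fun m2 => k; rewrite inE => ck; rewrite uv.
Qed.

Lemma nsq_ext u v : (forall k, cube N k -> u k = v k) -> nsq u = nsq v.
Proof. by move=> uv; apply: eq_Rintegral => k; rewrite inE => ck; rewrite uv. Qed.

Lemma L2_ext u v : (forall k, cube N k -> u k = v k) -> L2 u -> L2 v.
Proof.
move=> uv [mu' ui]; split; first exact: vmeas_ext mu'.
apply: le_lt_trans ui; rewrite le_eqVlt; apply/orP; left; apply/eqP.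
by apply: eq_integral => k; rewrite inE => ck; rewrite uv.
Qed.

Lemma nsq0_eqL2 w : L2 w -> nsq w = 0 -> eqL2 w (fun=> 0).
Proof.
move=> L2w w0; have wi := L2_integrable L2w.
have := ae_eq_integral_abs mu (measurable_cube N) (measurable_int _ wi).
move=> [H _]; have {H} := H _.
have -> : (\int[mu]_(x in cube N) `|(EFin \o (fun k => sqnorm (w k))) x| =
   \int[mu]_(x in cube N) (EFin \o (fun k => sqnorm (w k))) x)%E.
  by apply: eq_integral => k _; rewrite /= ger0_norm // sqnorm_ge0.
have -> : (\int[mu]_(x in cube N) (EFin \o (fun k => sqnorm (w k))) x = 0)%E.
  rewrite -[LHS]fineK; last by apply: integrable_fin_num => //.
  by congr EFin.
move=> /(_ erefl); apply: filterS => k h ck; apply/eqP.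
have [//|/sqnorm_gt0] := eqVneq (w k) 0.
by have [->] := h ck; rewrite ltxx.
Qed.

Lemma bounded_operator_nsq T : bounded_operator T ->
  exists2 C, 0 <= C & forall u, L2 u -> nsq (T u) <= C * nsq u.
Proof.
move=> [_ _ _ [K hK]]; exists (K ^+ 2); first exact: sqr_ge0.
move=> u /hK h; rewrite -(sqr_sqrtr (nsq_ge0 (T u))) -(sqr_sqrtr (nsq_ge0 u)) -exprMn.
by rewrite ler_sqr ?nnegrE ?sqrtr_ge0 // (le_trans _ h) ?sqrtr_ge0.
Qed.

(** Compatibility with [eqL2] follows from linearity and the bound: if [u = v] almost everywhere,
    then [T (u - v)] has norm 0. *)
Lemma bounded_operator_intro T :
  (forall u, L2 u -> L2 (T u)) ->
  (forall c u v, L2 u -> L2 v ->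
     eqL2 (T (fun k => c *: u k + v k)) (fun k => c *: T u k + T v k)) ->
  (exists2 C, 0 <= C & forall u, L2 u -> nsq (T u) <= C * nsq u) ->
  bounded_operator T.
Proof.
move=> L2T linT [C C0 hC]; split => //.
  move=> u v L2u L2v uv.
  have L2w := L2_lin (-1) L2v L2u.
  have w0 : nsq (fun k => (-1) *: v k + u k) = 0.
    rewrite (@eqL2_nsq _ (fun=> 0)); last 1 first.
    - by apply: filterS uv => k h ck; rewrite h // scaleN1r addNr.
    - by apply: etrans (@eq_Rintegral _ _ _ _ _ (fun=> 0) _ _) _ => [k _|];
        [exact: sqnorm0|rewrite Rintegral_cst // mul0r].
    - by case: L2w.
    - move=> a; rewrite mxE; split; exact: measurable_cst.
  have := hC _ L2w; rewrite w0 mulr0 => h.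
  have := nsq0_eqL2 (L2T _ L2w).
  have -> : nsq (T (fun k => (-1) *: v k + u k)) = 0.
    by apply/eqP; rewrite eq_le h nsq_ge0.
  move=> /(_ erefl) Tw0; have := linT (-1) v u L2v L2u.
  move: Tw0; apply: filterS2 => k h1 h2 ck.
  by have := h2 ck; rewrite (h1 ck) scaleN1r addrC => /esym/subr0_eq.
exists (Num.sqrt C) => u L2u; rewrite /normL2 -sqrtrM //.
by rewrite ler_sqrt ?mulr_ge0 ?nsq_ge0 //; exact: hC.
Qed.

Lemma bounded_operator_ext T T' :
  (forall u k, cube N k -> T u k = T' u k) -> bounded_operator T -> bounded_operator T'.
Proof.
move=> TT' bT; have [C C0 hC] := bounded_operator_nsq bT; case: bT => L2T _ linT _.
have E u : eqL2 (T' u) (T u) by apply: eqL2_cube => k ck; rewrite TT'.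
apply: bounded_operator_intro.
- move=> u /L2T; apply: L2_ext; exact: TT'.
- move=> c u v L2u L2v; apply: eqL2_trans (E _) _.
  apply: eqL2_trans (linT c u v L2u L2v) _.
  by apply: eqL2_lin; apply: eqL2_sym.
- by exists C => // u /hC; rewrite (nsq_ext (TT' u)).
Qed.

Lemma bounded_operatorD T S : bounded_operator T -> bounded_operator S ->
  bounded_operator (fun u k => T u k + S u k).
Proof.
move=> bT bS; have [C C0 hC] := bounded_operator_nsq bT.
have [D D0 hD] := bounded_operator_nsq bS.
case: bT bS => L2T _ linT _ [L2S _ linS _]; apply: bounded_operator_intro.
- by move=> u L2u; have [] := L2D (L2T u L2u) (L2S u L2u).
- move=> c u v L2u L2v; apply: eqL2_trans (eqL2D (linT c u v L2u L2v) (linS c u v L2u L2v)) _.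
  by apply: eqL2_cube => k _; rewrite scalerDr addrACA.
- exists (2 * C + 2 * D); first by rewrite addr_ge0 // mulr_ge0.
  move=> u L2u; have [_ /le_trans] := L2D (L2T u L2u) (L2S u L2u); apply.
  have h1 := hC u L2u; have h2 := hD u L2u; rewrite [leRHS]mulrDl -!mulrA.
  by apply: lerD; rewrite ler_pM2l.
Qed.

Lemma bounded_operator_comp T S : bounded_operator T -> bounded_operator S ->
  bounded_operator (fun u => T (S u)).
Proof.
move=> bT bS; have [C C0 hC] := bounded_operator_nsq bT.
have [D D0 hD] := bounded_operator_nsq bS.
case: bT bS => L2T eqT linT _ [L2S _ linS _]; apply: bounded_operator_intro.
- by move=> u L2u; exact/L2T/L2S.
- move=> c u v L2u L2v; have L2w := L2_lin c L2u L2v.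
  apply: eqL2_trans (eqT _ _ (L2S _ L2w) _ (linS c u v L2u L2v)) _.
    by apply: L2_lin; exact: L2S.
  by apply: linT; exact: L2S.
- exists (C * D); first by rewrite mulr_ge0.
  move=> u L2u; apply: le_trans (hC _ (L2S u L2u)) _; rewrite -mulrA.
  by apply: ler_wpM2l => //; exact: hD.
Qed.

Lemma bounded_operator_mulmx (B : point R N -> 'M[R[i]]_M) : mcont B ->
  bounded_operator (fun u k => B k *m u k).
Proof.
move=> cB; have [C C0 h] := L2_mulmx cB; apply: bounded_operator_intro.
- by move=> u /h[].
- by move=> c u v _ _; apply: eqL2_cube => k _; rewrite mulmxDr -scalemxAr.
- by exists C => // u /h[].
Qed.

Lemma bounded_operator_mavg r : (r <= N)%N -> bounded_operator (@mavg R r N M 1).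
Proof.
move=> rN; apply: bounded_operator_intro.
- by move=> u /(L2_mavg rN)[].
- move=> c u v L2u L2v; move: (ae_mslice rN L2u) (ae_mslice rN L2v).
  apply: filterS2 => k hu hv ck; rewrite mavgD ?mavgZ //; [exact: hu|exact/msliceZ/hu|exact: hv].
- by exists 1 => // u /(L2_mavg rN)[]; rewrite mul1r.
Qed.

Lemma bounded_operator0 : bounded_operator (fun u k => 0 : 'cV[R[i]]_M).
Proof.
apply: bounded_operator_ext (bounded_operator_mulmx (@mcont_cst R N M M 0)) => u k _.
by rewrite mul0mx.
Qed.

Lemma bounded_operator_sum (I : Type) (l : seq I) (P : pred I) (T : I -> vecfun -> vecfun) :
  (forall i, P i -> bounded_operator (T i)) ->
  bounded_operator (fun u k => \sum_(i <- l | P i) T i u k).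
Proof.
move=> bT; elim: l => [|i l IH].
  by apply: bounded_operator_ext bounded_operator0 => u k _; rewrite big_nil.
have [Pi|nPi] := boolP (P i).
  by apply: bounded_operator_ext (bounded_operatorD (bT i Pi) IH) => u k _; rewrite big_cons Pi.
by apply: bounded_operator_ext IH => u k _; rewrite big_cons (negPf nPi).
Qed.

Lemma mavg_mavg_eqL2 s r u : (s <= r)%N -> (r <= N)%N -> L2 u ->
  eqL2 (mavg r (mavg s u)) (mavg r u).
Proof.
move=> sr rN L2u; have := ae_mslice rN L2u.
by apply: filterS => k h ck; rewrite mavg_mavg //; exact: h.
Qed.

Lemma mavg_mulmx_eqL2 r (B : point R N -> 'M[R[i]]_M) u : (r <= N)%N ->
  invariant r B -> L2 u -> eqL2 (mavg r (fun k => B k *m u k)) (fun k => B k *m mavg r u k).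
Proof.
move=> rN Bi L2u; have := ae_mslice rN L2u.
by apply: filterS => k h ck; rewrite mavg_mulmxl //; exact: h.
Qed.

Lemma eqL2_mavg r u v : (r <= N)%N -> L2 u -> L2 v -> eqL2 u v ->
  eqL2 (mavg r u) (mavg r v).
Proof. by move=> rN; case: (bounded_operator_mavg rN) => _ + _ _; exact. Qed.

End BoundedOperators.

(** * The continued fractions and the truncated operators *)

Section MatrixIdentities.
Variables (K : comUnitRingType) (n : nat).
Implicit Types P B : 'M[K]_n.

(** The inverse is explicit: [1 - P (1 + B P)^-1 B]. *)
Lemma unitmx_1mul P B : 1%:M + B *m P \in unitmx -> 1%:M + P *m B \in unitmx.
Proof.
move=> u; set X := 1%:M + B *m P in u.
have E : (1%:M + P *m B) *m (1%:M - P *m invmx X *m B) = 1%:M.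
  rewrite mulmxBr mulmx1 mulmxDl mul1mx.
  have -> : P *m invmx X *m B + P *m B *m (P *m invmx X *m B) = P *m (X *m invmx X) *m B.
    by rewrite /X mulmxDl mul1mx mulmxDr mulmxDl !mulmxA.
  by rewrite mulmxV // mulmx1 addrK.
exact: (mulmx1_unit E).1.
Qed.

(** Push-through identity, a consequence of [P (1 + B P) = (1 + P B) P]. *)
Lemma mulmx_invmx_1mul P B : 1%:M + B *m P \in unitmx ->
  P *m invmx (1%:M + B *m P) = invmx (1%:M + P *m B) *m P.
Proof.
move=> u; have u' := unitmx_1mul u.
apply: (can_inj (mulKmx u')); rewrite mulKVmx //.
apply: (can_inj (mulmxK u)); rewrite -!mulmxA mulVmx // mulmx1.
by rewrite mulmxDl mulmxDr mul1mx mulmx1 mulmxA.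
Qed.

End MatrixIdentities.

Section InvariantFunctions.
Variables (R : realType) (N : nat).

Lemma invariant0 (U : Type) (f : point R N -> U) : invariant 0 f.
Proof. by move=> t k _ _; rewrite glue0. Qed.

Lemma invariant_ext r (U : Type) (f g : point R N -> U) :
  (forall k, cube N k -> f k = g k) -> invariant r f -> invariant r g.
Proof. by move=> fg fi t k ct ck; rewrite -!fg ?fi //; exact: cube_glue. Qed.

Lemma invariant_comp r (U V : Type) (h : U -> V) (f : point R N -> U) :
  invariant r f -> invariant r (fun k => h (f k)).
Proof. by move=> fi t k ct ck; rewrite fi. Qed.

Lemma invariant_comp2 r (U V W : Type) (h : U -> V -> W)
    (f : point R N -> U) (g : point R N -> V) :
  invariant r f -> invariant r g -> invariant r (fun k => h (f k) (g k)).
Proof. by move=> fi gi t k ct ck; rewrite fi ?gi. Qed.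

Lemma mcont_vmeas p (B : point R N -> 'M[R[i]]_p) a b : mcont B ->
  measurable_fun (cube N) (fun k => Re (B k a b)) /\
  measurable_fun (cube N) (fun k => Im (B k a b)).
Proof. by move=> cB; have [h1 h2] := cB a b; split; exact: ucont_measurable. Qed.

Lemma mavg0 p q (f : point R N -> 'M[R[i]]_(p, q)) k : cube N k -> mavg 0 f k = f k.
Proof. by move=> ck; rewrite mavg_invariant //; exact: invariant0. Qed.

End InvariantFunctions.

Section ContinuedFractions.
Variables (R : realType) (N M : nat).
Variable A : forall j : nat, point R (N - j) -> 'M[R[i]]_M.
Hypothesis A_continuous : forall j : nat, (j <= N)%N -> continuous_on_cube (A (j:=j)).
Variable lam : R[i].

Local Notation coef := (coef A).
Local Notation Finv := (Finv A lam).
Local Notation G := (G A lam).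
Local Notation Gbar := (Gbar A lam).
Local Notation H := (H A lam).
Local Notation D := (D A lam).

Lemma invariant_coef r j : (r <= j)%N -> invariant r (coef j).
Proof.
move=> rj t k _ _; rewrite /Defs.coef; congr A; apply: val_inj.
rewrite -[LHS]/(drop j (glue t k)) -[RHS]/(drop j k).
apply: (@eq_from_nth _ (0 : R)); rewrite !size_drop !size_tuple // => l lNj.
rewrite !nth_drop; have jlN : (j + l < N)%N by rewrite -ltn_subRL.
by rewrite !(nth_point _ jlN) tnth_mktuple /= ltnNge (leq_trans rj) // leq_addr.
Qed.

Lemma mcont_coef j : (j <= N)%N -> mcont (coef j).
Proof.
move=> jN a b; have [c1 c2] := A_continuous jN a b.
have E (f : point R (N - j) -> R) : ucont f -> ucont (fun k : point R N => f [tuple of drop j k]).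
  move=> fc e e0; have [d d0 h] := fc e e0; exists d => // k k' ck ck' kk'.
  have dropE (k0 : point R N) (i : 'I_(N - j)) (lt : (j + i < N)%N) :
      tnth [tuple of drop j k0] i = tnth k0 (Ordinal lt).
    by rewrite !(tnth_nth (0 : R)) /= nth_drop.
  have lt (i : 'I_(N - j)) : (j + i < N)%N by rewrite -ltn_subRL.
  apply: h; first by move=> i; rewrite (dropE _ _ (lt i)); exact: ck.
    by move=> i; rewrite (dropE _ _ (lt i)); exact: ck'.
  by move=> i; rewrite !(dropE _ _ (lt i)).
by split; [exact: (E (fun p => Re (A p a b)) (within_ucont c1))
  |exact: (E (fun p => Im (A p a b)) (within_ucont c2))].
Qed.

(** The inequality is strict so that [nonsingular j] is what the continuity of [G j], [Gbar j] and
    [H j] rests on; [Finv j] and [D j] also invert level [j] and ask for [nonsingular j.+1]. *)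
Definition nonsingular j := forall i, (i < j)%N -> forall k, cube N k ->
  G i k \in unitmx /\ Gbar i k \in unitmx.

Lemma nonsingular_le i j : (i <= j)%N -> nonsingular j -> nonsingular i.
Proof. by move=> ij h l li; apply: h; exact: leq_trans li ij. Qed.

(** The two properties go together: at level [j] both are needed to rewrite the mean over k_{j+1} as
    [mavg j.+1], which then yields both at the next level. The form [(1 + P B)^-1 P] of F_{j+1}^-1
    covers the points where the mean P is singular. *)
Lemma Finv_props j : (j <= N)%N -> nonsingular j.+1 ->
  mcont (Finv j) /\ invariant j (Finv j).
Proof.
elim: j => [|j IH] jN ns.
  split; last exact: invariant0.
  apply: mcontV; last by move=> k ck; have [] := ns 0%N isT k ck.
  by apply: mcontD; [exact: mcont_coef|exact: mcont_cst].
have [cF iF] := IH (ltnW jN) (nonsingular_le (leqnSn _) ns).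
have PE k : cube N k -> mean j.+1 j.+1 (Finv j) k = mavg j.+1 (Finv j) k.
  move=> ck; apply: (@mean_coordE R N (Ordinal jN)) => //.
  by move=> a b; exact: mcont_vmeas.
pose F' k := invmx (1%:M + mavg j.+1 (Finv j) k *m coef j.+1 k) *m mavg j.+1 (Finv j) k.
have FE k : cube N k -> F' k = Finv j.+1 k.
  move=> ck; have [u _] := ns j.+1 (ltnSn _) k ck.
  by rewrite /= Finv_stepE // PE.
split.
  apply: (mcont_eq FE); apply: mcontM; last exact: mcont_mavg.
  apply: mcontV.
    apply: mcontD; first exact: mcont_cst.
    by apply: mcontM; [exact: mcont_mavg|exact: mcont_coef].
  by move=> k ck; have [+ _] := ns j.+1 (ltnSn _) k ck; rewrite /= PE.
apply: (invariant_ext FE); apply: invariant_comp2; last exact: invariant_mavg.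
apply: invariant_comp; apply: invariant_comp; apply: invariant_comp2.
  exact: invariant_mavg.
exact: invariant_coef.
Qed.

Lemma mean_FinvE j k : (j < N)%N -> nonsingular j.+1 -> cube N k ->
  mean j.+1 j.+1 (Finv j) k = mavg j.+1 (Finv j) k.
Proof.
move=> jN ns ck; have [cF iF] := Finv_props (ltnW jN) ns.
apply: (@mean_coordE R N (Ordinal jN)) => //.
by move=> a b; exact: mcont_vmeas.
Qed.

Lemma G_SE j k : (j < N)%N -> nonsingular j.+1 -> cube N k ->
  G j.+1 k = 1%:M + mavg j.+1 (Finv j) k *m coef j.+1 k.
Proof. by move=> jN ns ck; rewrite /= mean_FinvE. Qed.

Lemma Gbar_SE j k : (j < N)%N -> nonsingular j.+1 -> cube N k ->
  Gbar j.+1 k = 1%:M + coef j.+1 k *m mavg j.+1 (Finv j) k.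
Proof. by move=> jN ns ck; rewrite /= mean_FinvE. Qed.

Lemma Finv_SE j k : (j < N)%N -> nonsingular j.+2 -> cube N k ->
  Finv j.+1 k = invmx (1%:M + mavg j.+1 (Finv j) k *m coef j.+1 k) *m mavg j.+1 (Finv j) k.
Proof.
move=> jN ns ck; have [u _] := ns j.+1 (ltnSn _) k ck.
rewrite -(mean_FinvE jN (nonsingular_le (leqnSn _) ns) ck).
exact: Finv_stepE u.
Qed.

Lemma mcont_G_Gbar j : (j <= N)%N -> nonsingular j -> mcont (G j) /\ mcont (Gbar j).
Proof.
case: j => [|j] jN ns.
  by split; apply: mcontD; [exact: mcont_coef|exact: mcont_cst|
     exact: mcont_coef|exact: mcont_cst].
have [cF _] := Finv_props (ltnW jN) ns.
split.
  apply: (@mcont_eq _ _ _ _ (fun k => 1%:M + mavg j.+1 (Finv j) k *m coef j.+1 k)).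
    by move=> k ck; rewrite G_SE.
  apply: mcontD; first exact: mcont_cst.
  by apply: mcontM; [exact: mcont_mavg|exact: mcont_coef].
apply: (@mcont_eq _ _ _ _ (fun k => 1%:M + coef j.+1 k *m mavg j.+1 (Finv j) k)).
  by move=> k ck; rewrite Gbar_SE.
apply: mcontD; first exact: mcont_cst.
by apply: mcontM; [exact: mcont_coef|exact: mcont_mavg].
Qed.

Lemma invariant_G_Gbar j : (j <= N)%N -> nonsingular j ->
  invariant j (G j) /\ invariant j (Gbar j).
Proof.
case: j => [|j] jN ns; first by split; exact: invariant0.
split.
  apply: (@invariant_ext _ _ _ _ (fun k => 1%:M + mavg j.+1 (Finv j) k *m coef j.+1 k)).
    by move=> k ck; rewrite G_SE.
  by apply: invariant_comp; apply: invariant_comp2; [exact: invariant_mavg|exact: invariant_coef].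
apply: (@invariant_ext _ _ _ _ (fun k => 1%:M + coef j.+1 k *m mavg j.+1 (Finv j) k)).
  by move=> k ck; rewrite Gbar_SE.
by apply: invariant_comp; apply: invariant_comp2; [exact: invariant_coef|exact: invariant_mavg].
Qed.

Definition prodGbar r k : 'M[R[i]]_M :=
  \big[mulmx/1%:M]_(0 <= i < r) Gbar (r.-1 - i) k.

Lemma prodGbarS r k : prodGbar r.+1 k = Gbar r k *m prodGbar r k.
Proof.
rewrite /prodGbar big_nat_recl //= subn0; congr mulmx.
by apply: eq_big_nat => i /andP[_ ir]; congr Gbar; rewrite subnS predn_sub.
Qed.

Lemma prodGbar_unit r k : cube N k -> nonsingular r -> prodGbar r k \in unitmx.
Proof.
move=> ck; elim: r => [|r IH] ns; first by rewrite /prodGbar big_nil unitmx1.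
rewrite prodGbarS unitmx_mul IH ?andbT; last exact: nonsingular_le ns.
by have [] := ns r (ltnSn r) k ck.
Qed.

Lemma H0E k : H 0 k = 1%:M.
Proof. by rewrite /Defs.H big_nil invmx1. Qed.

Lemma invmxM (P Q : 'M[R[i]]_M) : P \in unitmx -> Q \in unitmx ->
  invmx (P *m Q) = invmx Q *m invmx P.
Proof.
move=> uP uQ; have uPQ : P *m Q \in unitmx by rewrite unitmx_mul uP.
apply: (can_inj (mulKmx uPQ)); rewrite mulmxV //.
by rewrite mulmxA -(mulmxA P) mulmxV // mulmx1 mulmxV.
Qed.

Lemma H_SE r k : cube N k -> nonsingular r.+1 ->
  H r.+1 k = H r k *m invmx (Gbar r k).
Proof.
move=> ck ns; rewrite /Defs.H -!/(prodGbar _ _) prodGbarS invmxM //.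
  by have [] := ns r (ltnSn r) k ck.
by apply: prodGbar_unit => //; exact: nonsingular_le ns.
Qed.

Lemma mcont_prodGbar r : (r <= N.+1)%N -> nonsingular r -> mcont (prodGbar r).
Proof.
elim: r => [|r IH] rN ns.
  by apply: mcont_eq (@mcont_cst R N M M 1%:M) => k _; rewrite /prodGbar big_nil.
have ns' := nonsingular_le (leqnSn r) ns.
apply: (@mcont_eq _ _ _ _ (fun k => Gbar r k *m prodGbar r k)).
  by move=> k _; rewrite prodGbarS.
by apply: mcontM; [have [] := mcont_G_Gbar rN ns'|apply: IH => //; exact: ltnW].
Qed.

Lemma mcont_H r : (r <= N.+1)%N -> nonsingular r -> mcont (H r).
Proof.
move=> rN ns; apply: mcontV; first exact: mcont_prodGbar.
by move=> k ck; exact: prodGbar_unit.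
Qed.

Definition prodG r k : 'M[R[i]]_M := \big[mulmx/1%:M]_(0 <= i < r) G i k.

Lemma big_mulmx_recr (F : nat -> 'M[R[i]]_M) r :
  \big[mulmx/1%:M]_(0 <= i < r.+1) F i = (\big[mulmx/1%:M]_(0 <= i < r) F i) *m F r.
Proof.
elim: r F => [|r IH] F; first by rewrite big_nat_recl // !big_geq // mulmx1 mul1mx.
by rewrite [LHS]big_nat_recl // (IH (fun i => F i.+1)) [in RHS]big_nat_recl // mulmxA.
Qed.

Lemma prodG_unit r k : cube N k -> nonsingular r -> prodG r k \in unitmx.
Proof.
move=> ck; elim: r => [|r IH] ns; first by rewrite /prodG big_nil unitmx1.
rewrite /prodG big_mulmx_recr unitmx_mul IH; last exact: nonsingular_le ns.
by have [] := ns r (ltnSn r) k ck.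
Qed.

Lemma D0E k : D 0 k = invmx (G 0 k).
Proof. by rewrite /Defs.D big_nat_recl // big_geq // mulmx1. Qed.

Lemma D_SE r k : cube N k -> nonsingular r.+2 -> D r k = G r.+1 k *m D r.+1 k.
Proof.
move=> ck ns; rewrite /Defs.D (big_mulmx_recr _ r.+1) invmxM; last 2 first.
- by apply: prodG_unit => //; exact: nonsingular_le ns.
- by have [] := ns r.+1 (ltnSn _) k ck.
by rewrite mulmxA mulmxV ?mul1mx //; have [] := ns r.+1 (ltnSn _) k ck.
Qed.

Lemma mcont_D r : (r <= N)%N -> nonsingular r.+1 -> mcont (D r).
Proof.
move=> rN ns; apply: mcontV; last by move=> k ck; exact: prodG_unit ck ns.
have : forall l, (l <= r.+1)%N -> mcont (prodG l).
  elim=> [|l IH] lr.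
    by apply: mcont_eq (@mcont_cst R N M M 1%:M) => k _; rewrite /prodG big_nil.
  apply: (@mcont_eq _ _ _ _ (fun k => prodG l k *m G l k)).
    by move=> k _; rewrite /prodG big_mulmx_recr.
  apply: mcontM; first exact/IH/ltnW.
  have ns' := nonsingular_le (ltnW lr) ns.
  by have [] := mcont_G_Gbar (leq_trans (lr : (l <= r)%N) rN) ns'.
by apply.
Qed.

(** In H_{j+2} = H_{j+1} Gbar_{j+1}^-1 the last factor leaves the mean over the first j+1
    coordinates. By the tower property and induction the mean of H_{j+1} is P = <F_j^-1>_{j+1}. With
    B = A_{j+1}, push-through turns [P (1 + B P)^-1] into [(1 + P B)^-1 P], which is F_{j+1}^-1. *)
Lemma mavg_H j k : (j <= N)%N -> nonsingular j.+1 -> cube N k ->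
  mavg j (H j.+1) k = Finv j k.
Proof.
elim: j k => [|j IH] k jN ns ck.
  by rewrite mavg0 // H_SE // H0E mul1mx.
have ns' := nonsingular_le (leqnSn _) ns.
have [_ iGb] := invariant_G_Gbar jN ns'.
rewrite (@eq_mavg _ _ _ _ _ _ (fun k => H j.+1 k *m invmx (Gbar j.+1 k))) //; last first.
  by move=> k' ck'; exact: H_SE.
have cH : mcont (H j.+1) by apply: mcont_H => //; exact: ltnW.
have iVGb : invariant j.+1 (fun k => invmx (Gbar j.+1 k)) by exact: invariant_comp.
rewrite (mavg_mulmxr ck iVGb (mcont_mslice _ cH ck)).
rewrite -(@mavg_mavg R j) //; last exact: mcont_mslice.
rewrite (@eq_mavg _ _ _ _ _ _ (Finv j)) //; last by move=> k' ck'; apply: IH => //; exact: ltnW.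
have [uG uGb] := ns j.+1 (ltnSn _) k ck.
rewrite (Gbar_SE jN ns' ck) in uGb *.
by rewrite (Finv_SE jN ns ck) (mulmx_invmx_1mul uGb).
Qed.

Lemma mavg_SH j k : (j < N)%N -> nonsingular j.+1 -> cube N k ->
  mavg j.+1 (H j.+1) k = mavg j.+1 (Finv j) k.
Proof.
move=> jN ns ck; have cH : mcont (H j.+1) by apply: mcont_H => //; exact: ltnW.
rewrite -(@mavg_mavg R j) //; last exact: mcont_mslice.
by apply: eq_mavg => // k' ck'; apply: mavg_H => //; exact: ltnW.
Qed.

(** This is A^(j) - lam: the shift by [lam] is already contained in [G 0]. *)
Definition truncA j (u : vecfun R N M) : vecfun R N M := fun k =>
  G 0 k *m u k + \sum_(1 <= s < j.+1) coef s k *m mavg s u k.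

Lemma truncAS j u k : truncA j.+1 u k = truncA j u k + coef j.+1 k *m mavg j.+1 u k.
Proof. by rewrite /truncA big_nat_recr //= addrA. Qed.

Lemma truncAE u k : truncA N u k = sub_scalar (operA A) lam u k.
Proof.
rewrite /truncA /sub_scalar /operA /= mulmxBl mul_scalar_mx addrAC.
congr (_ + _ - _); apply: eq_big_nat => -[//|s] _.
by rewrite mean1E.
Qed.

Lemma eq_truncA j u v k : cube N k -> (forall k, cube N k -> u k = v k) ->
  truncA j u k = truncA j v k.
Proof.
move=> ck uv; rewrite /truncA uv //; congr (_ + _); apply: eq_bigr => s _.
by congr mulmx; exact: eq_mavg.
Qed.

(** The induction hypothesis is applied to c' = Gbar_j^-1 c, for which H_{j+1} c = H_j c'. The old
    terms then return c itself, and the new mean adds A_{j+1} <F_j^-1>_{j+1} c, which makes up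
    Gbar_{j+1} c. *)
Lemma truncA_H j (c : vecfun R N M) k : (j <= N)%N -> nonsingular j ->
  invariant j c -> cube N k -> truncA j (fun k => H j k *m c k) k = Gbar j k *m c k.
Proof.
elim: j c k => [|j IH] c k jN ns ci ck.
  by rewrite /truncA big_geq // addr0 H0E mul1mx.
have ns' := nonsingular_le (leqnSn _) ns.
pose c' k := invmx (Gbar j k) *m c k.
have [_ iGb] := invariant_G_Gbar (ltnW jN) ns'.
have c'i : invariant j c'.
  by apply: invariant_comp2; [exact: invariant_comp|exact: invariant_mono ci].
rewrite truncAS (@eq_truncA _ _ (fun k => H j k *m c' k)) //; last first.
  by move=> k' ck'; rewrite H_SE // /c' mulmxA.
rewrite IH // ?(ltnW jN) // /c' mulKVmx; last by have [] := ns j (ltnSn _) k ck.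
rewrite mavg_mulmxr //; last first.
  by apply: mcont_mslice => //; apply: mcont_H => //; exact: ltnW.
by rewrite mavg_SH // Gbar_SE // mulmxDl mul1mx mulmxA.
Qed.

Lemma bounded_operator_truncA j : (j <= N)%N -> bounded_operator (truncA j).
Proof.
move=> jN; apply: bounded_operatorD.
  apply: bounded_operator_mulmx; apply: mcontD; [exact: mcont_coef|exact: mcont_cst].
(* The bound [s <= N] is recorded in the predicate of the sum, so that each term is known to be a
   bounded operator. *)
have -> : (fun (u : vecfun R N M) k => \sum_(1 <= s < j.+1) coef s k *m mavg s u k) =
    (fun u k => \sum_(s <- index_iota 1 j.+1 | (s <= N)%N) coef s k *m mavg s u k).
  apply/funext => u; apply/funext => k; rewrite [LHS]big_nat_cond [RHS]big_seq_cond.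
  apply: eq_bigl => s; rewrite mem_index_iota andbT; case: (boolP (_ < s < _)%N) => //.
  by move=> /andP[_]; rewrite ltnS => /leq_trans ->.
apply: bounded_operator_sum => s sN.
apply: (@bounded_operator_comp _ _ _ (fun u k => coef s k *m u k)).
  exact/bounded_operator_mulmx/mcont_coef.
exact: bounded_operator_mavg.
Qed.

Definition truncR j (f : vecfun R N M) : vecfun R N M := fun k =>
  D 0 k *m f k - \sum_(1 <= r < j.+1) H r k *m coef r k *m mavg r (fun k => D r k *m f k) k.

(** The shape [c *: _ + _] is the one in which linearity of bounded operators is stated. *)
Lemma truncRS j f : truncR j.+1 f = (fun k =>
  (-1) *: (H j.+1 k *m (coef j.+1 k *m mavg j.+1 (fun k => D j.+1 k *m f k) k)) + truncR j f k).
Proof.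
apply/funext => k.
by rewrite /truncR big_nat_recr //= opprD addrA scaleN1r mulmxA addrC.
Qed.

Lemma truncRE f k : truncR N f k = resolvent_formula A lam f k.
Proof.
congr (_ - _); apply: eq_big_nat => -[//|s] _.
by rewrite mean1E.
Qed.

Lemma L2_truncR j f : (j <= N)%N -> nonsingular j.+1 -> L2 f -> L2 (truncR j f).
Proof.
move=> + + L2f; elim: j => [|j IH] jN ns.
  have [L2D0 _ _ _] := bounded_operator_mulmx (mcont_D jN ns).
  have := L2D0 f L2f; apply: L2_ext => k ck.
  by rewrite /truncR big_geq // subr0.
rewrite truncRS.
have ns' := nonsingular_le (leqnSn _) ns.
apply: L2_lin; last by apply: IH => //; exact: ltnW.
have [L2H _ _ _] := bounded_operator_mulmx (mcont_H (leqW jN) ns').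
have [L2c _ _ _] := bounded_operator_mulmx (mcont_coef jN).
have [L2D' _ _ _] := bounded_operator_mulmx (mcont_D jN ns).
by apply: L2H; apply: L2c; have [] := L2_mavg jN (L2D' f L2f).
Qed.

(* Only the first part is wanted; the second one carries the induction. *)
Lemma truncR_props j f : (j <= N)%N -> nonsingular j.+1 -> L2 f ->
  eqL2 (truncA j (truncR j f)) f /\
  eqL2 (mavg j (truncR j f)) (mavg j (fun k => D j k *m f k)).
Proof.
move=> + + L2f; elim: j => [|j IH] jN ns.
  have E k : cube N k -> truncR 0 f k = D 0 k *m f k.
    by move=> ck; rewrite /truncR big_geq // subr0.
  split; apply: eqL2_cube => k ck; last by rewrite !mavg0 // E.
  rewrite /truncA [\sum_(1 <= _ < 1) _]big_geq // addr0 E // D0E mulKVmx //.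
  by have [] := ns 0%N isT k ck.
have ns' := nonsingular_le (leqnSn _) ns; have jN' := ltnW jN.
have [IH1 IH2] := IH jN' ns'.
have cP := mcont_mavg j.+1 (Finv_props jN' ns').1.
have [L2D' _ _ _] := bounded_operator_mulmx (mcont_D jN ns).
have [L2Dj _ _ _] := bounded_operator_mulmx (mcont_D jN' ns').
have [L2H _ _ _] := bounded_operator_mulmx (mcont_H (leqW jN) ns').
have [L2c _ _ _] := bounded_operator_mulmx (mcont_coef jN).
pose m := mavg j.+1 (fun k => D j.+1 k *m f k).
have L2m : L2 m by have [] := L2_mavg jN (L2D' f L2f).
pose c k := coef j.+1 k *m m k.
have L2c' : L2 c by exact: L2c.
have ci : invariant j.+1 c.
  by apply: invariant_comp2; [exact: invariant_coef|exact: invariant_mavg].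
have L2R := L2_truncR jN' ns' L2f.
have L2Hc := L2H c L2c'.
have RE : truncR j.+1 f = (fun k => (-1) *: (H j.+1 k *m c k) + truncR j f k).
  exact: truncRS.
have [iG iGb] := invariant_G_Gbar jN ns'.
(* By the tower property R_j f may be replaced by D_j f under the larger mean; then D_j = G_{j+1}
   D_{j+1}, and G_{j+1} leaves the mean. *)
have Rm : eqL2 (mavg j.+1 (truncR j f)) (fun k => G j.+1 k *m m k).
  apply: eqL2_trans (eqL2_sym (mavg_mavg_eqL2 (leqnSn j) jN L2R)) _.
  apply: (@eqL2_trans _ _ _ (mavg j.+1 (mavg j (fun k => D j k *m f k)))).
    exact: (eqL2_mavg jN (L2_mavg jN' L2R).1 (L2_mavg jN' (L2Dj f L2f)).1 IH2).
  apply: eqL2_trans (mavg_mavg_eqL2 (leqnSn j) jN (L2Dj f L2f)) _.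
  apply: eqL2_trans (mavg_mulmx_eqL2 jN iG (L2D' f L2f)).
  by apply: eqL2_cube => k ck; apply: eq_mavg => // k' ck'; rewrite mulmxA -D_SE.
have HcE k : cube N k -> mavg j.+1 (fun k => H j.+1 k *m c k) k = mavg j.+1 (Finv j) k *m c k.
  move=> ck; rewrite mavg_mulmxr // ?mavg_SH //.
  by apply: mcont_mslice => //; apply: mcont_H => //; exact: leqW.
split.
  have [_ _ linT _] := bounded_operator_truncA jN.
  rewrite RE; apply: eqL2_trans (linT (-1) _ _ L2Hc L2R) _.
  move: IH1 Rm; apply: filterS2 => k h1 h2 ck.
  rewrite truncA_H // truncAS h1 // h2 // scaleN1r.
  rewrite (Gbar_SE jN ns' ck) (G_SE jN ns' ck) /c.
  move: (mavg _ _ k) (m k) => P x.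
  (* This is A_{j+1} G_{j+1} = Gbar_{j+1} A_{j+1}. One side comes from the new mean of R_j f, the
     other from the correction term, with opposite signs. *)
  have -> : coef j.+1 k *m ((1%:M + P *m coef j.+1 k) *m x) =
      (1%:M + coef j.+1 k *m P) *m (coef j.+1 k *m x).
    by rewrite !mulmxDl !mul1mx mulmxDr !mulmxA.
  by rewrite addrC addrK.
have [_ _ linM _] := @bounded_operator_mavg R N M j.+1 jN.
rewrite RE; apply: eqL2_trans (linM (-1) _ _ L2Hc L2R) _.
move: Rm; apply: filterS => k h2 ck.
by rewrite HcE // h2 // scaleN1r (G_SE jN ns' ck) mulmxDl mul1mx /c mulmxA addrC addrK.
Qed.

End ContinuedFractions.

(** * Approximate eigenvectors *)

Section Slab.
Variables (R : realType) (N : nat) (j : nat) (k0 : point R N).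
Hypothesis ck0 : cube N k0.
Local Notation mu := (lebesgue R N).

Definition slab (d : R) : set (point R N) :=
  [set k | cube N k /\
    forall i : 'I_N, (j <= i)%N -> `|(tnth k i : R) - (tnth k0 i : R)| <= d].

Definition chi d : point R N -> R := \1_(slab d).

Lemma chiE d k : slab d k -> chi d k = 1.
Proof. by move=> h; rewrite /chi indicE mem_set. Qed.

Lemma chi0 d k : ~ slab d k -> chi d k = 0.
Proof. by move=> h; rewrite /chi indicE memNset. Qed.

Lemma chi_ge0 d k : 0 <= chi d k. Proof. by rewrite /chi indicE. Qed.

Lemma chi_le1 d k : chi d k <= 1.
Proof. by rewrite /chi indicE; case: (_ \in _). Qed.

Lemma chi_sqr d k : chi d k ^+ 2 = chi d k.
Proof. by rewrite /chi indicE; case: (_ \in _); rewrite ?expr1n ?expr0n. Qed.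

Lemma measurable_slab d : measurable (slab d).
Proof.
pose B (i : 'I_N) : set R := if (j <= i)%N
  then [set` `[(tnth k0 i : R) - d, (tnth k0 i : R) + d]] else setT.
rewrite (_ : slab d = cube N `&` [set k | forall i : 'I_N, B i (tnth k i)]).
  apply: measurableI => //; apply: (measurable_box B) => i.
  by rewrite /B; case: ifP => _; [exact: measurable_itv|exact: measurableT].
apply/seteqP; split => k [ck h]; split => // i.
  by rewrite /B; case: ifP => // ji; rewrite /= in_itv /= -ler_distl; exact: h.
by move=> ji; have := h i; rewrite /B ji /= in_itv /= -ler_distl.
Qed.

Lemma measurable_chi d : measurable_fun (cube N) (chi d).
Proof. by apply: measurable_indic; exact: measurable_slab. Qed.

Lemma invariant_chi d : (j <= N)%N -> invariant j (chi d).
Proof.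
move=> jN t k ct ck.
suff E : slab d (glue t k) <-> slab d k.
  by rewrite /chi !indicE; congr (_ %:R); congr nat_of_bool; apply/idP/idP;
    rewrite !inE => /E.
split=> -[_ h]; split => //; try exact: cube_glue.
  by move=> i ji; have := h i ji; rewrite tnth_mktuple ltnNge ji.
by move=> i ji; rewrite tnth_mktuple ltnNge ji; exact: h.
Qed.

Lemma chi_slice_integrable r d k : cube N k -> slice_integrable r (chi d) k.
Proof.
move=> ck; apply: measurable_bounded_integrable => //.
- by apply: (@le_lt_trans _ _ 1%E); [rewrite -(lebesgue_cube R r)|exact: ltry].
- by apply: measurable_slice => //; exact: measurable_chi.
exists 1; split => // L L1 t ct; apply: le_trans (ltW L1).
by rewrite /= ger0_norm ?chi_ge0 // chi_le1.
Qed.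

Lemma chi_integrable d : mu.-integrable (cube N) (EFin \o chi d).
Proof.
have := @chi_slice_integrable N d k0 ck0; apply: eq_integrable => // t _.
by rewrite /= glue_full.
Qed.

(** The volume of the slab. The estimates of the approximate eigenvectors are relative to it, and it
    cancels at the end because it is positive. *)
Definition mass d := \int[mu]_(k in cube N) chi d k.

End Slab.

Section ApproximateEigenvectors.
Variables (R : realType) (N : nat) (j : nat) (k0 : point R N).
Hypotheses (ck0 : cube N k0) (jN : (j <= N)%N).
Local Notation mu := (lebesgue R N).

Lemma mass_gt0 d : 0 < d -> 0 < mass j k0 d.
Proof.
move=> d0.
have sub : slab 0 k0 d `<=` slab j k0 d.
  by move=> k [ck h]; split => // i _; exact: h.
have E : (\int[mu]_(k in cube N) (chi j k0 d k)%:E = mu (slab j k0 d))%E.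
  rewrite integral_indic //; last exact: measurable_slab.
  by congr (lebesgue R N _); apply/setIidl => k [].
have fin : (mu (slab j k0 d) < +oo)%E.
  apply: (@le_lt_trans _ _ (mu (cube N))); last by rewrite lebesgue_cube ltry.
  apply: le_measure; rewrite ?inE //; first exact: measurable_slab.
  by move=> k [].
rewrite /mass /Rintegral E fine_gt0 // fin andbT.
apply: (@lt_le_trans _ _ (mu (slab 0 k0 d))); last first.
  by apply: le_measure; rewrite ?inE //; exact: measurable_slab.
apply: lt_le_trans (lebesgue_box_gt0 ck0 d0) _.
rewrite le_eqVlt; apply/orP; left; apply/eqP; congr (lebesgue R N _).
by apply/seteqP; split => k [ck h]; split => // i *; exact: h.
Qed.

Lemma avg_chi_ge0 s d k : 0 <= avg s (chi j k0 d) k.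
Proof. by apply: Rintegral_ge0 => t _; exact: chi_ge0. Qed.

(** As [s > j], the mean runs over k_s, which the slab confines to an interval of length [2 d]; the
    other coordinates contribute at most a factor 1. *)
Lemma avg_chi_le s d k : (j < s <= N)%N -> 0 <= d -> cube N k ->
  avg s (chi j k0 d) k <= 2 * d.
Proof.
move=> /andP[js sN] d0 ck.
case: s js sN => // s js sN; pose l : 'I_N := Ordinal sN.
pose a : R := tnth k0 l.
pose I : set (measurableTypeR R) := [set` `[a - d, a + d]].
have mI : measurable I by exact: measurable_itv.
pose f : measurableTypeR R -> R := \1_I.
have f0 x : 0 <= f x <= 1 by rewrite /f indicE; case: (_ \in _); rewrite ?lexx ?ler01.
have mf D : measurable_fun D f by exact: measurable_indic.
have m1 : ((lebesgue R s.+1) (cube s.+1) < +oo)%E.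
  by apply: (@le_lt_trans _ _ 1%E); [rewrite -(lebesgue_cube R s.+1)|exact: ltry].
have fi : (lebesgue R s.+1).-integrable (cube s.+1) (EFin \o (fun t => f (tnth t ord_max))).
  apply: measurable_bounded_integrable => //.
    apply: measurableT_comp; first exact: mf.
    by apply: measurable_funTS; exact: measurable_tnth.
  exists 1; split => // L L1 t ct; apply: le_trans (ltW L1).
  by have /andP[h1 h2] := f0 (tnth t ord_max); rewrite /= ger0_norm.
apply: (@le_trans _ _ (\int[lebesgue R s.+1]_(t in cube s.+1) f (tnth t ord_max))).
  apply: le_Rintegral => //; first exact: chi_slice_integrable.
  move=> t ct; have [h|h] := pselect (slab j k0 d (glue t k)).
    rewrite chiE // /f indicE mem_set //= /I /= in_itv /= -ler_distl.
    have [_ /(_ l js)] := h; rewrite tnth_mktuple /= ltnSn.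
    by rewrite [tnth t ord_max](tnth_nth (0 : R)).
  by rewrite chi0 //; have /andP[] := f0 (tnth t ord_max).
rewrite (Rintegral_coord (@ord_max s) (mf _)).
set J := `[0, 1]%classic.
have mJ : measurable (J : set (measurableTypeR R)) by exact: measurable_itv.
have E : (\int[lebesgue_measure]_(x in J) (f x)%:E <= (2 * d)%:E)%E.
  rewrite integral_indic //.
  apply: (@le_trans _ _ (lebesgue_measure I)).
    by apply: le_measure; rewrite ?inE //; exact: measurableI.
  rewrite /I lebesgue_measure_itv /= lte_fin; case: ifP => _.
    by rewrite -EFinB lee_fin; lra.
  by rewrite lee_fin mulr_ge0.
rewrite -lee_fin; apply: le_trans (E); rewrite fineK //.
rewrite ge0_fin_numE; last by apply: integral_ge0 => x _; rewrite lee_fin; case/andP: (f0 x).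
by apply: le_lt_trans E _; rewrite ltry.
Qed.

Lemma avg_chi_mass s d : (s <= N)%N ->
  mu.-integrable (cube N) (EFin \o avg s (chi j k0 d)) /\
  \int[mu]_(k in cube N) avg s (chi j k0 d) k = mass j k0 d.
Proof. by move=> sN; exact: fubini sN (chi_integrable j ck0 d). Qed.

End ApproximateEigenvectors.

(** * Invertibility of G_j and Gbar_j off the spectrum *)

Section SpectrumBound.
Variables (R : realType) (N M : nat).
Variable A : forall j : nat, point R (N - j) -> 'M[R[i]]_M.
Hypothesis A_continuous : forall j : nat, (j <= N)%N -> continuous_on_cube (A (j:=j)).
Variable lam : R[i].
Local Notation mu := (lebesgue R N).
Local Notation coef := (coef A).
Local Notation G := (G A lam).
Local Notation Gbar := (Gbar A lam).
Local Notation H := (H A lam).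
Local Notation truncA := (truncA A lam).
Local Notation nonsingular := (nonsingular A lam).

(** Serves to choose the final tolerance: the summand 1 keeps the denominator positive when [x]
    vanishes, and the factor 1/2 gives a margin. *)
Lemma mul_div_succ_lt (x y : R) : 0 <= x -> 0 < y -> x * (y / (x + 1) / 2) < y.
Proof.
move=> x0 y0; have x1 : 0 < x + 1 by rewrite ltr_wpDl.
rewrite (_ : x * _ = y * (x / (x + 1) / 2)); last by field; rewrite gt_eqF.
rewrite gtr_pMr // ltr_pdivrMr // mul1r ltr_pdivrMr //; lra.
Qed.

Lemma ucont_sqnorm p (f : point R N -> 'cV[R[i]]_p) : mcont f ->
  ucont (fun k => sqnorm (f k)).
Proof.
move=> cf; apply: ucont_sum => a _; have [h1 h2] := cf a ord0.
by apply: ucontD; [apply: ucont_eq (ucontM h1 h1)|apply: ucont_eq (ucontM h2 h2)] => k _;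
  rewrite expr2.
Qed.

Section ApproximateEigenvector.
Variables (j : nat) (k0 : point R N) (v : 'cV[R[i]]_M).
Hypotheses (jN : (j <= N)%N) (ns : nonsingular j) (ck0 : cube N k0).
Local Notation chi := (chi j k0).
Local Notation mass := (mass j k0).

Definition bump d : vecfun R N M := fun k => (chi d k)%:C%C *: v.

Definition approx_eigen d : vecfun R N M := fun k => H j k *m bump d k.

Lemma sqnorm_bumpE d k : sqnorm (bump d k) = sqnorm v * chi d k.
Proof. by rewrite sqnormZ /sqc /= expr0n addr0 chi_sqr mulrC. Qed.

Lemma vmeas_bump d : vmeas (bump d).
Proof.
have mchi := @measurable_chi R N j k0 d => a; split.
  apply: (@eq_measurable_fun _ _ _ _ (cube N) (fun k => chi d k * Re (v a ord0))).
    by move=> k _; rewrite mxE cReM /= mul0r subr0.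
  exact: measurable_funM.
apply: (@eq_measurable_fun _ _ _ _ (cube N) (fun k => chi d k * Im (v a ord0))).
  by move=> k _; rewrite mxE cImM /= mul0r addr0.
exact: measurable_funM.
Qed.

Lemma integrable_cchi C d : mu.-integrable (cube N) (EFin \o (fun k => C * chi d k)).
Proof.
have := integrableZl (measurable_cube N) C (chi_integrable j ck0 d).
by apply: eq_integrable.
Qed.

Lemma L2_bump d : L2 (bump d).
Proof.
have [] := @L2_dominated R N M (bump d) (fun k => sqnorm v * chi d k) (vmeas_bump d) _
  (integrable_cchi (sqnorm v) d) _ => //.
  by move=> k; rewrite mulr_ge0 ?sqnorm_ge0 ?chi_ge0.
by apply: aeW => k _; rewrite sqnorm_bumpE.
Qed.

Lemma nsq_bump d : nsq (bump d) = sqnorm v * mass d.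
Proof.
rewrite /mass -RintegralZl //; last exact: chi_integrable.
by apply: eq_Rintegral => k _; exact: sqnorm_bumpE.
Qed.

Lemma invariant_bump d : invariant j (bump d).
Proof. by move=> t k ct ck; rewrite /bump (invariant_chi k0 d jN). Qed.

Lemma L2_approx_eigen d : L2 (approx_eigen d).
Proof.
have [+ _ _ _] := bounded_operator_mulmx (mcont_H A_continuous (leqW jN) ns).
by apply; exact: L2_bump.
Qed.

Lemma sqnorm_approx_eigen :
  exists2 L, 0 <= L & forall d k, sqnorm (approx_eigen d k) <= L * chi d k.
Proof.
have [C C0 hC] := mcont_sqnorm_mulmx (mcont_H A_continuous (leqW jN) ns).
exists (C * sqnorm v); first by rewrite mulr_ge0 ?sqnorm_ge0.
move=> d k; have [[ck h]|h] := pselect (slab j k0 d k).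
  by apply: le_trans (hC k (bump d k) ck) _; rewrite sqnorm_bumpE mulrA.
by rewrite /approx_eigen /bump chi0 // scale0r mulmx0 sqnorm0 mulr0.
Qed.

(* Since [chi d] only takes the values 0 and 1, the hypothesis on [f] bounds
   |f| itself by a multiple of [chi d]; the mean of [chi d] is at most 2 d. *)
Lemma sqr_avg_le L d s (f : point R N -> R) k : (j < s <= N)%N -> 0 <= d -> 0 <= L ->
  cube N k -> slice_integrable s f k -> (forall k, f k ^+ 2 <= L * chi d k) ->
  avg s f k ^+ 2 <= L * (2 * d) * avg s (chi d) k.
Proof.
move=> jsN d0 L0 ck fi fL.
have fL' k' : `|f k'| <= Num.sqrt L * chi d k'.
  rewrite -(@ler_pXn2r _ 2) ?nnegrE ?mulr_ge0 ?sqrtr_ge0 ?chi_ge0 //.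
  by rewrite real_normK ?num_real // exprMn sqr_sqrtr // chi_sqr.
have chii := chi_slice_integrable j k0 s d ck.
have le : `|avg s f k| <= Num.sqrt L * avg s (chi d) k.
  rewrite -avgZ //; apply: le_trans (le_normr_Rintegral _ fi) _ => //.
  apply: le_Rintegral => //; first exact: integrable_norm.
  exact: slice_integrableZ.
rewrite -real_normK ?num_real //.
apply: (@le_trans _ _ ((Num.sqrt L * avg s (chi d) k) ^+ 2)).
  by rewrite ler_sqr ?nnegrE ?mulr_ge0 ?sqrtr_ge0 ?avg_chi_ge0.
rewrite exprMn sqr_sqrtr // -mulrA ler_wpM2l // expr2.
by rewrite ler_wpM2r ?avg_chi_ge0 // avg_chi_le.
Qed.

Lemma nsq_mavg_approx_eigen s : (j < s <= N)%N ->
  exists2 C, 0 <= C & forall d, 0 <= d ->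
    nsq (mavg s (approx_eigen d)) <= C * d * mass d.
Proof.
move=> jsN; have /andP[js sN] := jsN.
have [L L0 hL] := sqnorm_approx_eigen.
(* [M] counts the components, the first 2 the real and imaginary parts, and [L * 2] comes from
   [sqr_avg_le]. *)
exists (M%:R * (2 * (L * 2))); first by rewrite !mulr_ge0.
move=> d d0; have L2u := L2_approx_eigen d; have [mu' _] := L2u.
(* A mean of [chi d] has the same integral as [chi d], so a pointwise bound by that mean still
   integrates to a multiple of [mass d]. *)
have [gi <-] := avg_chi_mass j ck0 d sN.
pose C := M%:R * (2 * (L * 2)) * d.
have Cgi : mu.-integrable (cube N) (EFin \o (fun k => C * avg s (chi d) k)).
  by have := integrableZl (measurable_cube N) C gi; apply: eq_integrable.
rewrite -/C -RintegralZl //.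
apply: (@L2_dominated R N M (mavg s (approx_eigen d)) (fun k => C * avg s (chi d) k)
  (vmeas_mavg s mu') _ Cgi _).2.
  by move=> k; rewrite !mulr_ge0 // avg_chi_ge0.
apply: aeW => k ck.
have ui a : slice_integrable s (fun k => Re (approx_eigen d k a ord0)) k /\
            slice_integrable s (fun k => Im (approx_eigen d k a ord0)) k.
  have si : slice_integrable s (fun k => L * chi d k) k.
    by apply: slice_integrableZ; exact: chi_slice_integrable.
  have [m1 m2] := mu' a; split.
    apply: (sqr_dominated_integrable (measurable_slice m1 ck) si _).2 => t.
    by apply: le_trans (hL _ _); exact: sqr_Re_le_sqnorm.
  apply: (sqr_dominated_integrable (measurable_slice m2 ck) si _).2 => t.
  by apply: le_trans (hL _ _); exact: sqr_Im_le_sqnorm.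
rewrite sqnormE.
apply: (@le_trans _ _ (\sum_(a < M) 2 * (L * (2 * d) * avg s (chi d) k))); last first.
  rewrite sumr_const card_ord -[_ *+ M]mulr_natl /C.
  by rewrite le_eqVlt; apply/orP; left; apply/eqP; ring.
apply: ler_sum => a _; rewrite mavgE /sqc /=.
have [u1 u2] := ui a.
have h1 := @sqr_avg_le L d s _ k jsN d0 L0 ck u1 _.
have h2 := @sqr_avg_le L d s _ k jsN d0 L0 ck u2 _.
rewrite mulr2n mulrDl mul1r; apply: lerD.
  by apply: h1 => k'; apply: le_trans (hL _ _); exact: sqr_Re_le_sqnorm.
by apply: h2 => k'; apply: le_trans (hL _ _); exact: sqr_Im_le_sqnorm.
Qed.

(** Induction on the number [l] of means beyond the j-th. For [l = 0] the image is Gbar_j v on the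
    slab, by [truncA_H]; each further term adds a multiple of [d <= e]. The constant must not depend
    on [e] and [d], which are chosen after it. *)
Lemma nsq_truncA_approx_eigen l : (j + l <= N)%N ->
  exists2 C, 0 <= C & forall e d, 0 <= d <= e ->
    (forall k, slab j k0 d k -> sqnorm (Gbar j k *m v) <= e) ->
    nsq (truncA (j + l) (approx_eigen d)) <= C * e * mass d.
Proof.
elim: l => [|l IH] lN.
  exists 1 => // e d /andP[d0 de] he; have e0 := le_trans d0 de.
  rewrite addn0 mul1r /mass -RintegralZl //; last exact: chi_integrable.
  have [L2T _ _ _] := bounded_operator_truncA A_continuous lam jN.
  apply: (L2_dominated (L2T _ (L2_approx_eigen d)).1 _ (integrable_cchi e d) _).2.
    by move=> k; rewrite mulr_ge0 ?chi_ge0.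
  apply: aeW => k ck; rewrite truncA_H //; last exact: invariant_bump.
  rewrite /bump -scalemxAr sqnormZ /sqc /= expr0n addr0 chi_sqr.
  have [h|h] := pselect (slab j k0 d k); last by rewrite chi0 // mul0r mulr0.
  by rewrite chiE // mul1r mulr1 he.
rewrite addnS in lN *.
have lN' := ltnW lN; have [C C0 hC] := IH lN'.
have jlN : (j < (j + l).+1 <= N)%N by rewrite lN andbT ltnS leq_addr.
have [C1 C10 hC1] := nsq_mavg_approx_eigen jlN.
have [C2 C20 hC2] := L2_mulmx (mcont_coef A_continuous lN).
exists (2 * C + 2 * (C2 * C1)); first by rewrite addr_ge0 // !mulr_ge0.
move=> e d /andP[d0 de] he; have e0 := le_trans d0 de.
have L2u := L2_approx_eigen d.
have [L2T _ _ _] := bounded_operator_truncA A_continuous lam lN'.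
have L2m := (L2_mavg lN L2u).1.
have [L2cm hcm] := hC2 _ L2m.
rewrite (@nsq_ext _ _ _ _ (fun k => truncA (j + l) (approx_eigen d) k +
    coef (j + l).+1 k *m mavg (j + l).+1 (approx_eigen d) k)); last first.
  by move=> k _; exact: truncAS.
apply: le_trans (L2D (L2T _ L2u) L2cm).2 _.
have m0 : 0 <= mass d by apply: Rintegral_ge0 => k _; exact: chi_ge0.
have h1 := hC e d (introT andP (conj d0 de)) he.
have h2 : nsq (fun k => coef (j + l).+1 k *m mavg (j + l).+1 (approx_eigen d) k) <=
    C2 * C1 * e * mass d.
  apply: le_trans hcm _; rewrite -!mulrA ler_wpM2l //.
  apply: le_trans (hC1 d d0) _; rewrite -mulrA ler_wpM2l //.
  by rewrite ler_wpM2r.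
rewrite [leRHS](_ : _ = 2 * (C * e * mass d) + 2 * (C2 * C1 * e * mass d)); last ring.
by apply: lerD; rewrite ler_pM2l.
Qed.

(* Otherwise the functions [approx_eigen d], d -> 0, would contradict the
   boundedness of the inverse. *)
Lemma resolvent_kernel_Gbar S : is_resolvent (operA A) lam S ->
  Gbar j k0 *m v = 0 -> v = 0.
Proof.
move=> [bS invS] Gv; have [//|v0] := eqVneq v 0.
have v_gt0 := sqnorm_gt0 v0.
have [K K0 hK] := bounded_operator_nsq bS.
have := @nsq_truncA_approx_eigen (N - j); rewrite subnKC // => /(_ (leqnn N))[C C0 hC].
have [C1 C10 hC1] := L2_mulmx (mcont_prodGbar A_continuous (leqW jN) ns).
(* Multiplying by [prodGbar], the inverse of [H j], recovers the bump from u, so with squared norms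
   |bump| <= C1 |u| <= C1 K |(A - lam) u| <= C1 K C e mass. As |bump| = |v| mass, any [e] with
   [B * e] below the squared norm of [v] is contradictory. *)
pose B := C1 * (K * C).
have B0 : 0 <= B by rewrite !mulr_ge0.
pose e := sqnorm v / (B + 1) / 2.
have B1 : 0 < B + 1 by rewrite ltr_wpDl.
have e0 : 0 < e by rewrite !divr_gt0.
have [_ iGb] := invariant_G_Gbar A_continuous jN ns.
have cg : mcont (fun k => Gbar j k *m v).
  by apply: mcontM; [exact: (mcont_G_Gbar A_continuous jN ns).2|exact: mcont_cst].
have ig : invariant j (fun k => sqnorm (Gbar j k *m v)).
  by apply: invariant_comp; apply: (@invariant_comp _ _ _ _ _ (fun B => B *m v)).
have [d' d'0 hd'] := ucont_invariant_at jN (ucont_sqnorm cg) ig ck0 e0.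
pose d := Num.min d' e.
have d0 : 0 < d by rewrite lt_min d'0.
have de : 0 <= d <= e by rewrite (ltW d0) ge_min lexx orbT.
have he k : slab j k0 d k -> sqnorm (Gbar j k *m v) <= e.
  move=> [ck h]; have := hd' k ck; rewrite Gv sqnorm0 subr0 (ger0_norm (sqnorm_ge0 _)).
  by apply => i ji; apply: le_trans (h i ji) _; rewrite ge_min lexx.
have m0 := mass_gt0 j ck0 d0.
have L2u := L2_approx_eigen d.
have [L2T _ _ _] := bounded_operator_truncA A_continuous lam (leqnn N).
have TE : truncA N (approx_eigen d) = sub_scalar (operA A) lam (approx_eigen d).
  by apply/funext => k; exact: truncAE.
have L2Tu := L2T _ L2u.
have h1 := hC e d de he.
have h2 := hK _ L2Tu.
have E : nsq (S (truncA N (approx_eigen d))) = nsq (approx_eigen d).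
  rewrite TE; apply: eqL2_nsq; last by have [] := invS _ L2u.
    by rewrite -TE; case: bS => + _ _ _ => /(_ _ L2Tu)[].
  by case: L2u.
have h3 := (hC1 _ L2u).2.
have E2 : nsq (fun k => prodGbar A lam j k *m approx_eigen d k) = nsq (bump d).
  by apply: nsq_ext => k ck; rewrite mulKVmx //; exact: prodGbar_unit.
have h4 : sqnorm v * mass d <= B * e * mass d.
  rewrite (_ : B * e * mass d = C1 * (K * (C * e * mass d))); last by rewrite /B; ring.
  rewrite -nsq_bump -E2; apply: le_trans h3 _; rewrite ler_wpM2l //.
  by rewrite -E; apply: le_trans h2 _; rewrite ler_wpM2l.
have h5 : sqnorm v <= B * e by rewrite -(ler_pM2r m0).
have h6 : B * e < sqnorm v.
  exact: mul_div_succ_lt.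
by have := le_lt_trans h5 h6; rewrite ltxx.
Qed.

End ApproximateEigenvector.

Lemma unitmx_of_trivial_kernel n (B : 'M[R[i]]_n) :
  (forall w : 'cV_n, B *m w = 0 -> w = 0) -> B \in unitmx.
Proof.
move=> hB; rewrite unitmxE unitfE; apply/negP => /eqP dB.
have /eqP/det0P[w w0 wB] : \det B^T = 0 by rewrite det_tr.
case/negP: w0; apply/eqP/trmx_inj; rewrite trmx0; apply: hB.
by apply: trmx_inj; rewrite trmx_mul trmxK wB trmx0.
Qed.

(** The levels have to be treated in order: the approximate eigenvectors for Gbar_j are built from
    H_j, whose continuity rests on all lower levels. *)
Lemma resolvent_nonsingular S j : is_resolvent (operA A) lam S ->
  (j <= N.+1)%N -> nonsingular j.
Proof.
move=> resS; elim: j => [|j IH] jN; first by [].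
have ns := IH (ltnW jN).
move=> i; rewrite ltnS leq_eqVlt => /predU1P[->|ij]; last exact: ns.
move=> k ck; have uGb : Gbar j k \in unitmx.
  by apply: unitmx_of_trivial_kernel => w; apply: resolvent_kernel_Gbar resS.
(* At level 0 both functions are A_0 - lam; above it invertibility passes from [1 + B P] to
   [1 + P B]. *)
split => //; case: j {IH} jN ns uGb => [//|j] jN ns.
rewrite Gbar_SE // G_SE //; exact: unitmx_1mul.
Qed.

End SpectrumBound.

(** * The Hermitian case *)

Section Adjoint.
Variable R : realType.

Lemma tJ_mulmx p q r (B : 'M[R[i]]_(p, q)) (C : 'M[R[i]]_(q, r)) :
  (B *m C)^t* = C^t* *m B^t*.
Proof. by rewrite trmx_mul map_mxM. Qed.

Lemma tJD p q (B C : 'M[R[i]]_(p, q)) : (B + C)^t* = B^t* + C^t*.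
Proof. by apply/matrixP => a b; rewrite !mxE rmorphD. Qed.

Lemma tJ_invmx p (B : 'M[R[i]]_p) : (invmx B)^t* = invmx (B^t*).
Proof. by rewrite trmx_inv map_invmx. Qed.

Lemma tJ1 p : (1%:M : 'M[R[i]]_p)^t* = 1%:M.
Proof. by rewrite trmx1 map_mx1. Qed.

Lemma tJ_mavg N r p q (f : point R N -> 'M[R[i]]_(p, q)) k : cube N k -> mslice r f k ->
  (mavg r f k)^t* = mavg r (fun k => (f k)^t*) k.
Proof.
move=> ck fi; apply/matrixP => a b; rewrite !mxE; apply: complexP.
  by rewrite cReJ /=; apply: eq_avg => // k' _; rewrite !mxE cReJ.
rewrite cImJ /= -mulN1r -avgZ; last by have [] := fi b a.
by apply: eq_avg => // k' _; rewrite !mxE cImJ mulN1r.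
Qed.

Lemma mslice_tJ N r p q (f : point R N -> 'M[R[i]]_(p, q)) k : cube N k ->
  mslice r f k -> mslice r (fun k => (f k)^t*) k.
Proof.
move=> ck fi a b; have [h1 h2] := fi b a; split.
  by apply: eq_slice_integrable h1 => // k' _; rewrite !mxE cReJ.
apply: eq_slice_integrable (slice_integrableZ (-1) h2) => // k' _.
by rewrite !mxE cImJ mulN1r.
Qed.

End Adjoint.

Section InnerProduct.
Variables (R : realType) (N M : nat).
Local Notation vecfun := (vecfun R N M).
Local Notation mu := (lebesgue R N).
Implicit Types u v w : vecfun.

(** Written as a 1 x 1 matrix product, the integrand of the inner product is subject to the matrix
    lemmas on means and adjoints. *)
Definition ip u v (k : point R N) : 'M[R[i]]_1 := (v k)^t* *m u k.

(* [mavg N f] is constant, so that it can be evaluated at any point. *)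
Definition origin : point R N := nseq_tuple N 0.

Lemma innerL2E u v : innerL2 u v = mavg N (ip u v) origin ord0 ord0.
Proof.
rewrite mavgE /cavg /innerL2 /cube_integral.
by congr Complex; apply: eq_Rintegral => k _; rewrite glue_full /ip !mxE;
  congr (_ (_ : R[i])); apply: eq_bigr => a _; rewrite !mxE mulrC.
Qed.

Lemma ip_parts u v k : Re (ip u v k ord0 ord0) =
    \sum_a (Re (v k a ord0) * Re (u k a ord0) + Im (v k a ord0) * Im (u k a ord0)) /\
  Im (ip u v k ord0 ord0) =
    \sum_a (Re (v k a ord0) * Im (u k a ord0) - Im (v k a ord0) * Re (u k a ord0)).
Proof.
rewrite !mxE cRe_sum cIm_sum; split; apply: eq_bigr => a _.
  by rewrite !mxE cReM cReJ cImJ mulNr opprK.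
by rewrite !mxE cImM cReJ cImJ mulNr.
Qed.

Lemma measurable_ip u v : vmeas u -> vmeas v ->
  measurable_fun (cube N) (fun k => Re (ip u v k ord0 ord0)) /\
  measurable_fun (cube N) (fun k => Im (ip u v k ord0 ord0)).
Proof.
move=> mu' mv; split.
  apply: (@eq_measurable_fun _ _ _ _ (cube N) (fun k =>
    \sum_a (Re (v k a ord0) * Re (u k a ord0) + Im (v k a ord0) * Im (u k a ord0)))).
    by move=> k _; rewrite (ip_parts u v k).1.
  apply: measurable_sum => a; have [u1 u2] := mu' a; have [v1 v2] := mv a.
  by apply: measurable_funD; apply: measurable_funM.
apply: (@eq_measurable_fun _ _ _ _ (cube N) (fun k =>
    \sum_a (Re (v k a ord0) * Im (u k a ord0) - Im (v k a ord0) * Re (u k a ord0)))).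
  by move=> k _; rewrite (ip_parts u v k).2.
apply: measurable_sum => a; have [u1 u2] := mu' a; have [v1 v2] := mv a.
by apply: measurable_funB; apply: measurable_funM.
Qed.

Lemma ler_norm_cross (a b c d : R) :
  `|a * c + b * d| <= (c ^+ 2 + d ^+ 2) + (a ^+ 2 + b ^+ 2).
Proof.
have h1 := sqr_ge0 (a - c); have h2 := sqr_ge0 (b - d).
have h3 := sqr_ge0 (a + c); have h4 := sqr_ge0 (b + d).
have h5 := sqr_ge0 a; have h6 := sqr_ge0 b; have h7 := sqr_ge0 c; have h8 := sqr_ge0 d.
rewrite ler_norml; apply/andP; split; nra.
Qed.

Lemma ip_bound u v k :
  `|Re (ip u v k ord0 ord0)| <= sqnorm (u k) + sqnorm (v k) /\
  `|Im (ip u v k ord0 ord0)| <= sqnorm (u k) + sqnorm (v k).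
Proof.
have [-> ->] := ip_parts u v k; rewrite !sqnormE -big_split /=.
split; apply: le_trans (ler_norm_sum _ _ _) _; apply: ler_sum => a _.
  exact: ler_norm_cross.
have := ler_norm_cross (Re (v k a ord0)) (- Im (v k a ord0)) (Im (u k a ord0)) (Re (u k a ord0)).
by rewrite mulNr sqrrN => h; apply: le_trans h _; rewrite /sqc; lra.
Qed.

Lemma mslice_ip u v : L2 u -> L2 v -> mslice N (ip u v) origin.
Proof.
move=> L2u L2v a b; rewrite (ord1 a) (ord1 b).
have ui := L2_integrable L2u; have vi := L2_integrable L2v.
have [m1 m2] := measurable_ip (proj1 L2u) (proj1 L2v).
have uvi := integrableD (measurable_cube N) ui vi.
have E (f : point R N -> R) : measurable_fun (cube N) f ->
    (forall k, `|f k| <= sqnorm (u k) + sqnorm (v k)) -> slice_integrable N f origin.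
  move=> mf fb.
  have fi : mu.-integrable (cube N) (EFin \o f).
    apply: (le_integrable (measurable_cube N) _ _ uvi); first exact/measurable_EFinP.
    by move=> k _; rewrite /= lee_fin; apply: le_trans (fb k) (ler_norm _).
  by move: fi; apply: eq_integrable => // t _; rewrite /= glue_full.
by split; apply: E => // k; have [] := ip_bound u v k.
Qed.

Lemma vmeas_ip u v : vmeas u -> vmeas v -> vmeas (ip u v).
Proof. by move=> mu' mv a; rewrite (ord1 a); exact: measurable_ip. Qed.

Lemma eqL2_mavg_total (f g : point R N -> 'cV[R[i]]_1) : vmeas f -> vmeas g ->
  eqL2 f g -> mavg N f origin = mavg N g origin.
Proof.
move=> mf mg fg; apply/matrixP => a b; rewrite (ord1 b) !mavgE.
have E (h h' : point R N -> R) : measurable_fun (cube N) h -> measurable_fun (cube N) h' ->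
    {ae mu, forall k, cube N k -> h k = h' k} -> avg N h origin = avg N h' origin.
  move=> mh mh' hh'; rewrite /avg.
  rewrite (@eq_Rintegral _ _ _ mu (cube N) h); last by move=> t _; rewrite glue_full.
  rewrite [RHS](@eq_Rintegral _ _ _ mu (cube N) h'); last by move=> t _; rewrite glue_full.
  congr fine; apply: ae_eq_integral => //; try exact/measurable_EFinP.
  by apply: filterS hh' => k hk ck; rewrite hk.
have [f1 f2] := mf a; have [g1 g2] := mg a.
by congr Complex; apply: E => //; apply: filterS fg => k hk ck; rewrite hk.
Qed.

Lemma innerL2_eq u u' v v' : L2 u -> L2 u' -> L2 v -> L2 v' ->
  eqL2 u u' -> eqL2 v v' -> innerL2 u v = innerL2 u' v'.
Proof.
move=> [mu1 _] [mu2 _] [mv1 _] [mv2 _] uu' vv'; rewrite !innerL2E.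
rewrite (@eqL2_mavg_total (ip u v) (ip u' v')) //; try exact: vmeas_ip.
by move: uu' vv'; apply: filterS2 => k h1 h2 ck; rewrite /ip h1 // h2.
Qed.

Lemma innerL2D u u' v : L2 u -> L2 u' -> L2 v ->
  innerL2 (fun k => u k + u' k) v = innerL2 u v + innerL2 u' v.
Proof.
move=> L2u L2u' L2v; rewrite !innerL2E.
transitivity ((mavg N (ip u v) origin + mavg N (ip u' v) origin) ord0 ord0); last by rewrite [LHS]mxE.
rewrite -mavgD; [|exact: cube0|exact: mslice_ip..].
by congr (fun_of_matrix _ _ _); apply: eq_mavg => [|k _]; [exact: cube0|rewrite /ip mulmxDr].
Qed.

Lemma innerL2Dr u v v' : L2 u -> L2 v -> L2 v' ->
  innerL2 u (fun k => v k + v' k) = innerL2 u v + innerL2 u v'.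
Proof.
move=> L2u L2v L2v'; rewrite !innerL2E.
transitivity ((mavg N (ip u v) origin + mavg N (ip u v') origin) ord0 ord0); last by rewrite [LHS]mxE.
rewrite -mavgD; [|exact: cube0|exact: mslice_ip..].
by congr (fun_of_matrix _ _ _); apply: eq_mavg => [|k _]; [exact: cube0|rewrite /ip tJD mulmxDl].
Qed.

Lemma innerL2_mulmx (B : point R N -> 'M[R[i]]_M) u v :
  (forall k, cube N k -> (B k)^t* = B k) ->
  innerL2 (fun k => B k *m u k) v = innerL2 u (fun k => B k *m v k).
Proof.
move=> BB; rewrite !innerL2E; congr (fun_of_matrix _ _ _).
apply: eq_mavg => [|k ck]; first exact: cube0.
by rewrite /ip tJ_mulmx BB // mulmxA.
Qed.

(** Both sides equal the inner product of the two means: by the tower property the mean over the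
    first [s] coordinates may be taken beforehand, and the factor that is already such a mean comes
    out of it. *)
Lemma innerL2_mavg s u v : (s <= N)%N -> L2 u -> L2 v ->
  innerL2 (mavg s u) v = innerL2 u (mavg s v).
Proof.
move=> sN L2u L2v; have L2su := (L2_mavg sN L2u).1; have L2sv := (L2_mavg sN L2v).1.
have m1 := vmeas_ip (proj1 L2su) (proj1 L2sv).
transitivity (mavg N (ip (mavg s u) (mavg s v)) origin ord0 ord0); rewrite innerL2E.
  have si := mslice_ip L2su L2v; rewrite -(mavg_mavg sN si); last exact: cube0.
  congr (fun_of_matrix _ _ _); apply: eqL2_mavg_total => //.
    by apply: vmeas_mavg; apply: vmeas_ip; [case: L2su|case: L2v].
  have := ae_mslice sN L2v; apply: filterS => k hk ck.
  have iu := @invariant_mavg R s s N M 1 u (leqnn s).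
  by rewrite (mavg_mulmxr ck iu (mslice_tJ ck (hk ck))) -(tJ_mavg ck (hk ck)).
have si := mslice_ip L2u L2sv; rewrite -(mavg_mavg sN si); last exact: cube0.
congr (fun_of_matrix _ _ _); apply: eqL2_mavg_total => //.
  by apply: vmeas_mavg; apply: vmeas_ip; [case: L2u|case: L2sv].
have := ae_mslice sN L2u; apply: filterS => k hk ck.
rewrite mavg_mulmxl //; last exact: hk.
by move=> t k' ct ck'; rewrite (@invariant_mavg R s s N M 1 v (leqnn s)).
Qed.

End InnerProduct.

(** * Symmetry of the operator and adjoints of the matrix functions *)

Section Symmetric.
Variables (R : realType) (N M : nat).
Variable A : forall j : nat, point R (N - j) -> 'M[R[i]]_M.
Hypothesis A_continuous : forall j : nat, (j <= N)%N -> continuous_on_cube (A (j:=j)).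
Hypothesis A_hermitian : forall (j : nat) (k : point R (N - j)), (j <= N)%N ->
  cube (N - j) k -> (A (j:=j) k)^t* = A (j:=j) k.
Local Notation coef := (coef A).

Lemma coef_tJ j k : (j <= N)%N -> cube N k -> (coef j k)^t* = coef j k.
Proof.
move=> jN ck; apply: A_hermitian => // i.
have lt : (j + i < N)%N by rewrite -ltn_subRL.
have -> : tnth [tuple of drop j k] i = tnth k (Ordinal lt).
  by rewrite !(tnth_nth (0 : R)) /= nth_drop.
exact: ck.
Qed.

Lemma real_scalar_tJ (x : R) : ((x%:C)%C%:M : 'M[R[i]]_M)^t* = (x%:C)%C%:M.
Proof.
apply/matrixP => a b; rewrite !mxE eq_sym rmorphMn /=; congr (_ *+ _).
by apply: complexP; rewrite ?cReJ ?cImJ //= oppr0.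
Qed.

(** Each term is symmetric: [coef s] is Hermitian and, being independent of the first [s]
    coordinates, commutes with the symmetric operator [mavg s]. The shift is symmetric because [x]
    is real. *)
Lemma truncA_symmetric (x : R) j u v : (j <= N)%N -> L2 u -> L2 v ->
  innerL2 (truncA A (x%:C)%C j u) v = innerL2 u (truncA A (x%:C)%C j v).
Proof.
move=> + L2u L2v; elim: j => [|j IH] jN.
  have E w k : truncA A (x%:C)%C 0 w k = (coef 0 k - (x%:C)%C%:M) *m w k.
    by rewrite /truncA big_geq // addr0.
  rewrite (_ : truncA A _ 0 u = (fun k => (coef 0 k - (x%:C)%C%:M) *m u k)); last exact/funext/E.
  rewrite (_ : truncA A _ 0 v = (fun k => (coef 0 k - (x%:C)%C%:M) *m v k)); last exact/funext/E.
  apply: innerL2_mulmx => k ck; rewrite tJD coef_tJ //; congr (_ + _).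
  by rewrite -scaleN1r -[X in X *: _]/(- 1) scaleN1r -[in RHS]real_scalar_tJ;
    apply/matrixP => a b; rewrite !mxE rmorphN.
have E w : truncA A (x%:C)%C j.+1 w =
    (fun k => truncA A (x%:C)%C j w k + coef j.+1 k *m mavg j.+1 w k).
  by apply/funext => k; exact: truncAS.
have [L2T _ _ _] := bounded_operator_truncA A_continuous (x%:C)%C (ltnW jN).
have [L2c _ _ _] := bounded_operator_mulmx (mcont_coef A_continuous jN).
have L2m (w : vecfun R N M) : L2 w -> L2 (mavg j.+1 w : vecfun R N M) by move=> L2w; exact: (L2_mavg jN L2w).1.
rewrite !E innerL2D //; [|exact: L2T|exact/L2c/L2m].
rewrite innerL2Dr //; [|exact: L2T|exact/L2c/L2m].
rewrite IH; last exact: ltnW.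
congr (_ + _).
rewrite innerL2_mulmx; last by move=> k ck; exact: coef_tJ.
rewrite innerL2_mavg //; last exact: L2c.
apply: innerL2_eq => //; [exact/L2m/L2c|exact/L2c/L2m|exact: eqL2_refl|].
by apply: mavg_mulmx_eqL2 => //; exact: invariant_coef.
Qed.

Lemma operA_self_adjoint : self_adjoint (operA A).
Proof.
have E : operA A = truncA A (0%:C)%C N.
  apply/funext => u; apply/funext => k.
  by rewrite truncAE /sub_scalar scale0r subr0.
rewrite E; split; first exact: bounded_operator_truncA.
by move=> u v L2u L2v; exact: truncA_symmetric.
Qed.

Section RealPoint.
Variable x : R.
Local Notation lam := (x%:C)%C.
Local Notation Finv := (Finv A lam).
Local Notation G := (G A lam).
Local Notation Gbar := (Gbar A lam).
Local Notation H := (H A lam).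
Local Notation D := (D A lam).
Local Notation nonsingular := (nonsingular A lam).

Lemma F0_tJ k : cube N k -> (coef 0 k - lam%:M)^t* = coef 0 k - lam%:M.
Proof.
move=> ck; rewrite tJD coef_tJ //; congr (_ + _).
by rewrite -[in RHS]real_scalar_tJ; apply/matrixP => a b; rewrite !mxE rmorphN.
Qed.

(** For Hermitian P and B the adjoint of [(1 + P B)^-1 P] is [P (1 + B P)^-1], the same matrix by
    push-through. *)
Lemma Finv_tJ j k : (j <= N)%N -> nonsingular j.+1 -> cube N k ->
  (Finv j k)^t* = Finv j k.
Proof.
elim: j k => [|j IH] k jN ns ck; first by rewrite tJ_invmx F0_tJ.
have ns' := nonsingular_le (leqnSn _) ns.
have [cF _] := Finv_props A_continuous (ltnW jN) ns'.
have PJ : (mavg j.+1 (Finv j) k)^t* = mavg j.+1 (Finv j) k.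
  rewrite tJ_mavg //; last exact: mcont_mslice.
  by apply: eq_mavg => // k' ck'; apply: IH => //; exact: ltnW.
have [uG uGb] := ns j.+1 (ltnSn _) k ck.
rewrite (Finv_SE A_continuous jN ns ck).
rewrite (Gbar_SE A_continuous jN ns' ck) in uGb.
move: PJ uGb (coef_tJ jN ck); move: (mavg _ _ k) (coef _ k) => P B PJ uB BJ.
by rewrite tJ_mulmx tJ_invmx tJD tJ1 tJ_mulmx PJ BJ mulmx_invmx_1mul.
Qed.

Lemma G_tJ j k : (j <= N)%N -> nonsingular j -> cube N k -> (G j k)^t* = Gbar j k.
Proof.
case: j => [|j] jN ns ck; first exact: F0_tJ.
have [cF _] := Finv_props A_continuous (ltnW jN) ns.
rewrite (G_SE A_continuous jN ns ck) (Gbar_SE A_continuous jN ns ck).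
rewrite tJD tJ1 tJ_mulmx (coef_tJ jN ck) (tJ_mavg ck (mcont_mslice _ cF ck)).
congr (_ + _ *m _); apply: eq_mavg => // k' ck'.
exact: (Finv_tJ (ltnW jN) ns ck').
Qed.

Lemma prodG_tJ r k : (r <= N.+1)%N -> nonsingular r -> cube N k ->
  (prodG A lam r k)^t* = prodGbar A lam r k.
Proof.
move=> + + ck; elim: r => [|r IH] rN ns.
  by rewrite /prodG /prodGbar !big_nil tJ1.
have ns' := nonsingular_le (leqnSn _) ns.
rewrite prodGbarS /prodG big_mulmx_recr tJ_mulmx -/(prodG _ _ _ _) IH //; last exact: ltnW.
by rewrite G_tJ.
Qed.

Lemma D_tJ r k : (r <= N)%N -> nonsingular r.+1 -> cube N k -> (D r k)^t* = H r.+1 k.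
Proof.
by move=> rN ns ck; rewrite /Defs.D -/(prodG A lam r.+1 k) tJ_invmx prodG_tJ.
Qed.

Lemma H_tJ r k : (r <= N)%N -> nonsingular r.+1 -> cube N k -> (H r.+1 k)^t* = D r k.
Proof. by move=> rN ns ck; rewrite -D_tJ // trmxCK. Qed.

Lemma resolvent_formula_HE u k : nonsingular N.+1 -> cube N k ->
  resolvent_formula A lam u k = resolvent_formula_H A lam u k.
Proof.
move=> ns ck; have nsr r : (r <= N)%N -> nonsingular r.+1 by move=> rN; exact: nonsingular_le ns.
have D0 : D 0 k = H 1 k.
  by rewrite D0E (H_SE ck (nsr 0%N isT)) H0E mul1mx.
rewrite /resolvent_formula /resolvent_formula_H.
rewrite D0.
apply: (congr1 (fun w => H 1 k *m u k - w)).
apply: eq_big_nat => -[/andP[h _]|r /andP[_ rN]]; first by case: (notF h).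
rewrite [in LHS]mean1E.
rewrite mean1E.
apply: (congr1 (mulmx _)).
apply: (eq_mavg r.+1 ck) => k' ck'.
have rN' : (r.+1 <= N)%N by exact: rN.
by rewrite (H_tJ rN' (nsr _ rN') ck').
Qed.

Lemma resolvent_formula_DE u k : nonsingular N.+1 -> cube N k ->
  resolvent_formula A lam u k = resolvent_formula_D A lam u k.
Proof.
move=> ns ck; have nsr r : (r <= N)%N -> nonsingular r.+1 by move=> rN; exact: nonsingular_le ns.
rewrite /resolvent_formula /resolvent_formula_D.
apply: (congr1 (fun w => D 0 k *m u k - w)).
apply: eq_big_nat => -[/andP[h _]|r /andP[_ rN]]; first by case: (notF h).
have rN' : (r <= N)%N by apply: ltnW; exact: rN.
by rewrite (D_tJ rN' (nsr r rN') ck).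
Qed.

End RealPoint.
End Symmetric.

(** * Identification of the formula with the resolvent *)

Section ResolventFormula.
Variables (R : realType) (N M : nat).
Variable A : forall j : nat, point R (N - j) -> 'M[R[i]]_M.
Hypothesis A_continuous : forall j : nat, (j <= N)%N -> continuous_on_cube (A (j:=j)).
Variable lam : R[i].
Local Notation nonsingular := (nonsingular A lam).

Lemma bounded_operator_truncR j : (j <= N)%N -> nonsingular j.+1 ->
  bounded_operator (truncR A lam j).
Proof.
elim: j => [|j IH] jN ns.
  apply: bounded_operator_ext (bounded_operator_mulmx (mcont_D A_continuous jN ns)) => u k _.
  by rewrite /truncR big_geq // subr0.
have ns' := nonsingular_le (leqnSn _) ns.
have bH := bounded_operator_mulmx (mcontN (mcont_H A_continuous (leqW jN) ns')).
have bc := bounded_operator_mulmx (mcont_coef A_continuous jN).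
have bD := bounded_operator_mulmx (mcont_D A_continuous jN ns).
have bm := @bounded_operator_mavg R N M j.+1 jN.
have := bounded_operatorD (bounded_operator_comp bH (bounded_operator_comp bc
  (bounded_operator_comp bm bD))) (IH (ltnW jN) ns').
by apply: bounded_operator_ext => u k _; rewrite truncRS scaleN1r mulNmx.
Qed.

(** The formula R satisfies (A - lam) R u = u; applying [S], which is also a left inverse, gives R u
    = S u almost everywhere. *)
Lemma resolvent_formula_eqL2 S : is_resolvent (operA A) lam S ->
  forall u, L2 u -> eqL2 (S u) (resolvent_formula A lam u).
Proof.
move=> resS u L2u; have [[L2S eqS _ _] invS] := resS.
have ns : nonsingular N.+1 by exact: resolvent_nonsingular resS _.
have RE : truncR A lam N u = resolvent_formula A lam u.
  by apply/funext => k; exact: truncRE.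
have L2R := L2_truncR A_continuous (leqnn N) ns L2u.
have [TR _] := truncR_props A_continuous (leqnn N) ns L2u.
have TE : truncA A lam N (truncR A lam N u) = sub_scalar (operA A) lam (truncR A lam N u).
  by apply/funext => k; exact: truncAE.
have [L2T _ _ _] := bounded_operator_truncA A_continuous lam (leqnn N).
rewrite -RE; apply: eqL2_trans (invS _ L2R).2.
rewrite -TE; exact: (eqS _ _ L2u (L2T _ L2R) (eqL2_sym TR)).
Qed.

Lemma is_resolvent_formula S : is_resolvent (operA A) lam S ->
  is_resolvent (operA A) lam (resolvent_formula A lam).
Proof.
move=> resS; have [[L2S eqS _ _] invS] := resS.
have ns : nonsingular N.+1 by exact: resolvent_nonsingular resS _.
have RE : truncR A lam N = resolvent_formula A lam.
  by apply/funext => u; apply/funext => k; exact: truncRE.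
have TE : truncA A lam N = sub_scalar (operA A) lam.
  by apply/funext => u; apply/funext => k; exact: truncAE.
have [L2T _ _ _] := bounded_operator_truncA A_continuous lam (leqnn N).
split; first by rewrite -RE; exact: bounded_operator_truncR.
move=> u L2u; split.
  by rewrite -RE -TE; exact: (truncR_props A_continuous (leqnn N) ns L2u).1.
(* The left inverse property is inherited from [S], with which the formula agrees at (A - lam) u. *)
apply: eqL2_trans (invS u L2u).2; apply: eqL2_sym.
have L2Tu := L2T u L2u; rewrite TE in L2Tu.
exact: (resolvent_formula_eqL2 resS L2Tu).
Qed.

End ResolventFormula.

Theorem mainTheorem4 (R : realType) (N M : nat)
    (A : forall j : nat, point R (N - j) -> 'M[R[i]]_M)
    (N_gt0 : (0 < N)%N) (M_gt0 : (0 < M)%N)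
    (A_continuous : forall j : nat, (j <= N)%N -> continuous_on_cube (A j)) :
  (forall lam : R[i], ~ spectrum (operA A) lam ->
     (forall (j : nat) (k : point R N), (j <= N)%N -> cube N k ->
        G A lam j k \in unitmx /\ Gbar A lam j k \in unitmx) /\
     is_resolvent (operA A) lam (resolvent_formula A lam)) /\
  ((forall (j : nat) (k : point R (N - j)), (j <= N)%N -> cube (N - j) k ->
      (A j k)^t* = A j k) ->
   forall x : R, ~ spectrum (operA A) (x%:C)%C ->
     self_adjoint (operA A) /\
     (forall S : vecfun R N M -> vecfun R N M,
        is_resolvent (operA A) (x%:C)%C S ->
        self_adjoint S /\
        (forall u : vecfun R N M, L2 u ->
           eqL2 (S u) (resolvent_formula_H A (x%:C)%C u) /\
           eqL2 (S u) (resolvent_formula_D A (x%:C)%C u)))).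
Proof.
split=> [lam /contrapT[S resS]|hermA x _].
  split; last exact: is_resolvent_formula resS.
  by move=> j k jN ck; exact: (resolvent_nonsingular A_continuous resS (leqnn _)).
split=> [|S resS]; first exact: operA_self_adjoint.
have ns := resolvent_nonsingular A_continuous resS (leqnn _).
have [[L2S eqS linS bS] invS] := resS.
have TE : truncA A (x%:C)%C N = sub_scalar (operA A) (x%:C)%C.
  by apply/funext => u; apply/funext => k; exact: truncAE.
have [L2T _ _ _] := bounded_operator_truncA A_continuous (x%:C)%C (leqnn N).
split.
  split; first by split.
  move=> u v L2u L2v; have L2Su := L2S u L2u; have L2Sv := L2S v L2v.
  (* With T = A - x, which is symmetric, (S u, v) = (S u, T S v) = (T S u, S v) = (u, S v). *)
  rewrite (@innerL2_eq _ _ _ (S u) (S u) v (truncA A (x%:C)%C N (S v))) //; last 3 first.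
  - exact: L2T.
  - exact: eqL2_refl.
  - by apply: eqL2_sym; rewrite TE; exact: (invS v L2v).1.
  rewrite -truncA_symmetric //.
  apply: innerL2_eq => //; [exact: L2T| |exact: eqL2_refl].
  by rewrite TE; exact: (invS u L2u).1.
move=> u L2u; have E := resolvent_formula_eqL2 A_continuous resS L2u.
split; apply: eqL2_trans E _; apply: eqL2_cube => k ck.
  exact: resolvent_formula_HE.
exact: resolvent_formula_DE.
Qed.
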